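(* Let $f\in L^2(\mathbb{T})$ and $\frac12\le H<1$. Let $\Delta=(\Delta_n)_{n\in\mathbb{Z}}$ be the discrete complex fractional Gaussian noise of parameter $H$. If there exist $\alpha>H$ and $K>0$ such that $$|\hat f(n)|\le K|n|^{-\alpha}\quad\text{for all } n\ne0,$$ then the function $t\mapsto\sum_{n\in\mathbb{Z}}\hat f(n)\,\Delta_n e^{2\pi i n t}$ is bounded almost surely. In particular, if in addition $f\in C(\mathbb{T})$ but the series $\sum_{n\in\mathbb{Z}}|\hat f(n)|$ diverges, then $f\in\mathscr{P}(H)$ but $f\notin\mathbb{A}(\mathbb{T})$.
   Context: $\mathbb{T}=\mathbb{R}/\mathbb{Z}$ with normalized Lebesgue measure; $\hat f(n)=\int_{\mathbb{T}}f(t)e^{-2\pi i n t}\,dt$; $C(\mathbb{T})$ is the space of continuous functions $f:\mathbb{T}\to\mathbb{C}$; $\mathbb{A}(\mathbb{T})$ is the Wiener algebra of $f\in C(\mathbb{T})$ with $\sum_n|\hat f(n)|<\infty$. The discrete complex fractional Gaussian noise of parameter $H$ is the complex (jointly) Gaussian process $\Delta=(\Delta_n)_{n\in\mathbb{Z}}$ on a probability space $(\Omega,\mathscr{F},\mathbb{P})$ with mean $0$, $\mathbb{E}(\Delta_n\Delta_m)=0$, and covariance $$\mathbb{E}(\Delta_n\overline{\Delta_m})=\gamma(n-m)=\tfrac12|n-m+1|^{2H}+\tfrac12|n-m-1|^{2H}-|n-m|^{2H}.$$ Its spectral measure $\mu_\Delta$ is the Borel probability measure on $\mathbb{T}$ with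 $\gamma(n)=\int_{\mathbb{T}}e^{2\pi i n t}\,d\mu_\Delta(t)$ for all $n\in\mathbb{Z}$. The random series is understood as the Gaussian process of its $L^2(\mathbb{P})$-sums (limits of the partial sums over $|n|\le N$, for each $t\in\mathbb{T}$; this convergence is part of the assertion). For a Gaussian process $\{S(t):t\in\mathbb{T}\}$, ''bounded almost surely'' means that it has almost surely bounded sample paths (for a separable version; equivalently, $\sup_F\mathbb{E}\max_{t\in F}|S(t)|<\infty$, the supremum being over finite subsets $F$ of $\mathbb{T}$). For a Borel probability measure $\mu$ on $\mathbb{T}$ and $f\in C(\mathbb{T})$, let $f_t(u)=f(t+u)$. Let $(e_n)_{n\in A}$ (with $A\subset\mathbb{Z}$) be an orthonormal basis of $L^2(\mu,\mathbb{C})$, let $(Z_n)_{n\in A}$ be i.i.d. standard complex Gaussian random variables (so $\mathbb{E}Z_n=0$, $\mathbb{E}|Z_n|^2=1$, $\mathbb{E}Z_n^2=0$), and set $X_f(t)=\sum_{n\in A}\langle f_t,e_n\rangle Z_n$, where $\langle g,e_n\rangle=\int_{\mathbb{T}}g\,\overline{e_n}\,d\mu$, the series converging in $L^2(\mathbb{P})$; thus $\mathbb{E}(X_f(t)\overline{X_f(s)})=\int_{\mathbb{T}}f(t+u)\overline{f(s+u)}\,d\mu(u)$. $\mathscr{P}(\mu)$ is the class of $f\in C(\mathbb{T})$ such that $X_f$ has almost surely bounded paths, and $\mathscr{P}(H)=\mathscr{P}(\mu_\Delta)$. *)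

(* Defs.v *)
(* Functions on the circle T = R/Z are 1-periodic functions on R; measures on T
   are measures on R carried by the fundamental domain [0, 1[, over which all
   integrals on T are taken. *)
From HB Require Import structures.
From mathcomp Require Import all_boot all_order all_algebra.
From mathcomp Require Import complex.
From mathcomp Require Import all_classical all_reals all_analysis.

Set Implicit Arguments.
Unset Strict Implicit.
Unset Printing Implicit Defensive.

Import Order.TTheory GRing.Theory Num.Theory.
Import numFieldNormedType.Exports.

Local Open Scope classical_set_scope.
Local Open Scope ring_scope.
Local Open Scope complex_scope.

(* The real-valued modulus ([`|z|] on [R[i]] is valued in [R[i]]). *)
Definition cmod (R : realType) (z : R[i]) : R := ComplexField.Normc.normc z.

(* exp (2 i pi x) *)
Definition cexp1 (R : realType) (x : R) : R[i] :=
  cos (2 * pi * x) +i* sin (2 * pi * x).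

Definition cmeasurable d (T : measurableType d) (R : realType) (g : T -> R[i]) :
    Prop :=
  measurable_fun setT (fun x => complex.Re (g x)) /\
  measurable_fun setT (fun x => complex.Im (g x)).

Definition cint d (T : measurableType d) (R : realType)
    (mu : {measure set T -> \bar R}) (D : set T) (g : T -> R[i]) : R[i] :=
  Rintegral mu D (fun x => complex.Re (g x)) +i*
  Rintegral mu D (fun x => complex.Im (g x)).

Definition sqnorm d (T : measurableType d) (R : realType)
    (mu : {measure set T -> \bar R}) (D : set T) (g : T -> R[i]) : \bar R :=
  (\int[mu]_(x in D) ((cmod (g x)) ^+ 2)%:E)%E.

Definition cL2 d (T : measurableType d) (R : realType)
    (mu : {measure set T -> \bar R}) (D : set T) (g : T -> R[i]) : Prop :=
  cmeasurable g /\ (sqnorm mu D g < +oo)%E.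

Definition periodic1 (R : realType) (U : Type) (f : R -> U) : Prop :=
  forall x : R, f (x + 1) = f x.

Definition circle_dom (R : realType) : set R := [set` `[0%R, 1%R[ ].

Definition L2_circle (R : realType) (f : R -> R[i]) : Prop :=
  periodic1 f /\ cL2 (@lebesgue_measure R) (@circle_dom R) f.

Definition fourier_coef (R : realType) (f : R -> R[i]) (n : int) : R[i] :=
  cint (@lebesgue_measure R) (@circle_dom R)
    (fun t => f t * cexp1 (- (n%:~R * t))).

Definition C_circle (R : realType) (f : R -> R[i]) : Prop :=
  periodic1 f /\ continuous (f : R -> R[i]^o).

Definition wiener_algebra (R : realType) (f : R -> R[i]) : Prop :=
  C_circle f /\
  summable [set: int] (fun n => (cmod (fourier_coef f n))%:E).

Section processes.
Context d (Omega : measurableType d) (R : realType) (P : probability Omega R).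

Definition cexpect (X : Omega -> R[i]) : R[i] := cint P setT X.

(* A real Gaussian variable, possibly degenerate; [normal_prob m 0] is not the
   Dirac mass at [m], hence the case distinction. *)
Definition gaussian_rv (X : Omega -> R) : Prop :=
  measurable_fun setT X /\
  exists m : R,
    {ae P, forall w, X w = m} \/
    exists2 s : R, 0 < s &
      forall A : set R, measurable A -> P (X @^-1` A) = normal_prob m s A.

Definition complex_gaussian_process (I : Type) (X : I -> Omega -> R[i]) : Prop :=
  forall (N : nat) (i : 'I_N -> I) (a b : 'I_N -> R),
    gaussian_rv (fun w => \sum_(k < N)
      (a k * complex.Re (X (i k) w) + b k * complex.Im (X (i k) w))).

Definition standard_complex_gaussian (Z : Omega -> R[i]) : Prop :=
  [/\ complex_gaussian_process (fun _ : unit => Z),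
      cexpect Z = 0,
      cexpect (fun w => Z w * conjc (Z w)) = 1 &
      cexpect (fun w => Z w * Z w) = 0].

(* Mutual independence of the [Z n], [n] in [A]; the Borel sets of the complex
   plane are those of R * R. *)
Definition independent_family (A : set int) (Z : int -> Omega -> R[i]) : Prop :=
  (forall n, A n -> cmeasurable (Z n)) /\
  forall (s : seq int) (B : int -> set (R * R)),
    uniq s -> (forall n, n \in s -> A n) ->
    (forall n, n \in s -> measurable (B n)) ->
    P [set w | forall n, n \in s ->
                 B n (complex.Re (Z n w), complex.Im (Z n w))] =
    (\prod_(n <- s)
       P [set w | B n (complex.Re (Z n w), complex.Im (Z n w))])%E.

(* [S] is the L^2(P)-limit of the partial sums of [u n] over |n| <= N. *)
Definition L2_sum (u : int -> Omega -> R[i]) (S : Omega -> R[i]) : Prop :=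
  cL2 P setT S /\
  (fun N : nat => sqnorm P setT
     (fun w => (\sum_(k < (2 * N).+1%N) u (k%:Z - N%:Z) w) - S w)) @ \oo --> 0%E.

Definition version (S S' : R -> Omega -> R[i]) : Prop :=
  forall t, cmeasurable (S' t) /\ {ae P, forall w, S' t w = S t w}.

Definition separable_process (S : R -> Omega -> R[i]) : Prop :=
  exists2 D : set R, countable D &
    {ae P, forall w, forall t e : R, 0 < e ->
       exists s, [/\ D s, `|s - t| < e & cmod (S s w - S t w) < e]}.

Definition bounded_paths (S : R -> Omega -> R[i]) : Prop :=
  {ae P, forall w, exists M : R, forall t, cmod (S t w) <= M}.

(* A process indexed by the circle is bounded almost surely when it has a
   separable version with almost surely bounded sample paths. *)
Definition bounded_as (S : R -> Omega -> R[i]) : Prop :=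
  exists S' : R -> Omega -> R[i],
    [/\ forall w, periodic1 (fun t => S' t w), version S S',
        separable_process S' & bounded_paths S'].

End processes.

Definition fgn_cov (R : realType) (H : R) (k : int) : R :=
  2^-1 * (`|(k + 1)%:~R| `^ (2 * H)) + 2^-1 * (`|(k - 1)%:~R| `^ (2 * H))
  - `|k%:~R| `^ (2 * H).

Definition complex_fgn d (Omega : measurableType d) (R : realType)
    (P : probability Omega R) (H : R) (Delta : int -> Omega -> R[i]) : Prop :=
  [/\ complex_gaussian_process P Delta,
      forall n, cexpect P (Delta n) = 0,
      forall n m, cexpect P (fun w => Delta n w * Delta m w) = 0 &
      forall n m, cexpect P (fun w => Delta n w * conjc (Delta m w)) =
                  (fgn_cov H (n - m))%:C].

Definition circle_measure (R : realType) (mu : probability R R) : Prop :=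
  mu (@circle_dom R) = 1%E.

Definition fgn_spectral_measure (R : realType) (H : R) (mu : probability R R) :
    Prop :=
  circle_measure mu /\
  forall n : int,
    (fgn_cov H n)%:C = cint mu (@circle_dom R) (fun t => cexp1 (n%:~R * t)).

Definition inner (R : realType) (mu : probability R R) (g h : R -> R[i]) : R[i] :=
  cint mu (@circle_dom R) (fun u => g u * conjc (h u)).

Definition orthonormal_basis (R : realType) (mu : probability R R)
    (A : set int) (e : int -> R -> R[i]) : Prop :=
  [/\ forall n, A n -> cL2 mu (@circle_dom R) (e n),
      forall n m, A n -> A m -> inner mu (e n) (e m) = (n == m)%:R &
      forall g, cL2 mu (@circle_dom R) g -> forall eps : R, 0 < eps ->
        exists (s : seq int) (c : int -> R[i]),
          (forall n, n \in s -> A n) /\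
          (sqnorm mu (@circle_dom R)
             (fun u => g u - (\sum_(n <- s) c n * e n u))%R < eps%:E)%E].

(* The law of X_f does not depend on the orthonormal basis or on the Gaussian
   sequence, so all choices are allowed. *)
Definition class_P (R : realType) (mu : probability R R) (f : R -> R[i]) : Prop :=
  C_circle f /\
  forall (d : measure_display) (Omega : measurableType d)
    (P : probability Omega R) (A : set int) (e : int -> R -> R[i])
    (Z : int -> Omega -> R[i]),
    orthonormal_basis mu A e ->
    independent_family P A Z ->
    (forall n, A n -> standard_complex_gaussian P (Z n)) ->
    exists X : R -> Omega -> R[i],
      (forall t, L2_sum P (fun n w =>
         if n \in A then inner mu (fun u => f (t + u)) (e n) * Z n w else 0)
         (X t)) /\
      bounded_as P X.

Definition class_PH (R : realType) (H : R) (f : R -> R[i]) : Prop :=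
  forall mu : probability R R, fgn_spectral_measure H mu -> class_P mu f.

(* Main.v *)
Require Import Defs.
From mathcomp Require Import all_boot all_order all_algebra.
From mathcomp Require Import complex ring lra zify.
From mathcomp Require Import all_classical all_reals all_analysis.
From mathcomp Require Import measurable_realfun.

Set Implicit Arguments.
Unset Strict Implicit.
Unset Printing Implicit Defensive.

Import Order.TTheory GRing.Theory Num.Theory.
Import numFieldNormedType.Exports.

Local Open Scope classical_set_scope.
Local Open Scope ring_scope.
Local Open Scope complex_scope.

(** The variance of a sum [\sum_(n in s) a n * Delta n] is at most the value at
    [a] of the quadratic form [fgn_form] with kernel [fgn_cov H (n - m)]. For
    [1/2 <= H] this kernel is nonnegative, and its sum over an interval of [N]
    integers is exactly [N `^ (2 * H)], because fractional Gaussian noise is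
    the increment process of a self-similar process. Hence the dyadic block
    [2 ^ i < `|n| <= 2 ^ i.+1] of the random Fourier series, whose coefficients
    are at most [K * 2 ^ (- i * alpha)], has a variance of order
    [rho ^+ (2 * i)] with [rho = 2 `^ (H - alpha) < 1], uniformly in [t]
    ([fgn_form_block]).

    A Gaussian variable has all its moments controlled by its variance. A block
    is a trigonometric polynomial of degree at most [2 ^ i.+1], so that its
    supremum is controlled by its maximum over a grid of [8 ^ i] points; a
    moment of high order of this maximum is at most [8 ^ i] times the moment of
    one value, and the geometric decay wins ([block_bound_summable]). So the
    dyadic partial sums converge almost surely and uniformly in [t], to a
    process with continuous bounded paths. As only moments enter, the result
    ([random_fourier_series_bounded]) is stated for any family [W] that
    satisfies the moment bounds [fgn_moments].

    For the noise [Delta] these bounds come from the exponential moments of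
    centred Gaussian variables ([complex_fgn_moments]). For the class P(H), let
    [mu] be the spectral measure, [e] an orthonormal family and [Z] independent
    standard Gaussian variables. The map that sends [g] to
    [\sum_n inner mu g (e n) * Z n] is linear and, by Bessel's inequality and
    independence, bounded from L^2 of [mu] to every moment space
    ([gauss_psum_moments]). It sends the characters [cexp1 (n * u)] to a family
    [W] that satisfies [fgn_moments], since the spectral measure has the Fourier
    coefficients [fgn_cov H n] ([noise_of_spectral_measure]). It remains to see
    that the image of [u |-> f (t + u)] is the Fourier series of [f] driven by
    [W]. This holds for the Cesaro means of the Fourier series of [f], and these
    converge uniformly to [f] by Fejer's theorem ([fejer_uniform],
    [gauss_psum_fourier]). *)

(** * Complex-valued functions *)

Section modulus.
Context {R : realType}.
Implicit Types (z w : R[i]) (x y : R).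

Lemma cmod_sqr z : cmod z ^+ 2 = complex.Re z ^+ 2 + complex.Im z ^+ 2.
Proof. by case: z => a b; rewrite /cmod /= sqr_sqrtr// addr_ge0 ?sqr_ge0. Qed.

Lemma cmod_ge0 z : 0 <= cmod z.
Proof. by case: z => a b; exact: sqrtr_ge0. Qed.

Lemma cmodM z w : cmod (z * w) = cmod z * cmod w.
Proof. exact: ComplexField.Normc.normcM. Qed.

Lemma cmodN z : cmod (- z) = cmod z.
Proof. by case: z => a b; rewrite /cmod /= !sqrrN. Qed.

Lemma cmod0 : cmod (0 : R[i]) = 0.
Proof. exact: ComplexField.Normc.normc0. Qed.

Lemma cmod1 : cmod (1 : R[i]) = 1.
Proof. exact: ComplexField.Normc.normc1. Qed.

Lemma cmodC x : cmod (x%:C) = `|x|.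
Proof. by rewrite /cmod /= expr0n addr0 sqrtr_sqr. Qed.

Lemma cmod_conj z : cmod (conjc z) = cmod z.
Proof. by case: z => a b; rewrite /cmod /= sqrrN. Qed.

Lemma cmodD z w : cmod (z + w) <= cmod z + cmod w.
Proof. exact: le_normcD. Qed.

Lemma cmodBC z w : cmod (z - w) = cmod (w - z).
Proof. by rewrite -cmodN opprB. Qed.

Lemma cmod_leDB z w : cmod w <= cmod z + cmod (z - w).
Proof. by have := cmodD z (w - z); rewrite addrC subrK cmodBC. Qed.

Lemma cmod_sum (I : Type) (s : seq I) (Q : pred I) (F : I -> R[i]) :
  cmod (\sum_(i <- s | Q i) F i) <= \sum_(i <- s | Q i) cmod (F i).
Proof.
elim/big_rec2: _ => [|i x z _ h]; first by rewrite cmod0.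
by rewrite (le_trans (cmodD _ _))// lerD2l.
Qed.

Lemma normRe_le z : `|complex.Re z| <= cmod z.
Proof.
rewrite -[leRHS](ger0_norm (cmod_ge0 z)) -ler_sqr ?nnegrE//.
by rewrite !real_normK ?num_real// cmod_sqr lerDl sqr_ge0.
Qed.

Lemma normIm_le z : `|complex.Im z| <= cmod z.
Proof.
rewrite -[leRHS](ger0_norm (cmod_ge0 z)) -ler_sqr ?nnegrE//.
by rewrite !real_normK ?num_real// cmod_sqr lerDr sqr_ge0.
Qed.

Lemma cmod_le z : cmod z <= `|complex.Re z| + `|complex.Im z|.
Proof.
rewrite -ler_sqr ?nnegrE ?addr_ge0 ?cmod_ge0// cmod_sqr sqrrD.
by rewrite !real_normK ?num_real// lerD2r lerDl mulrn_wge0// mulr_ge0.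
Qed.

Lemma creD z w : complex.Re (z + w) = complex.Re z + complex.Re w.
Proof. by case: z w => [a b] [a' b']. Qed.

Lemma cimD z w : complex.Im (z + w) = complex.Im z + complex.Im w.
Proof. by case: z w => [a b] [a' b']. Qed.

Lemma creN z : complex.Re (- z) = - complex.Re z.
Proof. by case: z. Qed.

Lemma cimN z : complex.Im (- z) = - complex.Im z.
Proof. by case: z. Qed.

Lemma creM z w : complex.Re (z * w) =
  complex.Re z * complex.Re w - complex.Im z * complex.Im w.
Proof. by case: z w => [a b] [a' b']. Qed.

Lemma cimM z w : complex.Im (z * w) =
  complex.Re z * complex.Im w + complex.Im z * complex.Re w.
Proof. by case: z w => [a b] [a' b']. Qed.

Lemma cre_conj z : complex.Re (conjc z) = complex.Re z.
Proof. by case: z. Qed.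

Lemma cim_conj z : complex.Im (conjc z) = - complex.Im z.
Proof. by case: z. Qed.

Lemma cre_sum (I : Type) (s : seq I) (Q : pred I) (F : I -> R[i]) :
  complex.Re (\sum_(i <- s | Q i) F i) = \sum_(i <- s | Q i) complex.Re (F i).
Proof. by elim/big_rec2: _ => // i x z _ <-; rewrite creD. Qed.

Lemma cim_sum (I : Type) (s : seq I) (Q : pred I) (F : I -> R[i]) :
  complex.Im (\sum_(i <- s | Q i) F i) = \sum_(i <- s | Q i) complex.Im (F i).
Proof. by elim/big_rec2: _ => // i x z _ <-; rewrite cimD. Qed.

Lemma complexP z w : complex.Re z = complex.Re w ->
  complex.Im z = complex.Im w -> z = w.
Proof. by case: z w => [a b] [a' b'] /= -> ->. Qed.

Lemma mul_conj z : z * conjc z = (cmod z ^+ 2)%:C.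
Proof.
by apply: complexP; rewrite (creM, cimM) cre_conj cim_conj /= ?cmod_sqr; ring.
Qed.

End modulus.

Section cexp1.
Context {R : realType}.
Implicit Types x y : R.

Lemma cexp1D x y : cexp1 (x + y) = cexp1 x * cexp1 y.
Proof.
rewrite /cexp1 mulrDr; apply: complexP; rewrite (creM, cimM) /= (cosD, sinD)//.
by rewrite addrC.
Qed.

Lemma conj_cexp1 x : conjc (cexp1 x) = cexp1 (- x).
Proof. by rewrite /cexp1 /= mulrN cosN sinN. Qed.

Lemma cmod_cexp1 x : cmod (cexp1 x) = 1.
Proof.
apply/eqP; rewrite -(@eqrXn2 _ 2) ?cmod_ge0//.
by rewrite cmod_sqr /= cos2Dsin2 expr1n.
Qed.

Lemma cexp10 : cexp1 (0 : R) = 1.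
Proof. by rewrite /cexp1 mulr0 cos0 sin0. Qed.

Lemma cexp1_nat (n : nat) : cexp1 (n%:R : R) = 1.
Proof.
elim: n => [|n ih]; first exact: cexp10.
rewrite -natr1 cexp1D ih mul1r /cexp1 mulr1 mulr_natl.
by rewrite cos2pi sin2pi.
Qed.

Lemma cexp1_int (n : int) : cexp1 (n%:~R : R) = 1.
Proof.
case: n => n; first exact: cexp1_nat.
by rewrite NegzE mulrNz -conj_cexp1 cexp1_nat conjc1.
Qed.

Lemma cexp1_lip x y : cmod (cexp1 x - cexp1 y) <= 4 * pi * `|x - y|.
Proof.
have lip (f g : R -> R) : (forall x, is_derive x 1 f (g x)) ->
    (forall x, `|g x| <= 1) -> forall a b, `|f a - f b| <= `|a - b|.
  move=> df g1; have h a b : a <= b -> `|f b - f a| <= `|b - a|.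
    move=> ab; have [] := @MVT_segment R f g a b ab (fun x _ => df x).
      apply: continuous_subspaceT => z.
      by apply/differentiable_continuous/derivable1_diffP; case: (df z).
    by move=> c _ ->; rewrite normrM ler_piMl.
  move=> a b; have [|/ltW] := leP a b; first by move=> /h; rewrite distrC (distrC b).
  exact: h.
have sinlip := @lip _ _ (@is_derive_sin R).
have coslip := @lip _ _ (@is_derive_cos R).
rewrite (le_trans (cmod_le _))// creD cimD creN cimN /=.
have c1 : `|cos (2 * pi * x) - cos (2 * pi * y)| <= `|2 * pi * x - 2 * pi * y|.
  by apply: coslip => z; rewrite normrN ler_norml sin_le1 sin_geN1.
have s1 : `|sin (2 * pi * x) - sin (2 * pi * y)| <= `|2 * pi * x - 2 * pi * y|.
  by apply: sinlip => z; rewrite ler_norml cos_le1 cos_geN1.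
have e1 : `|2 * pi * x - 2 * pi * y| = 2 * pi * `|x - y|.
  by rewrite -mulrBr normrM ger0_norm// mulr_ge0// pi_ge0.
by rewrite (le_trans (lerD c1 s1))// e1; lra.
Qed.

Lemma continuous_cexp1_Re : continuous (fun x : R => complex.Re (cexp1 x)).
Proof.
move=> x; apply: (@continuous_comp _ _ _ (fun x => 2 * pi * x) cos).
  exact: mulrl_continuous.
exact: continuous_cos.
Qed.

Lemma continuous_cexp1_Im : continuous (fun x : R => complex.Im (cexp1 x)).
Proof.
move=> x; apply: (@continuous_comp _ _ _ (fun x => 2 * pi * x) sin).
  exact: mulrl_continuous.
exact: continuous_sin.
Qed.

End cexp1.

Section cmeasurable.
Context d (T : measurableType d) (R : realType).
Implicit Types f g : T -> R[i].

Lemma cmeasurable_cst c : cmeasurable (fun _ : T => c : R[i]).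
Proof. by split; exact: measurable_cst. Qed.

Lemma cmeasurableD f g : cmeasurable f -> cmeasurable g ->
  cmeasurable (fun x => f x + g x).
Proof.
move=> [fr fi] [gr gi]; split.
  by under eq_fun do rewrite creD; exact: measurable_funD.
by under eq_fun do rewrite cimD; exact: measurable_funD.
Qed.

Lemma cmeasurableM f g : cmeasurable f -> cmeasurable g ->
  cmeasurable (fun x => f x * g x).
Proof.
move=> [fr fi] [gr gi]; split.
  by under eq_fun do rewrite creM; apply: measurable_funB; exact: measurable_funM.
by under eq_fun do rewrite cimM; apply: measurable_funD; exact: measurable_funM.
Qed.

Lemma cmeasurable_conj f : cmeasurable f -> cmeasurable (fun x => conjc (f x)).
Proof.
move=> [fr fi]; split; first by under eq_fun do rewrite cre_conj.
by under eq_fun do rewrite cim_conj; exact: measurableT_comp.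
Qed.

Lemma cmeasurableN f : cmeasurable f -> cmeasurable (fun x => - f x).
Proof.
move=> [fr fi]; split.
  by under eq_fun do rewrite creN; exact: measurableT_comp.
by under eq_fun do rewrite cimN; exact: measurableT_comp.
Qed.

Lemma cmeasurableB f g : cmeasurable f -> cmeasurable g ->
  cmeasurable (fun x => f x - g x).
Proof. by move=> mf mg; apply: cmeasurableD => //; exact: cmeasurableN. Qed.

Lemma cmeasurable_sum (I : Type) (s : seq I) (Q : pred I) (F : I -> T -> R[i]) :
  (forall i, cmeasurable (F i)) ->
  cmeasurable (fun x => \sum_(i <- s | Q i) F i x).
Proof.
move=> mF; under eq_fun do rewrite -big_filter.
split.
  under eq_fun do rewrite cre_sum.
  by apply: measurable_sum => i; have [] := mF i.
under eq_fun do rewrite cim_sum.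
by apply: measurable_sum => i; have [] := mF i.
Qed.

Lemma measurable_cmod_sqr f : cmeasurable f ->
  measurable_fun setT (fun x => cmod (f x) ^+ 2).
Proof.
move=> [fr fi]; under eq_fun do rewrite cmod_sqr.
by apply: measurable_funD; exact: measurable_funX.
Qed.

Lemma measurable_cmod f : cmeasurable f -> measurable_fun setT (fun x => cmod (f x)).
Proof.
move=> mf.
have -> : (fun x => cmod (f x)) = (fun x => Num.sqrt (cmod (f x) ^+ 2)).
  by apply/funext => x; rewrite sqrtr_sqr ger0_norm ?cmod_ge0.
apply: measurableT_comp (measurable_cmod_sqr mf).
apply: continuous_measurable_fun; exact: sqrt_continuous.
Qed.

Lemma measurable_cmodX f n (D : set T) : cmeasurable f ->
  measurable_fun D (fun x => (cmod (f x) ^+ n)%:E).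
Proof.
move=> mf; apply/measurable_EFinP; apply: measurable_funX.
exact: measurable_funS (measurable_cmod mf).
Qed.

End cmeasurable.

(** * The covariance of fractional Gaussian noise *)

Section fgn_covariance.
Context {R : realType}.
Implicit Types (H : R) (k : int) (n : nat).

Lemma fgn_covN H k : fgn_cov H (- k) = fgn_cov H k.
Proof.
rewrite /fgn_cov (_ : - k + 1 = - (k - 1)); last by ring.
rewrite (_ : - k - 1 = - (k + 1)); last by ring.
by rewrite !mulrNz !normrN; ring.
Qed.

Lemma fgn_cov0 H : H != 0 -> fgn_cov H 0 = 1.
Proof.
move=> H0; rewrite /fgn_cov add0r sub0r mulrNz normrN !normr1 normr0 powR1.
by rewrite powR0 ?mulf_neq0// subr0; field.
Qed.

(** For [1/2 <= H] the function [x `^ (2 * H)] is convex and [fgn_cov] is half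
    of its second difference. *)
Lemma fgn_cov_ge0 H k : 2^-1 <= H -> 0 <= fgn_cov H k.
Proof.
move=> H2; have H1 : 1 <= 2 * H by lra.
wlog : k / 0 <= k.
  move=> h; have [/h//|k0] := leP 0 k.
  by rewrite -fgn_covN h// oppr_ge0 ltW.
case: k => // -[_|n _].
  by rewrite fgn_cov0// gt_eqF//; lra.
have n0 : (0 : R) <= n%:R by [].
have n2 : (0 : R) <= n.+2%:R by [].
rewrite /fgn_cov (_ : n.+1%:Z + 1 = n.+2%:Z); last by lia.
rewrite (_ : n.+1%:Z - 1 = n%:Z); last by lia.
rewrite -!pmulrn !normr_nat.
have h0 : (0 : R) <= 2^-1 by lra.
have h1 : (2^-1 : R) <= 1 by lra.
have := @convex_powR R _ H1 (Itv01 h0 h1) n.+2%:R n%:R.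
rewrite !inE /= !in_itv /= !andbT => /(_ n2 n0).
rewrite convRE [X in X `^ _ <= _]convRE /= /unstable.onem.
rewrite (_ : 1 - 2^-1 = 2^-1 :> R); last by lra.
rewrite (_ : 2^-1 * n.+2%:R + 2^-1 * n%:R = n.+1%:R :> R); last first.
  by rewrite -!natr1; field.
by rewrite subr_ge0.
Qed.

(** The noise is the increment process of a self-similar one: the variance of
    the sum of [N] consecutive terms is [N `^ (2 * H)], since the second
    differences telescope. *)
Lemma sum_fgn_cov H n : H != 0 ->
  \sum_(i < n) \sum_(j < n) fgn_cov H (i%:Z - j%:Z) = n%:R `^ (2 * H).
Proof.
move=> H0; pose p (k : nat) := (k%:R : R) `^ (2 * H).
have p0 : p 0 = 0 by rewrite /p powR0 ?mulf_neq0.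
have covS m : fgn_cov H m.+1 = 2^-1 * (p m.+2 - p m.+1) - 2^-1 * (p m.+1 - p m).
  rewrite /fgn_cov (_ : m.+1%:Z + 1 = m.+2%:Z); last by lia.
  rewrite (_ : m.+1%:Z - 1 = m%:Z); last by lia.
  by rewrite -!pmulrn !normr_nat -!/(p _); field.
have tel m : \sum_(i < m) fgn_cov H i.+1 = 2^-1 * (p m.+1 - p m) - 2^-1.
  elim: m => [|m ih]; last by rewrite big_ord_recr ih /= covS; ring.
  by rewrite big_ord0 p0 /p powR1 /=; ring.
have row m : \sum_(i < m) fgn_cov H (m%:Z - i%:Z) = \sum_(i < m) fgn_cov H i.+1.
  rewrite (reindex_inj rev_ord_inj) /=; apply: eq_bigr => i _; congr fgn_cov.
  by have := ltn_ord i; lia.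
have rowN m : \sum_(i < m) fgn_cov H (i%:Z - m%:Z) = \sum_(i < m) fgn_cov H i.+1.
  by rewrite -row; apply: eq_bigr => i _; rewrite -fgn_covN opprB.
rewrite -/(p n); elim: n => [|n ih]; first by rewrite big_ord0 p0.
rewrite big_ord_recr /=; under eq_bigr do rewrite big_ord_recr /=.
rewrite big_split /= ih big_ord_recr /= row rowN tel subrr fgn_cov0//.
by field.
Qed.

End fgn_covariance.

Section sym_range.

(** The integers [n] with [`|n| <= N], in the order in which [L2_sum] adds
    them. *)
Definition sym_range (N : nat) : seq int :=
  [seq k%:Z - N%:Z | k <- iota 0 (2 * N).+1].

Lemma mem_sym_range n N : (n \in sym_range N) = (absz n <= N)%N.
Proof.
apply/mapP/idP => [[k]|nN].
  by rewrite mem_iota => kN ->; lia.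
exists (absz (n + N%:Z)); last by lia.
by rewrite mem_iota; lia.
Qed.

Lemma uniq_sym_range N : uniq (sym_range N).
Proof. by rewrite map_inj_uniq ?iota_uniq// => i j; lia. Qed.

Lemma big_sym_range (V : nmodType) (F : int -> V) N :
  \sum_(k < (2 * N).+1%N) F (k%:Z - N%:Z) = \sum_(n <- sym_range N) F n.
Proof. by rewrite big_map -[iota _ _]/(index_iota 0 (2 * N).+1) big_mkord. Qed.

Lemma sym_range_split (V : nmodType) (F : int -> V) N M : (N <= M)%N ->
  \sum_(n <- sym_range M) F n =
  \sum_(n <- sym_range N) F n +
  \sum_(n <- sym_range M | (N < absz n)%N) F n.
Proof.
move=> NM; rewrite (bigID (fun n : int => (absz n <= N)%N)) /=; congr (_ + _).
  rewrite -big_filter; apply: perm_big; apply: uniq_perm.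
  - exact: filter_uniq (uniq_sym_range _).
  - exact: uniq_sym_range.
  - by move=> n; rewrite mem_filter !mem_sym_range; lia.
by apply: eq_bigl => n; rewrite ltnNge.
Qed.

Context {R : realType}.

Lemma sum_sym_range_fgn_cov (H : R) N : H != 0 ->
  \sum_(n <- sym_range N) \sum_(m <- sym_range N) fgn_cov H (n - m) =
  (2 * N).+1%:R `^ (2 * H).
Proof.
move=> H0; rewrite -big_sym_range -(sum_fgn_cov _ H0).
apply: eq_bigr => i _; rewrite -(big_sym_range (fun m => fgn_cov H (i%:Z - N%:Z - m))).
by apply: eq_bigr => j _; congr fgn_cov; lia.
Qed.

(** The quadratic form that bounds the variance of [\sum_(n <- s) c n * Delta n]. *)
Definition fgn_form (H : R) (s : seq int) (c : int -> R[i]) : R :=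
  \sum_(n <- s) \sum_(m <- s) cmod (c n) * cmod (c m) * fgn_cov H (n - m).

Lemma fgn_form_ge0 (H : R) s c : 2^-1 <= H -> 0 <= fgn_form H s c.
Proof.
move=> H2; apply: sumr_ge0 => n _; apply: sumr_ge0 => m _.
by rewrite !mulr_ge0 ?cmod_ge0 ?fgn_cov_ge0.
Qed.

(** For [`|n|] of order [L = 2 ^ i] the coefficients are at most
    [K * L `^ (- alpha)]. As [fgn_cov] is nonnegative, the form is at most the
    square of this bound times the sum of the covariances over [`|n| <= 2 * L],
    which self-similarity evaluates to [(4 * L + 1) `^ (2 * H)]. The result,
    of order [L `^ (2 * (H - alpha))], is geometric in the dyadic scale [i]. *)
Lemma fgn_form_block (H alpha K : R) (c : int -> R[i]) (i N M : nat) :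
  2^-1 <= H -> H < alpha -> 0 < K ->
  (forall n : int, n != 0 -> cmod (c n) <= K * `|n%:~R| `^ (- alpha)) ->
  (2 ^ i <= N)%N -> (N <= M)%N -> (M <= 2 ^ i.+1)%N ->
  fgn_form H [seq n <- sym_range M | (N < absz n)%N] c <=
  K ^+ 2 * 5 `^ (2 * H) * (2 `^ (H - alpha)) ^+ i ^+ 2.
Proof.
move=> H2 Ha K0 hc iN NM Mi.
have H0 : H != 0 by rewrite gt_eqF//; lra.
pose L : R := (2 ^ i)%:R.
have L0 : 0 < L by rewrite ltr0n expn_gt0.
have cL n : (N < absz n)%N -> cmod (c n) <= K * L `^ (- alpha).
  move=> Nn; have n0 : n != 0 by apply: contraTneq Nn => ->.
  rewrite (le_trans (hc _ n0))// ler_pM2l// !powRN lef_pV2 ?posrE ?powR_gt0 ?normr_gt0 ?intr_eq0//.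
  rewrite ge0_ler_powR ?nnegrE ?(ltW L0)//; first lra.
  rewrite -intr_norm -abszE -pmulrn ler_nat.
  by rewrite (leq_trans iN)// ltnW.
have B0 : 0 <= K * L `^ (- alpha) by rewrite mulr_ge0 ?powR_ge0// ltW.
apply: (@le_trans _ _ ((K * L `^ (- alpha)) ^+ 2 * (2 * M).+1%:R `^ (2 * H))).
  rewrite -sum_sym_range_fgn_cov// /fgn_form big_filter mulr_sumr.
  under eq_bigr do rewrite big_filter.
  rewrite big_mkcond /=; apply: ler_sum => n _; rewrite mulr_sumr; case: ifPn => [Nn|_].
    rewrite big_mkcond /=; apply: ler_sum => m _; case: ifPn => [Nm|_].
      by rewrite ler_wpM2r ?fgn_cov_ge0// expr2 ler_pM ?cmod_ge0 ?cL.
    by rewrite mulr_ge0 ?fgn_cov_ge0 ?sqr_ge0.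
  by apply: sumr_ge0 => m _; rewrite mulr_ge0 ?fgn_cov_ge0 ?sqr_ge0.
have ML : (2 * M).+1%:R <= 5 * L.
  by rewrite /L -natrM ler_nat; have := expn_gt0 2 i; rewrite expnS in Mi; lia.
apply: (@le_trans _ _ ((K * L `^ (- alpha)) ^+ 2 * (5 * L) `^ (2 * H))).
  by rewrite ler_wpM2l ?sqr_ge0// ge0_ler_powR ?nnegrE ?mulr_ge0// ?(ltW L0)//; lra.
rewrite powRM// ?(ltW L0)// exprMn.
have -> : 2 `^ (H - alpha) ^+ i = L `^ (- alpha) * L `^ H.
  rewrite -powRD; last by apply/implyP => _; rewrite gt_eqF.
  by rewrite addrC -powR_mulrn ?powR_ge0// powRAC powR_mulrn// -natrX.
rewrite exprMn (_ : L `^ (2 * H) = L `^ H ^+ 2); last first.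
  by rewrite mulrC powRrM powR_mulrn ?powR_ge0.
by rewrite le_eqVlt; apply/orP; left; apply/eqP; ring.
Qed.

End sym_range.
(** * Limits of nonnegative and of complex sequences *)

Section nonnegative_convergence.
Context {R : realType}.

Lemma cvge0_le (u : nat -> \bar R) : (forall n, (0 <= u n)%E) ->
  (u @ \oo --> 0%E) <->
  forall e : R, 0 < e -> exists N : nat, forall n, (N <= n)%N -> (u n <= e%:E)%E.
Proof.
move=> u0; split=> [/fine_cvgP[[N _ fN]] /cvgrPdist_lt h e e0|h].
  have [M _ hM] := h _ e0.
  exists (maxn N M) => n; rewrite geq_max => /andP[Nn Mn].
  rewrite -(fineK (fN _ Nn)) lee_fin.
  have := hM _ Mn; rewrite /= sub0r normrN ger0_norm ?fine_ge0//.
  exact: ltW.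
apply/fine_cvgP; split.
  have [N hN] := h 1 ltr01; exists N => // n /= Nn.
  by rewrite ge0_fin_numE// (le_lt_trans (hN _ Nn))// ltry.
apply/cvgrPdist_le => e e0; have [N hN] := h _ e0; exists N => // n /= Nn.
rewrite sub0r normrN ger0_norm ?fine_ge0//.
have un : u n \is a fin_num.
  by rewrite ge0_fin_numE// (le_lt_trans (hN _ Nn))// ltry.
by rewrite -lee_fin fineK// hN.
Qed.

Lemma nneseries_bounded_cvg (y : nat -> R) : (forall k, 0 <= y k) ->
  (\sum_(k <oo) (y k)%:E < +oo)%E -> cvgn (series y).
Proof.
move=> y0 yoo; apply: nondecreasing_is_cvgn.
  apply/nondecreasing_seqP => n.
  by rewrite /series /= big_nat_recr//= lerDl.
have yfin : (\sum_(k <oo) (y k)%:E)%E \is a fin_num.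
  by rewrite ge0_fin_numE// nneseries_ge0// => n _ _; rewrite lee_fin.
exists (fine (\sum_(k <oo) (y k)%:E)%E) => _ [n _ <-].
rewrite -lee_fin fineK// /series /= -sumEFin.
rewrite (@nneseries_split _ _ 0 n); last by move=> k _; rewrite lee_fin.
rewrite add0n leeDl// nneseries_ge0// => k _ _; rewrite lee_fin//.
Qed.

End nonnegative_convergence.

Section complex_limit.
Context {R : realType}.
Implicit Types (z : nat -> R[i]) (y : nat -> R).

Definition clim z : R[i] :=
  limn (fun k => complex.Re (z k)) +i* limn (fun k => complex.Im (z k)).

Lemma cmod_cvg z (a : R[i]) :
  (fun k => complex.Re (z k)) @ \oo --> complex.Re a ->
  (fun k => complex.Im (z k)) @ \oo --> complex.Im a ->
  (fun k => cmod (z k)) @ \oo --> cmod a.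
Proof.
move=> hr hi.
have e (x : R[i]) : cmod x = Num.sqrt (complex.Re x ^+ 2 + complex.Im x ^+ 2).
  by rewrite -cmod_sqr sqrtr_sqr ger0_norm ?cmod_ge0.
under eq_fun do rewrite e; rewrite e.
apply: continuous_cvg; first exact: sqrt_continuous.
by apply: cvgD; rewrite expr2; under eq_fun do rewrite expr2; apply: cvgM.
Qed.

(** A sequence whose increments are dominated by a convergent series converges,
    at the rate of the tails of that series. *)
Lemma clim_tail z y : (forall k, cmod (z k.+1 - z k) <= y k) ->
  cvgn (series y) ->
  [/\ (fun k => complex.Re (z k)) @ \oo --> complex.Re (clim z),
      (fun k => complex.Im (z k)) @ \oo --> complex.Im (clim z) &
      forall k, cmod (z k - clim z) <= limn (series y) - series y k].
Proof.
move=> zy cy.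
have y0 k : 0 <= y k by exact: le_trans (cmod_ge0 _) (zy k).
have zD k l : (k <= l)%N -> cmod (z l - z k) <= series y l - series y k.
  elim: l => [|l ih]; first by rewrite leqn0 => /eqP->; rewrite !subrr cmod0.
  rewrite leq_eqVlt => /predU1P[->|]; first by rewrite !subrr cmod0.
  rewrite ltnS => kl; rewrite -(subrKA (z l)) (le_trans (cmodD _ _))//.
  rewrite [series y l.+1]/series /= big_nat_recr//= -/(series y l).
  rewrite [series y l + y l]addrC -addrA; apply: lerD (zy l) _.
  exact: ih.
have ylim l : series y l <= limn (series y).
  apply: nondecreasing_cvgn_le => //; apply/nondecreasing_seqP => n.
  by rewrite /series /= big_nat_recr//= lerDl.
have cauchy (p : R[i] -> R) : (forall u v, `|p u - p v| <= cmod (u - v)) ->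
    cvgn (fun k => p (z k)).
  move=> hp; have -> : (fun k => p (z k)) =
      (fun k => p (z 0%N) + series (fun k => p (z k.+1) - p (z k)) k).
    by apply/funext => k; rewrite /series /= telescope_sumr// addrC subrK.
  apply: is_cvgD; first exact: is_cvg_cst.
  apply: normed_cvg; apply: (series_le_cvg _ y0 _ cy) => k.
    exact: normr_ge0.
  exact: le_trans (hp _ _) (zy k).
have cRe : cvgn (fun k => complex.Re (z k)).
  by apply: cauchy => u v; rewrite -creN -creD normRe_le.
have cIm : cvgn (fun k => complex.Im (z k)).
  by apply: cauchy => u v; rewrite -cimN -cimD normIm_le.
split; [exact: cRe|exact: cIm|move=> k].
have cvgk : (fun l => cmod (z l - z k)) @ \oo --> cmod (clim z - z k).
  by apply: cmod_cvg; under eq_fun do rewrite (creD, cimD);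
    rewrite (creD, cimD); apply: cvgD; [exact: cRe|exact: cvg_cst|exact: cIm|exact: cvg_cst].
rewrite cmodBC -(cvg_lim _ cvgk)//; apply: limr_le; first by apply/cvg_ex; eexists; exact: cvgk.
near=> l; rewrite (le_trans (zD k l _))//; last by rewrite lerD2r.
by near: l; exact: nbhs_infty_ge.
Unshelve. all: by end_near. Qed.

End complex_limit.
(** * Convergence in quadratic mean *)

Section integrals.
Context d (T : measurableType d) (R : realType).
Context (mu : {measure set T -> \bar R}).

Lemma ge0_integral_le_lin (D : set T) (a b : R) (f g h : T -> R) :
  measurable D -> 0 <= a -> 0 <= b ->
  measurable_fun setT f -> measurable_fun setT g -> measurable_fun setT h ->
  (forall x, 0 <= f x) -> (forall x, 0 <= g x) -> (forall x, 0 <= h x) ->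
  (forall x, D x -> h x <= a * f x + b * g x) ->
  (\int[mu]_(x in D) (h x)%:E <=
   a%:E * \int[mu]_(x in D) (f x)%:E + b%:E * \int[mu]_(x in D) (g x)%:E)%E.
Proof.
move=> mD a0 b0 mf mg mh f0 g0 h0 hfg.
have mE (k : T -> R) : measurable_fun setT k ->
    measurable_fun D (fun x => (k x)%:E).
  by move=> mk; apply/measurable_EFinP; exact: measurable_funTS.
rewrite -!ge0_integralZl//; do ?[exact: mE | by move=> *; rewrite lee_fin].
rewrite -ge0_integralD//; first last.
- by apply: measurable_funeM; exact: mE.
- by move=> x _; rewrite mule_ge0// lee_fin.
- by apply: measurable_funeM; exact: mE.
- by move=> x _; rewrite mule_ge0// lee_fin.
apply: ge0_le_integral => //; do ?[exact: mE | by move=> *; rewrite lee_fin].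
  by apply: emeasurable_funD; apply: measurable_funeM; exact: mE.
Qed.

Lemma sqnorm_ge0 (D : set T) f : (0 <= sqnorm mu D f)%E.
Proof. by apply: integral_ge0 => x _; rewrite lee_fin sqr_ge0. Qed.

(** A weight [r] close to 1 lets one of the two terms pass almost unchanged,
    which sums of geometrically decreasing blocks require. *)
Lemma sqnormD_weighted (D : set T) (r : R) f g :
  measurable D -> 0 < r < 1 -> cmeasurable f -> cmeasurable g ->
  (sqnorm mu D (fun x => (f x + g x)%R) <=
   ((1 - r)^-1)%:E * sqnorm mu D f + (r^-1)%:E * sqnorm mu D g)%E.
Proof.
move=> mD /andP[r0 r1] mf mg; apply: ge0_integral_le_lin => //.
- by rewrite invr_ge0 subr_ge0 ltW.
- by rewrite invr_ge0 ltW.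
- exact: measurable_cmod_sqr.
- exact: measurable_cmod_sqr.
- by apply: measurable_cmod_sqr; exact: cmeasurableD.
- by move=> x; exact: sqr_ge0.
- by move=> x; exact: sqr_ge0.
- by move=> x; exact: sqr_ge0.
move=> x _; set u := cmod (f x); set v := cmod (g x).
have uv : cmod (f x + g x) ^+ 2 <= (u + v) ^+ 2.
  by rewrite ler_sqr ?nnegrE ?addr_ge0 ?cmod_ge0// cmodD.
rewrite (le_trans uv)// -subr_ge0.
have -> : (1 - r)^-1 * u ^+ 2 + r^-1 * v ^+ 2 - (u + v) ^+ 2 =
    (r * u - (1 - r) * v) ^+ 2 / (r * (1 - r)).
  by field; rewrite !gt_eqF// subr_gt0.
by rewrite mulr_ge0 ?sqr_ge0// invr_ge0 mulr_ge0 ?subr_ge0 ?ltW.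
Qed.

Lemma sqnormD (D : set T) f g :
  measurable D -> cmeasurable f -> cmeasurable g ->
  (sqnorm mu D (fun x => (f x + g x)%R) <=
   2%:E * sqnorm mu D f + 2%:E * sqnorm mu D g)%E.
Proof.
move=> mD mf mg.
have h : 0 < (2^-1 : R) < 1 by rewrite invr_gt0 ltr0n invf_lt1 ?ltr1n.
have := sqnormD_weighted mD h mf mg; rewrite invrK.
by rewrite (_ : (1 - 2^-1)^-1 = 2 :> R)//; field.
Qed.

Lemma sqnormZ (D : set T) (c : R[i]) f : measurable D -> cmeasurable f ->
  sqnorm mu D (fun x => (c * f x)%R) = ((cmod c ^+ 2)%:E * sqnorm mu D f)%E.
Proof.
move=> mD mf; rewrite /sqnorm -ge0_integralZl//.
- by apply: eq_integral => x _; rewrite cmodM exprMn EFinM.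
- exact: measurable_cmodX.
- by move=> x _; rewrite lee_fin sqr_ge0.
- by rewrite lee_fin sqr_ge0.
Qed.

Lemma sqnorm_cvg0D (D : set T) (f g : nat -> T -> R[i]) : measurable D ->
  (forall n, cmeasurable (f n)) -> (forall n, cmeasurable (g n)) ->
  (fun n => sqnorm mu D (f n)) @ \oo --> 0%E ->
  (fun n => sqnorm mu D (g n)) @ \oo --> 0%E ->
  (fun n => sqnorm mu D (fun x => f n x + g n x)) @ \oo --> 0%E.
Proof.
move=> mD mf mg hf hg.
apply: (@squeeze_cvge _ _ _ _ (cst 0%E) _
  (fun n => (2%:E * sqnorm mu D (f n) + 2%:E * sqnorm mu D (g n))%E)).
- by apply: nearW => n; rewrite sqnorm_ge0/= sqnormD.
- exact: cvg_cst.
- have e0 : (2%:E * 0 + 2%:E * 0 = 0 :> \bar R)%E by rewrite mule0 adde0.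
  by rewrite -e0; apply: cvgeD; [rewrite mule0|exact: cvgeZl|exact: cvgeZl].
Qed.

Lemma ae_summable (Y : nat -> T -> R) :
  (forall k, measurable_fun setT (Y k)) -> (forall k x, 0 <= Y k x) ->
  (\sum_(k <oo) \int[mu]_x (Y k x)%:E < +oo)%E ->
  {ae mu, forall x, (\sum_(k <oo) (Y k x)%:E < +oo)%E}.
Proof.
move=> mY Y0 hY.
have mYE k : measurable_fun setT (fun x => (Y k x)%:E) by exact/measurable_EFinP.
have iY : mu.-integrable setT (fun x => (\sum_(k <oo) (Y k x)%:E)%E).
  apply/integrableP; split.
    by apply: ge0_emeasurable_sum => // k x _ _; rewrite lee_fin.
  under eq_integral.
    move=> x _; rewrite gee0_abs; first over.
    by apply: nneseries_ge0 => k _ _; rewrite lee_fin.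
  by rewrite integral_nneseries// => k x _; rewrite lee_fin.
have := integrable_ae measurableT iY.
apply: filterS => x /(_ Logic.I); rewrite ge0_fin_numE//.
by apply: nneseries_ge0 => k _ _; rewrite lee_fin.
Qed.

Lemma fatou_le (h_ : nat -> T -> R) (h : T -> R) (B : \bar R) :
  (forall n, measurable_fun setT (h_ n)) -> (forall n x, 0 <= h_ n x) ->
  measurable_fun setT h -> (forall x, 0 <= h x) ->
  {ae mu, forall x, h_ ^~ x @ \oo --> h x} ->
  (forall n, (\int[mu]_x (h_ n x)%:E <= B)%E) ->
  (\int[mu]_x (h x)%:E <= B)%E.
Proof.
move=> mh_ h_0 mh h0 hae hB.
have mh_E n : measurable_fun setT (fun x => (h_ n x)%:E) by exact/measurable_EFinP.
apply: (@le_trans _ _ (\int[mu]_x limn_einf (fun n => (h_ n x)%:E))%E).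
  apply: ae_ge0_le_integral => //.
  - by move=> x _; rewrite lee_fin.
  - exact/measurable_EFinP.
  - move=> x _; rewrite limn_einf_lim; apply: lime_ge; first exact: is_cvg_einfs.
    apply: nearW => n; apply: le_ereal_inf_tmp => _ [m /= _ <-].
    by rewrite lee_fin.
  - under eq_fun do rewrite limn_einf_lim.
    apply: (emeasurable_fun_cvg (fun n x => einfs (fun k => (h_ k x)%:E) n)).
      by move=> n; exact: measurable_fun_einfs.
    by move=> x _; exact: is_cvg_einfs.
  - move: hae; apply: filterS => x hx _.
    have : (fun n => (h_ n x)%:E) @ \oo --> (h x)%:E.
      by apply: cvg_EFin => //; exact: nearW.
    by move=> hx'; rewrite (cvg_limn_einf_sup hx').1.
apply: (le_trans (fatou _ _ _ _)) => //; first by move=> n x _; rewrite lee_fin.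
rewrite limn_einf_lim; apply: lime_le; first exact: is_cvg_einfs.
apply: nearW => n; apply: le_trans (hB n); apply: ereal_inf_lbound.
by exists n => //=; exact: leqnn.
Qed.

End integrals.

Lemma nneseries_geometric_lty (R : realType) (u : nat -> \bar R) (C r : R) :
  0 <= C -> 0 < r -> r < 1 ->
  (forall k, (0 <= u k)%E) -> (forall k, (u k <= (C * r ^+ k)%:E)%E) ->
  (\sum_(k <oo) u k < +oo)%E.
Proof.
move=> C0 r0 r1 u0 ur; apply: (@le_lt_trans _ _ (C * (1 - r)^-1)%:E); last first.
  by rewrite ltry.
apply: lime_le; first by apply: is_cvg_nneseries => n _ _; exact: u0.
apply: nearW => n; apply: (@le_trans _ _ (\sum_(0 <= k < n) (C * r ^+ k)%:E)%E).
  by apply: lee_sum.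
rewrite sumEFin lee_fin; apply: geometric_le_lim => //.
by rewrite ger0_norm// ltW.
Qed.

Section L2_limits.
Context d (T : measurableType d) (R : realType).
Context (P : probability T R).

Lemma integral_prob_cst (c : R) : (\int[P]_x c%:E = c%:E)%E.
Proof.
have := integral_cst P measurableT c%:E.
by rewrite [X in (_ * X)%E]probability_setT mule1.
Qed.

Lemma measurable_summable_set (Y : nat -> T -> R) :
  (forall k, measurable_fun setT (Y k)) -> (forall k x, 0 <= Y k x) ->
  measurable [set x | (\sum_(k <oo) (Y k x)%:E < +oo)%E].
Proof.
move=> mY Y0; rewrite -[X in measurable X]setTI.
apply: emeasurable_fun_infty_o => //.
apply: ge0_emeasurable_sum => // [k x _ _|k _]; first by rewrite lee_fin.
by apply/measurable_EFinP; exact: mY.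
Qed.

Lemma cmeasurable_clim_restr (G : set T) (z : nat -> T -> R[i]) :
  measurable G -> (forall k, cmeasurable (z k)) ->
  (forall x, G x ->
    (fun k => complex.Re (z k x)) @ \oo --> complex.Re (clim (z ^~ x)) /\
    (fun k => complex.Im (z k x)) @ \oo --> complex.Im (clim (z ^~ x))) ->
  cmeasurable (fun x => if x \in G then clim (z ^~ x) else 0).
Proof.
move=> mG mz zG.
have mI : measurable_fun setT (\1_G : T -> R) by exact: measurable_indic.
split.
  apply: (@measurable_fun_cvg _ _ _ _ (fun k x => complex.Re (z k x) * \1_G x)).
    by move=> k; apply: measurable_funM => //; have [] := mz k.
  move=> x _; rewrite indicE; case: (boolP (x \in G)) => [/set_mem/zG[h _]|_].
    by under eq_fun do rewrite mulr1.
  by under eq_fun do rewrite mulr0; exact: cvg_cst.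
apply: (@measurable_fun_cvg _ _ _ _ (fun k x => complex.Im (z k x) * \1_G x)).
  by move=> k; apply: measurable_funM => //; have [] := mz k.
move=> x _; rewrite indicE; case: (boolP (x \in G)) => [/set_mem/zG[_ h]|_].
  by under eq_fun do rewrite mulr1.
by under eq_fun do rewrite mulr0; exact: cvg_cst.
Qed.

Lemma cmod_cvg_subl (z : nat -> R[i]) (a b : R[i]) :
  (fun k => complex.Re (z k)) @ \oo --> complex.Re a ->
  (fun k => complex.Im (z k)) @ \oo --> complex.Im a ->
  (fun k => cmod (b - z k)) @ \oo --> cmod (b - a).
Proof.
move=> hr hi; apply: cmod_cvg; under eq_fun do rewrite (creD, cimD) (creN, cimN).
  by rewrite creD creN; apply: cvgB => //; exact: cvg_cst.
by rewrite cimD cimN; apply: cvgB => //; exact: cvg_cst.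
Qed.

Lemma sqnorm_cvg_subseq_ae (z : nat -> T -> R[i]) (W : T -> R[i]) :
  (forall n, cmeasurable (z n)) -> cmeasurable W ->
  (fun n => sqnorm P setT (fun x => z n x - W x)) @ \oo --> 0%E ->
  exists phi : nat -> nat, (forall k, (k <= phi k)%N) /\
    {ae P, forall x, (fun k => cmod (z (phi k) x - W x)) @ \oo --> (0 : R)}.
Proof.
move=> mz mW /cvge0_le h.
have {}h := h (fun n => sqnorm_ge0 _ _ _).
have hk k : exists n, (k <= n)%N /\
    (sqnorm P setT (fun x => (z n x - W x)%R) <= (2^-1 ^+ k)%:E)%E.
  have [|N hN] := h (2^-1 ^+ k); first by rewrite exprn_gt0// invr_gt0.
  by exists (maxn N k); split; [exact: leq_maxr|apply: hN; exact: leq_maxl].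
have [phi hphi] := choice hk.
exists phi; split=> [k|]; first by have [] := hphi k.
have : {ae P, forall x, (\sum_(k <oo) (cmod (z (phi k) x - W x)%R ^+ 2)%:E < +oo)%E}.
  apply: ae_summable.
  - by move=> k; apply: measurable_cmod_sqr; exact: cmeasurableB.
  - by move=> k x; exact: sqr_ge0.
  apply: (@nneseries_geometric_lty _ _ 1 2^-1) => //.
  - by lra.
  - by move=> k; exact: sqnorm_ge0.
  - by move=> k; rewrite mul1r; have [] := hphi k.
apply: filterS => x /nneseries_bounded_cvg h1.
have {h1}/cvg_series_cvg_0 h1 := h1 (fun k => sqr_ge0 _).
have -> : (fun k => cmod (z (phi k) x - W x)) =
    (fun k => Num.sqrt (cmod (z (phi k) x - W x) ^+ 2)).
  by apply/funext => k; rewrite sqrtr_sqr ger0_norm ?cmod_ge0.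
by rewrite -(sqrtr0 R); apply: continuous_cvg => //; exact: sqrt_continuous.
Qed.

(** Completeness: along a subsequence whose increments have norms at most
    [2 ^- k] the series of increments converges almost surely, and Fatou's
    lemma identifies its sum as the limit in quadratic mean. *)
Lemma sqnorm_complete (z : nat -> T -> R[i]) :
  (forall n, cmeasurable (z n)) ->
  (forall e : R, 0 < e -> exists N, forall m n, (N <= m)%N -> (N <= n)%N ->
    (sqnorm P setT (fun x => (z m x - z n x)%R) <= e%:E)%E) ->
  exists2 W : T -> R[i], cmeasurable W &
    (fun n => sqnorm P setT (fun x => z n x - W x)) @ \oo --> 0%E.
Proof.
move=> mz hz.
have hk k : exists N, forall m n, (N <= m)%N -> (N <= n)%N ->
    (sqnorm P setT (fun x => (z m x - z n x)%R) <= (4^-1 ^+ k)%:E)%E.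
  by apply: hz; rewrite exprn_gt0// invr_gt0.
have [N hN] := choice hk.
pose phi k := (k + \sum_(j < k.+1) N j)%N.
have phi_ge k : (k <= phi k)%N by exact: leq_addr.
have phi_geN k : (N k <= phi k)%N by rewrite /phi big_ord_recr /=; lia.
have phiS k : (phi k <= phi k.+1)%N by rewrite /phi (big_ord_recr k.+1) /=; lia.
pose D k x := z (phi k.+1) x - z (phi k) x.
have mD k : cmeasurable (D k) by exact: cmeasurableB.
(* An integrable majorant of [cmod (D k x)], from [y <= l + y ^+ 2 / l] with
   [l = 2 ^- k]. *)
pose Y k x := 2^-1 ^+ k + 2 ^+ k * cmod (D k x) ^+ 2.
have e2 k : 2 ^+ k * 2^-1 ^+ k = 1 :> R by rewrite -exprMn divff ?expr1n.
have DY k x : cmod (D k x) <= Y k x.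
  rewrite /Y; set u := cmod _; have := e2 k; set a := 2 ^+ k; set b := _ ^+ k => ab.
  have a0 : 0 < a by rewrite exprn_gt0.
  rewrite -subr_ge0 -(pmulr_rge0 _ a0).
  have -> : a * (b + a * u ^+ 2 - u) = a * b + (a * u) ^+ 2 - a * u by ring.
  rewrite ab; have := sqr_ge0 (a * u - 1); have := sqr_ge0 (a * u + 1).
  by rewrite !expr2; nra.
have Y0 k x : 0 <= Y k x by exact: le_trans (cmod_ge0 _) (DY k x).
have mY k : measurable_fun setT (Y k).
  apply: measurable_funD => //; apply: measurable_funM => //.
  exact: measurable_cmod_sqr.
have iY k : (\int[P]_x (Y k x)%:E <= (2 * 2^-1 ^+ k)%:E)%E.
  apply: (@le_trans _ _ ((2^-1 ^+ k)%:E * \int[P]_x (cst 1 x)%:E +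
      (2 ^+ k)%:E * sqnorm P setT (D k))%E).
    apply: ge0_integral_le_lin => //; do ?by rewrite exprn_ge0.
    - exact: measurable_cmod_sqr.
    - by move=> x; exact: sqr_ge0.
    - by move=> x _; rewrite mulr1.
  rewrite (integral_prob_cst 1).
  rewrite mule1 mulrDl mul1r EFinD leeD2l//.
  apply: (@le_trans _ _ ((2 ^+ k)%:E * (4^-1 ^+ k)%:E)%E).
    apply: lee_wpmul2l; first by rewrite lee_fin exprn_ge0.
    by apply: hN; rewrite ?phi_geN// (leq_trans (phi_geN k)).
  by rewrite -EFinM lee_fin -exprMn (_ : 2 / 4 = 2^-1)//; field.
pose G := [set x | (\sum_(k <oo) (Y k x)%:E < +oo)%E].
have mG : measurable G by exact: measurable_summable_set.
have aeG : {ae P, forall x, G x}.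
  apply: ae_summable => //; apply: (nneseries_geometric_lty _ _ _ _ iY) => //.
  - lra.
  - by move=> k; apply: integral_ge0 => x _; rewrite lee_fin.
have limG x : G x -> [/\
    (fun k => complex.Re (z (phi k) x)) @ \oo --> complex.Re (clim (fun k => z (phi k) x)),
    (fun k => complex.Im (z (phi k) x)) @ \oo --> complex.Im (clim (fun k => z (phi k) x)) &
    forall k, cmod (z (phi k) x - clim (fun k => z (phi k) x)) <=
      limn (series (Y ^~ x)) - series (Y ^~ x) k].
  move=> Gx; apply: clim_tail => [k|]; first exact: DY.
  exact: nneseries_bounded_cvg.
pose W x := if x \in G then clim (fun k => z (phi k) x) else 0.
have mW : cmeasurable W.
  apply: (@cmeasurable_clim_restr G (fun k => z (phi k))) => // x /limG[? ? _].
  by split.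
exists W => //; apply/cvge0_le; first by move=> n; exact: sqnorm_ge0.
move=> e e0; have [M hM] := hz _ e0; exists M => n Mn.
apply: (@fatou_le _ _ _ _ (fun k x => cmod (z n x - z (phi (k + M)%N) x) ^+ 2)).
- by move=> k; apply: measurable_cmod_sqr; exact: cmeasurableB.
- by move=> k x; exact: sqr_ge0.
- by apply: measurable_cmod_sqr; exact: cmeasurableB.
- by move=> x; exact: sqr_ge0.
- move: aeG; apply: filterS => x Gx.
  rewrite /W mem_set//; have [hr hi _] := limG x Gx.
  under eq_fun do rewrite expr2; rewrite expr2.
  have h := cmod_cvg_subl (b := z n x) hr hi; rewrite -(cvg_shiftn M) in h.
  by apply: cvgM.
- by move=> k; apply: hM => //; apply: leq_trans (phi_ge _); exact: leq_addl.
Qed.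

End L2_limits.

(** * Random Fourier series *)

Section random_fourier_series.
Context d (T : measurableType d) (R : realType) (P : probability T R).
Implicit Types (W : int -> T -> R[i]) (a : int -> R[i]).

(** The moment bounds of a Gaussian family with covariance [fgn_cov H]. In
    contrast with Gaussian laws, they pass to limits by Fatou's lemma alone. *)
Definition fgn_moments (H : R) W : Prop := forall q : nat,
  exists2 C : R, 0 <= C & forall (s : seq int) (c : int -> R[i]), uniq s ->
    (\int[P]_x (cmod (\sum_(n <- s) c n * W n x)%R ^+ (2 * q))%:E <=
     (C * fgn_form H s c ^+ q)%:E)%E.

Definition fourier_psum a W (N : nat) (t : R) (x : T) : R[i] :=
  \sum_(n <- sym_range N) a n * W n x * cexp1 (n%:~R * t).

Lemma cmeasurable_fourier_psum a W N t : (forall n, cmeasurable (W n)) ->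
  cmeasurable (fourier_psum a W N t).
Proof.
move=> mW; apply: cmeasurable_sum => n; apply: cmeasurableM; last exact: cmeasurable_cst.
by apply: cmeasurableM => //; exact: cmeasurable_cst.
Qed.

Lemma fourier_psum_int a W N t (k : int) x :
  fourier_psum a W N (t + k%:~R) x = fourier_psum a W N t x.
Proof.
apply: eq_bigr => n _; congr (_ * _).
by rewrite mulrDr cexp1D -intrM cexp1_int mulr1.
Qed.

Lemma fourier_psumB a W N M t x : (N <= M)%N ->
  fourier_psum a W M t x - fourier_psum a W N t x =
  \sum_(n <- [seq n <- sym_range M | (N < absz n)%N])
    (a n * cexp1 (n%:~R * t)) * W n x.
Proof.
move=> NM; rewrite /fourier_psum (sym_range_split _ NM) addrC addKr big_filter.
by apply: eq_bigr => n _; rewrite mulrAC.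
Qed.

(** A Lipschitz constant in [t] of the partial sums and of their increments. *)
Definition fourier_lip a W (N : nat) (x : T) : R :=
  \sum_(n <- sym_range N) 4 * pi * (`|n%:~R| * cmod (a n) * cmod (W n x)).

Lemma fourier_term_lip a W n t s x :
  cmod (a n * W n x * cexp1 (n%:~R * t) - a n * W n x * cexp1 (n%:~R * s)) <=
  4 * pi * (`|n%:~R| * cmod (a n) * cmod (W n x)) * `|t - s|.
Proof.
rewrite -mulrBr !cmodM.
have := cexp1_lip (n%:~R * t) (n%:~R * s); rewrite -mulrBr normrM => h.
rewrite (le_trans (ler_wpM2l _ h)) ?mulr_ge0 ?cmod_ge0//.
by rewrite le_eqVlt; apply/orP; left; apply/eqP; ring.
Qed.

Lemma fourier_lip_term_ge0 a W n x :
  0 <= 4 * pi * (`|n%:~R| * cmod (a n) * cmod (W n x)) :> R.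
Proof. by rewrite !mulr_ge0 ?pi_ge0 ?cmod_ge0. Qed.

Lemma fourier_psum_lip a W N t s x :
  cmod (fourier_psum a W N t x - fourier_psum a W N s x) <=
  fourier_lip a W N x * `|t - s|.
Proof.
rewrite /fourier_psum -sumrB (le_trans (cmod_sum _ _ _))// /fourier_lip mulr_suml.
by apply: ler_sum => n _; exact: fourier_term_lip.
Qed.

Lemma fourier_psumB_lip a W N M t s x : (N <= M)%N ->
  cmod ((fourier_psum a W M t x - fourier_psum a W N t x) -
        (fourier_psum a W M s x - fourier_psum a W N s x)) <=
  fourier_lip a W M x * `|t - s|.
Proof.
move=> NM; rewrite !fourier_psumB// !big_filter -sumrB (le_trans (cmod_sum _ _ _))//.
rewrite /fourier_lip mulr_suml big_mkcond /=; apply: ler_sum => n _; case: ifP => _.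
  by have := fourier_term_lip a W n t s x; rewrite ![a n * W n x * _]mulrAC.
by rewrite mulr_ge0// fourier_lip_term_ge0.
Qed.

Lemma measurable_fourier_lip a W N : (forall n, cmeasurable (W n)) ->
  measurable_fun setT (fourier_lip a W N).
Proof.
move=> mW; apply: measurable_sum => n; apply: measurable_funM => //.
by apply: measurable_funM => //; exact: measurable_cmod.
Qed.

Context (H alpha K : R) (W : int -> T -> R[i]) (a : int -> R[i]).
Context (H2 : 2^-1 <= H) (Ha : H < alpha) (K0 : 0 < K).
Context (mW : forall n, cmeasurable (W n)) (momW : fgn_moments H W).
Context (ha : forall n : int, n != 0 -> cmod (a n) <= K * `|n%:~R| `^ (- alpha)).

Let rho : R := 2 `^ (H - alpha).
Let psum := fourier_psum a W.
Let D0 : R := K ^+ 2 * 5 `^ (2 * H).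

Let rho0 : 0 < rho. Proof. by rewrite powR_gt0. Qed.
Let rho1 : rho < 1.
Proof.
rewrite /rho /powR pnatr_eq0 /= expR_lt1 pmulr_llt0 ?subr_lt0//.
by rewrite ln_gt0 ?ltr1n.
Qed.

Let mpsum N t : cmeasurable (psum N t).
Proof. exact: cmeasurable_fourier_psum. Qed.

Let mpsumB N M t : cmeasurable (fun x => psum M t x - psum N t x).
Proof. by apply: cmeasurableB. Qed.

Let D0_ge0 : 0 <= D0.
Proof. by rewrite mulr_ge0 ?sqr_ge0 ?powR_ge0. Qed.

Let ha_lip t n : n != 0 ->
  cmod (a n * cexp1 (n%:~R * t)) <= K * `|n%:~R| `^ (- alpha).
Proof. by move=> n0; rewrite cmodM cmod_cexp1 mulr1 ha. Qed.

Lemma moment_block q : exists2 C : R, 0 <= C & forall i N M t,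
  (2 ^ i <= N)%N -> (N <= M)%N -> (M <= 2 ^ i.+1)%N ->
  (\int[P]_x (cmod (psum M t x - psum N t x)%R ^+ (2 * q))%:E <=
   (C * (rho ^+ i ^+ 2) ^+ q)%:E)%E.
Proof.
have [C C0 hC] := momW q; exists (C * D0 ^+ q); first by rewrite mulr_ge0 ?exprn_ge0.
move=> i N M t iN NM Mi.
under eq_integral do rewrite /psum fourier_psumB//.
apply: (le_trans (hC _ _ _)); first by rewrite filter_uniq ?uniq_sym_range.
have hb := fgn_form_block H2 Ha K0 (@ha_lip t) iN NM Mi.
rewrite lee_fin -mulrA ler_wpM2l// -exprMn lerXn2r ?nnegrE ?fgn_form_ge0//.
by rewrite mulr_ge0 ?exprn_ge0// ltW.
Qed.

Lemma sqnorm_block : exists2 C : R, 0 <= C & forall i N M t,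
  (2 ^ i <= N)%N -> (N <= M)%N -> (M <= 2 ^ i.+1)%N ->
  (sqnorm P setT (fun x => (psum M t x - psum N t x)%R) <=
   (C * rho ^+ i ^+ 2)%:E)%E.
Proof.
have [C C0 hC] := moment_block 1; by exists C.
Qed.

(** The blocks are summed with geometric weights, so that the loss at each
    use of [sqnormD_weighted] is compensated by the decay of the next block. *)
Lemma sqnorm_dyadic : exists2 A : R, 0 <= A & forall k l t, (k <= l)%N ->
  (sqnorm P setT (fun x => (psum (2 ^ l) t x - psum (2 ^ k) t x)%R) <=
   (A * rho ^+ k ^+ 2)%:E)%E.
Proof.
have [C C0 hC] := sqnorm_block.
have r1 : 0 < 1 - rho by rewrite subr_gt0.
exists (C / (1 - rho) ^+ 2); first by rewrite divr_ge0 ?sqr_ge0.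
move=> k l t kl; rewrite -(subnK kl); move: (l - k)%N => m {l kl}; elim: m k => [|m ih] k.
  rewrite add0n /sqnorm; under eq_integral do rewrite subrr cmod0 expr2 mul0r.
  by rewrite integral0 lee_fin mulr_ge0 ?divr_ge0 ?sqr_ge0.
rewrite addSnnS.
have -> : (fun x => psum (2 ^ (m + k.+1)) t x - psum (2 ^ k) t x) =
    (fun x => (psum (2 ^ k.+1) t x - psum (2 ^ k) t x) +
              (psum (2 ^ (m + k.+1)) t x - psum (2 ^ k.+1) t x)).
  by apply/funext => x; rewrite [RHS]addrC subrKA.
have rr : 0 < rho < 1 by apply/andP.
apply: (le_trans (sqnormD_weighted P measurableT rr _ _)) => //.
have h1 := hC k (2 ^ k)%N (2 ^ k.+1)%N t (leqnn _) (leq_pexp2l (isT : (0 < 2)%N) (leqnSn k)) (leqnn _).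
have h2 := ih k.+1.
apply: (@le_trans _ _ (((1 - rho)^-1)%:E * (C * rho ^+ k ^+ 2)%:E +
   (rho^-1)%:E * (C / (1 - rho) ^+ 2 * rho ^+ k.+1 ^+ 2)%:E)%E).
  by apply: leeD; apply: lee_wpmul2l; rewrite ?lee_fin ?invr_ge0// ltW.
rewrite -!EFinM -EFinD lee_fin le_eqVlt; apply/orP; left; apply/eqP.
by rewrite (exprS rho k); field; rewrite !gt_eqF.
Qed.

(** A crude polynomial bound suffices here, since the grid has mesh
    [8 ^- i]. *)
Lemma integral_fourier_lip : exists2 B : R, 0 <= B & forall N,
  (\int[P]_x (fourier_lip a W N x)%:E <= (B * (N%:R * (2 * N).+1%:R))%:E)%E.
Proof.
have H0 : 0 < H by rewrite (lt_le_trans _ H2)// invr_gt0.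
have [C C0 hC] := momW 1.
have W2 n : (\int[P]_x (cmod (W n x) ^+ 2)%:E <= C%:E)%E.
  have := hC [:: n] (fun=> 1) isT.
  rewrite /fgn_form !big_seq1 cmod1 !mul1r subrr fgn_cov0 ?gt_eqF// expr1 mulr1 muln1.
  by under eq_integral do rewrite big_seq1 mul1r.
have pi4 : 0 <= 4 * pi :> R by rewrite mulr_ge0 ?pi_ge0.
pose B := 4 * pi * K * (1 + C).
have B0 : 0 <= B by rewrite !mulr_ge0 ?pi_ge0 ?addr_ge0// ltW.
exists B => // N; rewrite /fourier_lip.
under eq_integral do rewrite -sumEFin.
rewrite ge0_integral_sum//; last 2 first.
- move=> n; apply/measurable_EFinP; apply: measurable_funM => //.
  by apply: measurable_funM => //; exact: measurable_cmod.
- by move=> n x _; rewrite lee_fin fourier_lip_term_ge0.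
apply: (@le_trans _ _ (\sum_(n <- sym_range N) (B * N%:R)%:E)%E); last first.
  rewrite sumEFin lee_fin big_const_seq count_predT size_map size_iota.
  by rewrite iter_addr_0 -[_ *+ _]mulr_natr mulrA.
rewrite big_seq [leRHS]big_seq; apply: lee_sum => n; rewrite mem_sym_range => nN.
pose c := 4 * pi * (`|n%:~R| * cmod (a n)).
have c0 : 0 <= c by rewrite !mulr_ge0 ?pi_ge0 ?cmod_ge0.
have cN : c <= 4 * pi * (N%:R * K).
  rewrite /c ler_wpM2l//; have [->|n0] := eqVneq n 0.
    by rewrite mulr0z normr0 mul0r mulr_ge0// ltW.
  rewrite ler_pM ?cmod_ge0//.
    by rewrite -intr_norm -abszE -pmulrn ler_nat.
  rewrite (le_trans (ha n0))// ler_piMr ?(ltW K0)//.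
  rewrite -[leRHS](powRr0 `|n%:~R : R|); apply: ler_powR; last first.
    by rewrite oppr_le0 (le_trans (ltW H0))// ltW.
  by rewrite -intr_norm -abszE -pmulrn ler1n absz_gt0.
apply: (@le_trans _ _ (c%:E * \int[P]_x (cst 1 x)%:E +
    c%:E * \int[P]_x (cmod (W n x) ^+ 2)%:E)%E).
  apply: ge0_integral_le_lin => //.
  - exact: measurable_cmod_sqr.
  - apply: measurable_funM => //; apply: measurable_funM => //.
    exact: measurable_cmod.
  - by move=> x; exact: sqr_ge0.
  - by move=> x; exact: fourier_lip_term_ge0.
  - move=> x _; rewrite mulrA -mulrDr /= ler_wpM2l//.
    have := sqr_ge0 (cmod (W n x) - 1); rewrite sqrrB mulr1 expr1n mulr2n.
    by have := cmod_ge0 (W n x); move: (cmod _) (_ ^+ 2) => u v *; lra.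
rewrite (integral_prob_cst P 1).
apply: (@le_trans _ _ (c%:E * 1 + c%:E * C%:E)%E).
  by rewrite leeD2l// lee_wpmul2l// ?lee_fin.
rewrite -EFinM -EFinD lee_fin -mulrDr.
apply: (@le_trans _ _ (4 * pi * (N%:R * K) * (1 + C))).
  by rewrite ler_wpM2r ?addr_ge0.
by rewrite le_eqVlt; apply/orP; left; apply/eqP; rewrite /B; ring.
Qed.

(* Blocks have standard deviation of order [rho ^+ i]. Allowing the size
   [lam ^+ i] with [lam ^+ 2 = rho] leaves a factor [lam ^+ i] to pay for the
   maximum over the grid. *)
Let lam : R := Num.sqrt rho.
Let lam0 : 0 < lam. Proof. by rewrite /lam sqrtr_gt0. Qed.
Let lamE : lam ^+ 2 = rho. Proof. exact: sqr_sqrtr (ltW rho0). Qed.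
Let lam1 : lam < 1.
Proof. by rewrite -[ltRHS](sqrtr1 R) ltr_sqrt. Qed.

Let block i t x := psum (2 ^ i.+1) t x - psum (2 ^ i) t x.

Definition grid_sum q i x : R :=
  \sum_(j < 8 ^ i) cmod (block i (j%:R / (8 ^ i)%:R) x) ^+ (2 * q).

(** The first two terms bound the maximum over the grid, by
    [y <= l * (1 + (y / l) ^+ (2 * q))] with [l = lam ^+ i]; the last one is
    the oscillation between neighbours of the grid. The factor [1] gives both
    levels the shape required by [ge0_integral_le_lin]. *)
Definition block_bound q i x : R := lam ^+ i +
  1 * (lam ^+ i / (lam ^+ i) ^+ (2 * q) * grid_sum q i x +
       (8 ^ i)%:R^-1 * fourier_lip a W (2 ^ i.+1) x).

Lemma grid_sum_ge0 q i x : 0 <= grid_sum q i x.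
Proof. by apply: sumr_ge0 => j _; rewrite exprn_ge0 ?cmod_ge0. Qed.

Lemma measurable_grid_sum q i : measurable_fun setT (grid_sum q i).
Proof.
by apply: measurable_sum => j; apply: measurable_funX;
  exact: measurable_cmod (mpsumB _ _ _).
Qed.

Lemma fourier_lip_ge0 N x : 0 <= fourier_lip a W N x.
Proof. by apply: sumr_ge0 => n _; exact: fourier_lip_term_ge0. Qed.

(** On a block of degree at most [2 ^ i.+1] the maximum over the [8 ^ i] points
    of a grid controls the supremum: the rest is a Lipschitz term. A maximum
    over so few points costs little when a high moment is used. *)
Lemma block_le_bound q i t x : (0 < q)%N -> cmod (block i t x) <= block_bound q i x.
Proof.
move=> q0; have M0 : 0 < (8 ^ i)%:R :> R by rewrite ltr0n expn_gt0.
pose u := t - (Num.floor t)%:~R.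
have u01 : 0 <= u < 1.
  have /andP[h1 h2] := floor_itv t; rewrite intrD in h2.
  by rewrite subr_ge0 h1 /u ltrBlDl.
have -> : block i t x = block i u x.
  have e : t = u + (Num.floor t)%:~R by rewrite /u subrK.
  by rewrite [in LHS]e /block /psum !fourier_psum_int.
have [u0 u1] := andP u01.
pose j := Num.truncn (u * (8 ^ i)%:R).
have uM : 0 <= u * (8 ^ i)%:R by rewrite mulr_ge0 ?(ltW M0).
have /andP[j1 j2] := truncn_itv uM; rewrite -/j in j1 j2.
have jM : (j < 8 ^ i)%N.
  by rewrite -(ltr_nat R) (le_lt_trans j1)// -[ltRHS]mul1r ltr_pM2r.
pose v : R := j%:R / (8 ^ i)%:R.
have uv : `|u - v| <= (8 ^ i)%:R^-1.
  rewrite ger0_norm; last by rewrite subr_ge0 ler_pdivrMr.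
  rewrite lerBlDr /v -[X in X + _]mul1r -mulrDl ler_pdivlMr//.
  by rewrite addrC natr1 ltW.
have lip := fourier_psumB_lip a W u v x (leq_pexp2l (isT : (0 < 2)%N) (leqnSn i)).
have lamn : 0 < lam ^+ i by rewrite exprn_gt0.
have gv : cmod (block i v x) ^+ (2 * q) <= grid_sum q i x.
  rewrite /grid_sum (bigD1 (Ordinal jM)) //= lerDl.
  by apply: sumr_ge0 => k _; rewrite exprn_ge0 ?cmod_ge0.
have bv : cmod (block i v x) <=
    lam ^+ i + lam ^+ i / (lam ^+ i) ^+ (2 * q) * grid_sum q i x.
  set l := lam ^+ i in lamn *; set y := cmod _ in gv *.
  have yl : y / l <= 1 + (y / l) ^+ (2 * q).
    have yl0 : 0 <= y / l by rewrite divr_ge0 ?cmod_ge0 ?ltW.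
    have [y1|/ltW y1] := leP (y / l) 1.
      by rewrite (le_trans y1)// lerDl exprn_ge0.
    by rewrite (@le_trans _ _ ((y / l) ^+ (2 * q)))// ?lerDr// ler_eXnr// muln_gt0.
  have -> : y = l * (y / l) by rewrite mulrC divfK ?gt_eqF.
  rewrite (le_trans (ler_wpM2l (ltW lamn) yl))// mulrDr mulr1 lerD2l.
  by rewrite -mulrA ler_wpM2l ?(ltW lamn)// expr_div_n mulrC ler_wpM2l// invr_ge0 exprn_ge0// ltW.
rewrite -(subrK (block i v x) (block i u x)) (le_trans (cmodD _ _))//.
rewrite /block_bound mul1r addrA [leRHS]addrC; apply: lerD bv.
apply: le_trans lip _; rewrite mulrC ler_wpM2r ?fourier_lip_ge0//.
Qed.

Lemma measurable_block_bound q i : measurable_fun setT (block_bound q i).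
Proof.
apply: measurable_funD => //; apply: measurable_funM => //.
apply: measurable_funD; apply: measurable_funM => //.
  exact: measurable_grid_sum.
exact: measurable_fourier_lip.
Qed.

Lemma block_bound_ge0 q i x : 0 <= block_bound q i x.
Proof.
rewrite /block_bound mul1r !addr_ge0 ?exprn_ge0 ?(ltW lam0)// mulr_ge0 ?invr_ge0//.
- by rewrite divr_ge0 ?exprn_ge0 ?ltW.
- exact: grid_sum_ge0.
- exact: fourier_lip_ge0.
Qed.

Lemma block_bound_summable : exists2 q, (0 < q)%N &
  (\sum_(i <oo) \int[P]_x (block_bound q i x)%:E < +oo)%E.
Proof.
(* For this moment the gain [lam ^+ (2 * q * i)] outweighs the [8 ^+ i] points
   of the grid. *)
have [q hq] : exists q, 8 * lam ^+ (2 * q) <= 1.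
  have /cvgrPdist_lt h : (fun n => rho ^+ n) @ \oo --> (0 : R).
    by apply: cvg_expr; rewrite ger0_norm// ltW.
  have [//|q _ hq] := h 8^-1; exists q.
  have := hq q (leqnn _); rewrite /= sub0r normrN ger0_norm ?exprn_ge0 ?(ltW rho0)//.
  by rewrite exprM lamE => /ltW; rewrite -[8^-1]mulr1 ler_pdivlMl.
have q0 : (0 < q)%N.
  by rewrite lt0n; apply: contraTneq hq => ->; rewrite muln0 expr0 mulr1 -ltNge ltr1n.
have exp_eq i : (2 * (i * (2 * q)) = i * (2 * q) + 2 * q * i)%N.
  by clear; lia.
have [C C0 hC] := moment_block q.
have [B B0 hB] := integral_fourier_lip.
exists q => //; pose r := Num.max lam 2^-1.
have r0 : 0 < r by rewrite lt_max lam0.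
have r1 : r < 1 by rewrite gt_max lam1 invf_lt1 ?ltr1n.
apply: (@nneseries_geometric_lty _ _ (1 + (C + 10 * B)) r) => //.
- by rewrite !addr_ge0// mulr_ge0.
- by move=> i; apply: integral_ge0 => x _; rewrite lee_fin block_bound_ge0.
move=> i; pose h x := lam ^+ i / (lam ^+ i) ^+ (2 * q) * grid_sum q i x +
       (8 ^ i)%:R^-1 * fourier_lip a W (2 ^ i.+1) x.
have lamn : 0 < lam ^+ i by rewrite exprn_gt0.
have c0 : 0 <= lam ^+ i / (lam ^+ i) ^+ (2 * q) by rewrite divr_ge0 ?exprn_ge0// ltW.
have h0 x : 0 <= h x.
  by apply: addr_ge0; apply: mulr_ge0 => //; [exact: grid_sum_ge0|exact: fourier_lip_ge0].
have mh : measurable_fun setT h.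
  apply: measurable_funD; apply: measurable_funM => //.
    exact: measurable_grid_sum.
  exact: measurable_fourier_lip.
have ig : (\int[P]_x (grid_sum q i x)%:E <= ((8 ^ i)%:R * (C * (rho ^+ i ^+ 2) ^+ q))%:E)%E.
  rewrite /grid_sum; under eq_integral do rewrite -sumEFin.
  rewrite ge0_integral_sum//; last 2 first.
  - by move=> j; exact: measurable_cmodX (mpsumB _ _ _).
  - by move=> j x _; rewrite lee_fin exprn_ge0 ?cmod_ge0.
  apply: (@le_trans _ _ (\sum_(j < 8 ^ i) (C * (rho ^+ i ^+ 2) ^+ q)%:E)%E).
    by apply: lee_sum => j _; apply: hC => //; rewrite leq_exp2l.
  by rewrite sumEFin sumr_const card_ord mulr_natl.
have ih : (\int[P]_x (h x)%:E <= ((C + 10 * B) * r ^+ i)%:E)%E.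
  apply: (@le_trans _ _ ((lam ^+ i / (lam ^+ i) ^+ (2 * q))%:E *
      \int[P]_x (grid_sum q i x)%:E + ((8 ^ i)%:R^-1)%:E *
      \int[P]_x (fourier_lip a W (2 ^ i.+1) x)%:E)%E).
    apply: ge0_integral_le_lin => //.
    - exact: measurable_grid_sum.
    - exact: measurable_fourier_lip.
    - by move=> x; exact: grid_sum_ge0.
    - by move=> x; exact: fourier_lip_ge0.
  rewrite mulrDl EFinD; apply: leeD.
    apply: (le_trans (lee_wpmul2l _ ig)); first by rewrite lee_fin.
    rewrite -EFinM lee_fin.
    have -> : lam ^+ i / (lam ^+ i) ^+ (2 * q) * ((8 ^ i)%:R * (C * (rho ^+ i ^+ 2) ^+ q)) =
        C * (lam ^+ i * (8 * lam ^+ (2 * q)) ^+ i).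
      rewrite -lamE natrX [(8 * _) ^+ i]exprMn -!exprM.
      rewrite exp_eq exprD; have := exprn_gt0 (i * (2 * q)) lam0.
      move: (lam ^+ (i * (2 * q))) (lam ^+ (2 * q * i)) (8 ^+ i) (lam ^+ i) => u v w z u0.
      by field; rewrite gt_eqF.
    rewrite ler_wpM2l//; apply: (@le_trans _ _ (lam ^+ i)).
      by rewrite ler_piMr ?(ltW lamn)// exprn_ile1// mulr_ge0 ?exprn_ge0 ?(ltW lam0).
    by rewrite lerXn2r ?nnegrE ?(ltW lam0) ?(ltW r0)// le_max lexx.
  apply: (le_trans (lee_wpmul2l _ (hB _))); first by rewrite lee_fin invr_ge0.
  rewrite -EFinM lee_fin.
  apply: (@le_trans _ _ (10 * B * 2^-1 ^+ i)); last first.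
    rewrite ler_wpM2l ?mulr_ge0// lerXn2r ?nnegrE ?invr_ge0 ?(ltW r0)//.
    by rewrite le_max lexx orbT.
  rewrite ler_pdivrMl ?ltr0n ?expn_gt0//.
  have -> : (8 ^ i)%:R * (10 * B * 2^-1 ^+ i) = B * (10 * (2 ^ i)%:R ^+ 2) :> R.
    rewrite (_ : 8 = 2 ^ 3)%N// -expnM mulnC expnM natrX exprVn.
    by rewrite natrX; field; rewrite expf_neq0.
  rewrite ler_wpM2l// -natrM -natrX -natrM ler_nat expnS -mulnn.
  have := expn_gt0 2 i; move: (2 ^ i)%N => m /= m0.
  by clear -m0; nia.
apply: (@le_trans _ _ ((lam ^+ i)%:E * \int[P]_x (cst 1 x)%:E +
    1%:E * \int[P]_x (h x)%:E)%E).
  apply: ge0_integral_le_lin => //; rewrite ?(ltW lamn)//.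
  - exact: measurable_block_bound.
  - by move=> x; exact: block_bound_ge0.
  - by move=> x _; rewrite mulr1.
rewrite (integral_prob_cst P 1) mule1 mul1e mulrDl mul1r EFinD; apply: leeD => //.
by rewrite lee_fin lerXn2r ?nnegrE ?(ltW lam0) ?(ltW r0)// le_max lexx.
Qed.

(** The dyadic partial sums converge almost surely, uniformly in [t], because
    their increments are dominated by the summable [block_bound]. The limit,
    set to 0 on the exceptional event, has continuous bounded paths, so that
    it is its own separable version; Fatou's lemma identifies it with the sum
    in quadratic mean. *)
Theorem random_fourier_series_bounded : exists S : R -> T -> R[i],
  (forall t : R, L2_sum P (fun n w => a n * W n w * cexp1 (n%:~R * t)) (S t)) /\
  bounded_as P S.
Proof.
have [q q0 sumY] := block_bound_summable.
pose Y := block_bound q.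
pose G := [set x | (\sum_(i <oo) (Y i x)%:E < +oo)%E].
have mG : measurable G.
  by apply: measurable_summable_set; [exact: measurable_block_bound|exact: block_bound_ge0].
have aeG : {ae P, forall x, G x}.
  by apply: ae_summable => //; [exact: measurable_block_bound|exact: block_bound_ge0].
pose dy t k x := psum (2 ^ k) t x.
have limG t x : G x -> [/\
    (fun k => complex.Re (dy t k x)) @ \oo --> complex.Re (clim (dy t ^~ x)),
    (fun k => complex.Im (dy t k x)) @ \oo --> complex.Im (clim (dy t ^~ x)) &
    forall k, cmod (dy t k x - clim (dy t ^~ x)) <=
      limn (series (Y ^~ x)) - series (Y ^~ x) k].
  move=> Gx; apply: clim_tail => [k|]; first exact: block_le_bound.
  by apply: nneseries_bounded_cvg => // k; exact: block_bound_ge0.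
pose S t x := if x \in G then clim (dy t ^~ x) else 0.
have mS t : cmeasurable (S t).
  apply: (@cmeasurable_clim_restr _ _ _ G (dy t)) => // [k|x /(limG t)[? ? _]].
    exact: mpsum.
  by split.
have mSB t k : cmeasurable (fun x => psum k t x - S t x) by exact: cmeasurableB.
have cvgS t : (fun N => sqnorm P setT (fun x => psum N t x - S t x)) @ \oo --> 0%E.
  have [C C0 hC] := sqnorm_block; have [A A0 hA] := sqnorm_dyadic.
  have dyS k : (sqnorm P setT (fun x => (psum (2 ^ k) t x - S t x)%R) <=
      (A * rho ^+ k ^+ 2)%:E)%E.
    apply: (@fatou_le _ _ _ _ (fun l x => cmod (dy t k x - dy t (l + k)%N x) ^+ 2)).
    - by move=> l; exact: measurable_cmod_sqr (mpsumB _ _ _).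
    - by move=> l x; exact: sqr_ge0.
    - exact: measurable_cmod_sqr (mSB _ _).
    - by move=> x; exact: sqr_ge0.
    - move: aeG; apply: filterS => x Gx.
      rewrite /S mem_set//; have [hr hi _] := limG t x Gx.
      under eq_fun do rewrite expr2; rewrite expr2.
      have h := cmod_cvg_subl (b := dy t k x) hr hi; rewrite -(cvg_shiftn k) in h.
      by apply: cvgM.
    - move=> l; under eq_integral do rewrite cmodBC.
      by apply: hA; exact: leq_addl.
  apply/cvge0_le; first by move=> N; exact: sqnorm_ge0.
  move=> e e0.
  have /cvgrPdist_lt h : (fun n => (2 * C + 2 * A) * (rho ^+ 2) ^+ n) @ \oo --> (0 : R).
    rewrite -(mulr0 (2 * C + 2 * A)); apply: cvgMr.
    apply: cvg_expr; rewrite ger0_norm ?exprn_ge0 ?(ltW rho0)//.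
    by rewrite expr_lt1// ltW.
  have [k0 _ hk0] := h _ e0; exists (2 ^ k0)%N => N kN.
  have N0 : (0 < N)%N by rewrite (leq_trans _ kN) ?expn_gt0.
  pose k := trunc_log 2 N.
  have /andP[k1 k2] : (2 ^ k <= N < 2 ^ k.+1)%N by rewrite trunc_logP// trunc_log_ltn.
  have kk0 : (k0 <= k)%N by exact: trunc_log_max.
  have -> : (fun x => psum N t x - S t x) =
      (fun x => (psum N t x - psum (2 ^ k) t x) + (psum (2 ^ k) t x - S t x)).
    by apply/funext => x; rewrite subrKA.
  apply: (le_trans (sqnormD P measurableT _ _)) => //.
  apply: (@le_trans _ _ (2%:E * (C * rho ^+ k ^+ 2)%:E + 2%:E * (A * rho ^+ k ^+ 2)%:E)%E).
    by apply: leeD; apply: lee_wpmul2l => //; apply: hC => //; exact: ltnW.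
  rewrite -!EFinM -EFinD lee_fin.
  have := hk0 k kk0; rewrite /= sub0r normrN ger0_norm; last first.
    by rewrite mulr_ge0 ?addr_ge0 ?mulr_ge0 ?exprn_ge0 ?(ltW rho0).
  by move=> /ltW; rewrite -!exprM mulnC mulrDl !mulrA.
have bS t x : G x -> cmod (S t x) <= cmod (psum 1 t x) + limn (series (Y ^~ x)).
  move=> Gx; rewrite /S mem_set//; have [_ _ /(_ 0%N)] := limG t x Gx.
  have -> : series (Y ^~ x) 0%N = 0 by rewrite /series /= big_geq.
  rewrite subr0 => h.
  by rewrite (le_trans (cmod_leDB (dy t 0%N x) _))// lerD2l.
exists S; split=> [t|].
  split.
    split=> //.
    have /cvge0_le h := cvgS t.
    have [N hN] := h (fun N => sqnorm_ge0 _ _ _) 1 ltr01.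
    have -> : S t = (fun x => psum N t x + - (psum N t x - S t x)).
      by apply/funext => x; rewrite opprB addrC subrK.
    apply: (le_lt_trans (sqnormD P measurableT _ _)) => //; first exact: cmeasurableN.
    have [C C0 hC] := momW 1.
    have := hC (sym_range N) (fun n => a n * cexp1 (n%:~R * t)) (uniq_sym_range N).
    rewrite muln1 expr1 => fin.
    apply: (@le_lt_trans _ _ (2%:E * (C * fgn_form H (sym_range N)
        (fun n => (a n * cexp1 (n%:~R * t))%R))%:E + 2%:E * 1%:E)%E); last first.
      by rewrite -!EFinM -EFinD ltry.
    apply: leeD; apply: lee_wpmul2l => //.
      apply: le_trans fin; rewrite le_eqVlt; apply/orP; left; apply/eqP.
      apply: eq_integral => x _; congr ((cmod _ ^+ 2)%:E).
      by apply: eq_bigr => n _; rewrite mulrAC.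
    rewrite (_ : sqnorm _ _ _ = sqnorm P setT (fun x => psum N t x - S t x)) ?hN//.
    by apply: eq_integral => x _; rewrite cmodN.
  under eq_fun => N.
    under eq_fun => w do rewrite (big_sym_range (fun n => a n * W n w * cexp1 (n%:~R * t))).
    over.
  exact: cvgS.
exists S; split.
- move=> x t; rewrite /S; case: ifP => // _; congr clim; apply/funext => k.
  exact: (fourier_psum_int a W (2 ^ k) t 1 x).
- move=> t; split=> //; exact: aeW.
- (* Paths are continuous on [G], so the rationals form a separating set. *)
  exists (range (@ratr R)); first exact: sub_countable (card_image_le _ _) (countableP _).
  move: aeG; apply: filterS => x Gx t e e0.
  have e4 : 0 < e / 4 by rewrite divr_gt0.
  have cY : cvgn (series (Y ^~ x)).
    by apply: nneseries_bounded_cvg => // k; exact: block_bound_ge0.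
  have /cvgrPdist_lt/(_ _ e4)[k _ /(_ k (leqnn _)) tail] : series (Y ^~ x) @ \oo --> limn (series (Y ^~ x)).
    exact: cY.
  have {}tail : limn (series (Y ^~ x)) - series (Y ^~ x) k < e / 4.
    by rewrite (le_lt_trans (ler_norm _)).
  pose L := fourier_lip a W (2 ^ k) x + 1.
  have L0 : 0 < L by rewrite ltr_wpDl// fourier_lip_ge0.
  pose r := Num.min e (e / 4 / L).
  have r0 : 0 < r by rewrite lt_min e0 divr_gt0.
  have [s] := @rat_in_itvoo R (t - r) (t + r) (ltac:(by rewrite ltrD2l gtrN)).
  rewrite in_itv /= => /andP[s1 s2].
  have str : `|ratr s - t| < r by rewrite ltr_norml; apply/andP; split; [rewrite ltrBrDl|rewrite ltrBlDl].
  exists (ratr s); split.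
  + by exists s.
  + by rewrite (lt_le_trans str)// ge_min lexx.
  have [_ _ /(_ k) ht] := limG t x Gx; have [_ _ /(_ k) hs] := limG (ratr s) x Gx.
  rewrite /S mem_set//.
  set u := clim _ in hs *; set v := clim _ in ht *.
  have lip := fourier_psum_lip a W (2 ^ k) (ratr s) t x.
  have lipr : fourier_lip a W (2 ^ k) x * `|ratr s - t| <= e / 4.
    apply: (@le_trans _ _ (L * r)).
      by rewrite ler_pM ?fourier_lip_ge0// ?lerDl// ltW.
    by rewrite mulrC -ler_pdivlMr// ge_min lexx orbT.
  have -> : u - v = (psum (2 ^ k) t x - v) + - (psum (2 ^ k) (ratr s) x - u) +
      (psum (2 ^ k) (ratr s) x - psum (2 ^ k) t x) by ring.
  rewrite (le_lt_trans (cmodD _ _))//.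
  have h1 := cmodD (psum (2 ^ k) t x - v) (- (psum (2 ^ k) (ratr s) x - u)).
  rewrite cmodN in h1.
  have h2 := le_trans lip lipr.
  have h3 : cmod (psum (2 ^ k) t x - v) < e / 4 by rewrite (le_lt_trans ht).
  have h4 : cmod (psum (2 ^ k) (ratr s) x - u) < e / 4 by rewrite (le_lt_trans hs).
  apply: (@lt_le_trans _ _ ((e / 4 + e / 4) + e / 4)); last first.
    have -> : e / 4 + e / 4 + e / 4 = e - e / 4 by field.
    by rewrite gerBl ltW.
  by rewrite ltr_leD// (le_lt_trans h1)// ltrD.
- move: aeG; apply: filterS => x Gx.
  exists (\sum_(n <- sym_range 1) cmod (a n * W n x) + limn (series (Y ^~ x))) => t.
  rewrite (le_trans (bS t x Gx))// lerD2r (le_trans (cmod_sum _ _ _))//.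
  by apply: ler_sum => n _; rewrite cmodM cmod_cexp1 mulr1.
Qed.

End random_fourier_series.
(** * Integrals determined by the measures of preimages *)

Section integral_transfer.
Context (R : realType).
Import HBNNSimple.

Section weighted.
Context d1 d2 (T : measurableType d1) (X : measurableType d2).
Context (mu : {measure set T -> \bar R}) (Z : T -> X) (G : T -> R).
Context (mZ : measurable_fun setT Z) (mG : measurable_fun setT G).
Context (G0 : forall x, 0 <= G x).

Let mGZ (phi : X -> R) : measurable_fun setT phi ->
  measurable_fun setT (fun x => (G x * phi (Z x))%:E).
Proof.
move=> mphi; apply/measurable_EFinP; apply: measurable_funM => //.
exact: measurableT_comp.
Qed.

Lemma integral_weighted_approx (phi : X -> R)
    (mphi : measurable_fun setT (fun y => (phi y)%:E)) : (forall y, 0 <= phi y) ->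
  (\int[mu]_x (G x * phi (Z x))%:E =
   limn (fun n => \sum_(y \in range (nnsfun_approx measurableT mphi n))
     y%:E * \int[mu]_x (G x * \1_(nnsfun_approx measurableT mphi n @^-1` [set y]) (Z x))%:E))%E.
Proof.
move=> phi0; pose h := nnsfun_approx measurableT mphi.
have mh n : measurable_fun setT (h n) by exact: measurable_funP.
transitivity (limn (fun n => \int[mu]_x (G x * h n (Z x))%:E)%E).
  rewrite -monotone_convergence//.
  - apply: eq_integral => x _; apply/esym/cvg_lim => //.
    under eq_fun do rewrite EFinM; rewrite EFinM.
    apply: cvgeZl => //; apply: (cvg_nnsfun_approx measurableT mphi) => //.
    by move=> y _; rewrite lee_fin.
  - by move=> n; exact: mGZ.
  - by move=> n x _; rewrite lee_fin mulr_ge0.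
  - move=> x _ m n mn; rewrite lee_fin ler_wpM2l//.
    exact/lefP/nd_nnsfun_approx.
congr (limn _); apply/funext => n; rewrite -/(h n).
have mI y : measurable_fun setT (\1_(h n @^-1` [set y]) : X -> R) by exact: measurable_indic.
under eq_integral => x _.
  rewrite (fimfunE (h n)) mulr_fsumr -fsumEFin//.
  under eq_fsbigr do rewrite mulrCA.
  over.
rewrite ge0_integral_fsum//; last 2 first.
- by move=> y; under eq_fun do rewrite EFinM; apply: measurable_funeM; exact: mGZ.
- move=> y x _; rewrite lee_fin mulrCA mulr_ge0// -lee_fin.
  exact: nnfun_muleindic_ge0.
apply: eq_fsbigr => y /set_mem[t _ <-].
under eq_integral do rewrite EFinM.
rewrite ge0_integralZl//.
- exact: mGZ.
- by move=> x _; rewrite lee_fin mulr_ge0// indicE.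
- by rewrite lee_fin.
Qed.

End weighted.

(** An identity between weighted measures of preimages extends to integrals of
    nonnegative functions. It serves both to integrate against a law given on
    sets and to deduce product formulas from independence. *)
Lemma integral_weighted_transfer d1 d2 d (T1 : measurableType d1)
    (T2 : measurableType d2) (X : measurableType d)
    (mu1 : {measure set T1 -> \bar R}) (mu2 : {measure set T2 -> \bar R})
    (Z1 : T1 -> X) (Z2 : T2 -> X) (G1 : T1 -> R) (G2 : T2 -> R) :
  measurable_fun setT Z1 -> measurable_fun setT Z2 ->
  measurable_fun setT G1 -> measurable_fun setT G2 ->
  (forall x, 0 <= G1 x) -> (forall x, 0 <= G2 x) ->
  (forall B : set X, measurable B ->
    (\int[mu1]_x (G1 x * \1_B (Z1 x))%:E = \int[mu2]_x (G2 x * \1_B (Z2 x))%:E)%E) ->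
  forall phi : X -> R, measurable_fun setT phi -> (forall y, 0 <= phi y) ->
  (\int[mu1]_x (G1 x * phi (Z1 x))%:E = \int[mu2]_x (G2 x * phi (Z2 x))%:E)%E.
Proof.
move=> mZ1 mZ2 mG1 mG2 G10 G20 hB phi mphi phi0.
have mphiE : measurable_fun setT (fun y => (phi y)%:E) by exact/measurable_EFinP.
rewrite (integral_weighted_approx _ mZ1 mG1 G10 mphiE phi0).
rewrite (integral_weighted_approx _ mZ2 mG2 G20 mphiE phi0).
congr (limn _); apply/funext => n; apply: eq_fsbigr => y _; congr (_ * _)%E.
apply: hB; rewrite -[X in measurable X]setTI.
exact: (measurable_funP (nnsfun_approx measurableT mphiE n)).
Qed.

End integral_transfer.

(** * Moments of Gaussian variables *)

Section real_gaussian.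
Context {R : realType}.
Local Notation leb := (@lebesgue_measure R).

(** Completing the square in the exponent. *)
Lemma normal_pdf_expR (m s l x : R) : s != 0 ->
  normal_pdf m s x * expR (l * x) =
  expR (l * m + l ^+ 2 * s ^+ 2 / 2) * normal_pdf (m + l * s ^+ 2) s x.
Proof.
move=> s0; rewrite !normal_pdfE//= -[LHS]mulrA [RHS]mulrCA; congr (_ * _).
rewrite /normal_fun -!expRD; congr expR; rewrite mulr2n; field.
by rewrite -mulr2n -mulr_natr mulf_neq0 ?sqrf_eq0.
Qed.

Lemma normal_mgf (m s l : R) : s != 0 ->
  (\int[leb]_x (normal_pdf m s x * expR (l * x))%:E =
   (expR (l * m + l ^+ 2 * s ^+ 2 / 2))%:E)%E.
Proof.
move=> s0; under eq_integral do rewrite normal_pdf_expR// EFinM.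
rewrite ge0_integralZl//.
- by rewrite integral_normal_pdf mule1.
- by apply/measurable_EFinP; exact: measurable_normal_pdf.
- by move=> x _; rewrite lee_fin normal_pdf_ge0.
Qed.

(** A lower bound of the mass that a normal law puts on an interval of length
    [s] at distance [s] from its mean. *)
Definition gauss_mass : R := normal_peak 1 * expR (- 2).

Lemma gauss_mass_gt0 : 0 < gauss_mass.
Proof. by rewrite mulr_gt0 ?expR_gt0 ?normal_peak_gt0 ?oner_eq0. Qed.

Lemma normal_peakM (s : R) : 0 < s -> normal_peak s * s = normal_peak 1.
Proof.
move=> s0; rewrite /normal_peak expr1n mul1r -mulrnAr sqrtrM ?sqr_ge0//.
by rewrite sqrtr_sqr gtr0_norm// invfM mulrAC mulVf ?mul1r// gt_eqF.
Qed.

(** On the interval at distance [s] to [2 * s] from the mean, on the side away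
    from 0, the density is at least [normal_peak s * expR (- 2)] and
    [x ^+ 2 >= s ^+ 2]. *)
Lemma normal_second_moment_ge (m s : R) : 0 < s ->
  ((gauss_mass * s ^+ 2)%:E <= \int[leb]_x (normal_pdf m s x * x ^+ 2)%:E)%E.
Proof.
move=> s0; have sn : s != 0 by rewrite gt_eqF.
have mf : measurable_fun setT (fun x => (normal_pdf m s x * x ^+ 2)%:E).
  apply/measurable_EFinP; apply: measurable_funM; first exact: measurable_normal_pdf.
  exact: measurable_funX.
have f0 x : (0 <= (normal_pdf m s x * x ^+ 2)%:E)%E.
  by rewrite lee_fin mulr_ge0 ?normal_pdf_ge0 ?sqr_ge0.
have key (a : R) : (forall x, a <= x <= a + s ->
    (x - m) ^+ 2 <= 4 * s ^+ 2 /\ s ^+ 2 <= x ^+ 2) ->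
    ((gauss_mass * s ^+ 2)%:E <= \int[leb]_x (normal_pdf m s x * x ^+ 2)%:E)%E.
  move=> ha; pose I : set R := `[a, a + s]%classic.
  apply: (@le_trans _ _ (\int[leb]_(x in I) (normal_pdf m s x * x ^+ 2)%:E)%E); last first.
    by apply: ge0_subset_integral => //; exact: measurable_itv.
  apply: (@le_trans _ _ (\int[leb]_(x in I) (normal_peak s * expR (- 2) * s ^+ 2)%:E)%E).
    have := @integral_cst _ _ R leb I (measurable_itv _) (normal_peak s * expR (- 2) * s ^+ 2)%:E.
    have hI : leb I = s%:E.
      rewrite /I lebesgue_measure_itv /= lte_fin ltrDl s0 -EFinD.
      by rewrite addrAC subrr add0r.
    rewrite /cst [X in (_ * X)%E]hI => ->; rewrite -EFinM lee_fin.
    rewrite /gauss_mass -(normal_peakM s0).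
    by rewrite le_eqVlt; apply/orP; left; apply/eqP; ring.
  apply: ge0_le_integral => //.
  - exact: measurable_itv.
  - by move=> x _; rewrite lee_fin mulr_ge0 ?sqr_ge0 ?mulr_ge0 ?normal_peak_ge0 ?expR_ge0.
  - exact: measurable_funTS.
  - move=> x; rewrite /I /= in_itv /= => /ha[h1 h2]; rewrite lee_fin.
    rewrite ler_pM ?sqr_ge0 ?mulr_ge0 ?normal_peak_ge0 ?expR_ge0//.
    rewrite normal_pdfE// ler_wpM2l ?normal_peak_ge0// ler_expR.
    rewrite mulNr lerN2 -[s ^+ 2 *+ 2]mulr_natr ler_pdivrMr ?mulr_gt0 ?exprn_gt0//.
    by rewrite (le_trans h1)//; rewrite mulrCA; lra.
have [m0|m0] := leP 0 m.
  apply: (key (m + s)) => x /andP[x1 x2].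
  have d1 : s <= x - m by lra.
  have d2 : x - m <= 2 * s by lra.
  by split; nra.
apply: (key (m - 2 * s)) => x /andP[x1 x2].
have d1 : x - m <= - s by lra.
have d2 : - (2 * s) <= x - m by lra.
by split; nra.
Qed.

Context d (T : measurableType d) (P : probability T R).

Lemma integral_normal_law (X : T -> R) (m s : R) (phi : R -> R) :
  measurable_fun setT X ->
  (forall A, measurable A -> P (X @^-1` A) = normal_prob m s A) ->
  measurable_fun setT phi -> (forall x, 0 <= phi x) ->
  (\int[P]_x (phi (X x))%:E = \int[leb]_x (normal_pdf m s x * phi x)%:E)%E.
Proof.
move=> mX hX mphi phi0.
transitivity (\int[P]_x (1 * phi (X x))%:E)%E.
  by apply: eq_integral => x _; rewrite mul1r.
apply: (@integral_weighted_transfer _ _ _ _ _ _ _ P leb X id (fun=> 1) (normal_pdf m s)) => //.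
- exact: measurable_normal_pdf.
- exact: normal_pdf_ge0.
move=> B mB; have mXB : measurable (X @^-1` B) by rewrite -[X in measurable X]setTI; exact: mX.
transitivity (normal_prob m s B).
  rewrite -hX//; under eq_integral do rewrite mul1r.
  rewrite (_ : (fun x => (\1_B (X x))%:E) = (fun x => (\1_(X @^-1` B) x)%:E))//.
  by rewrite integral_indic// setIT.
rewrite /normal_prob [LHS]integral_mkcond; apply: eq_integral => x _.
by rewrite patchE indicE; case: ifP => _; rewrite ?mulr1 ?mulr0.
Qed.

Lemma integrable_of_sqr (X : T -> R) (v : R) : measurable_fun setT X ->
  (\int[P]_x (X x ^+ 2)%:E <= v%:E)%E -> P.-integrable setT (EFin \o X).
Proof.
move=> mX hv; apply/integrableP; split; first exact/measurable_EFinP.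
under eq_integral do rewrite /= .
apply: (@le_lt_trans _ _ (1%:E * \int[P]_x (cst 1 x)%:E +
    1%:E * \int[P]_x (X x ^+ 2)%:E)%E).
  apply: ge0_integral_le_lin => //.
  - exact: measurable_funX.
  - exact: measurableT_comp.
  - by move=> x; exact: sqr_ge0.
  - move=> x _; rewrite !mul1r /= -(real_normK (num_real (X x))).
    move: `|X x| (normr_ge0 (X x)) => u u0.
    by have := sqr_ge0 (u - 1); rewrite sqrrB mulr1 expr1n mulr2n; lra.
rewrite (integral_prob_cst P 1) !mul1e.
by apply: (@le_lt_trans _ _ (1%:E + v%:E)%E); [rewrite leeD2l|rewrite -EFinD ltry].
Qed.

(** The exponential moment of a centred Gaussian variable. That the parameter
    [m] of its law vanishes follows from [expR y >= 1 + y]: otherwise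
    [expR (l * m + l ^+ 2 * s ^+ 2 / 2) >= 1] would fail for some [l]. *)
Lemma gaussian_rv_mgf (X : T -> R) (v : R) : gaussian_rv P X ->
  (\int[P]_x (X x)%:E = 0)%E -> (\int[P]_x (X x ^+ 2)%:E <= v%:E)%E ->
  (\int[P]_x (expR (X x))%:E <= (expR (v / (2 * gauss_mass)))%:E)%E.
Proof.
move=> [mX [m law]] EX hv.
have gm : 0 < 2 * gauss_mass by rewrite mulr_gt0// gauss_mass_gt0.
have v0 : 0 <= v.
  by rewrite -lee_fin (le_trans _ hv)// integral_ge0// => x _; rewrite lee_fin sqr_ge0.
case: law => [Xm|[s s0 law]].
  have m0 : m = 0.
    have : (\int[P]_x (X x)%:E = \int[P]_x m%:E)%E.
      apply: ae_eq_integral => //; first exact/measurable_EFinP.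
      by apply: filterS Xm => x + _ => ->.
    by rewrite EX integral_prob_cst => -[].
  rewrite (_ : (\int[P]_x (expR (X x))%:E)%E = 1%:E).
    by rewrite lee_fin -[leLHS]expR0 ler_expR divr_ge0// ltW.
  rewrite -(integral_prob_cst P 1); apply: ge0_ae_eq_integral => //.
  - by apply/measurable_EFinP; exact: measurableT_comp.
  - by apply: filterS Xm => x + _ => ->; rewrite m0 expR0.
have sn : s != 0 by rewrite gt_eqF.
have mgf l : (\int[P]_x (expR (l * X x))%:E =
    (expR (l * m + l ^+ 2 * s ^+ 2 / 2))%:E)%E.
  rewrite (integral_normal_law mX law (phi := fun x => expR (l * x))) ?normal_mgf//.
  by apply: measurableT_comp => //; exact: measurable_funM.
have expo l : 0 <= l * m + l ^+ 2 * s ^+ 2 / 2.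
  have iX := integrable_of_sqr mX hv.
  have : (\int[P]_x (1%:E + l%:E * (X x)%:E) <= \int[P]_x (expR (l * X x))%:E)%E.
    apply: le_integral => //.
    - apply: (integrableD measurableT); first exact: finite_measure_integrable_cst.
      exact: integrableZl.
    - apply/integrableP; split.
        apply/measurable_EFinP; apply: measurableT_comp => //.
        exact: measurable_funM.
      under eq_integral do rewrite gee0_abs ?lee_fin ?expR_ge0//.
      by rewrite mgf ltry.
    - by move=> x _; rewrite -EFinM -EFinD lee_fin expR_ge1Dx.
  rewrite mgf integralD//; last 2 first.
  - exact: finite_measure_integrable_cst.
  - exact: integrableZl.
  rewrite integralZl// EX mule0 adde0 integral_prob_cst lee_fin.
  by rewrite -[in X in X <= _]expR0 ler_expR.
have m0 : m = 0.
  apply/eqP; rewrite -sqrf_eq0 eq_le sqr_ge0 andbT.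
  (* the minimum of the exponent, where its value is [- m ^+ 2 / (2 * s ^+ 2)] *)
  have := expo (- m / s ^+ 2).
  rewrite (_ : _ + _ = - (m ^+ 2 / (2 * s ^+ 2))); last by field.
  by rewrite oppr_ge0 pmulr_lle0// invr_gt0 mulr_gt0 ?exprn_gt0.
have := mgf 1; under eq_integral do rewrite mul1r.
move=> ->; rewrite lee_fin ler_expR m0 mulr0 add0r expr1n mul1r.
have : ((gauss_mass * s ^+ 2)%:E <= v%:E)%E.
  apply: le_trans hv; rewrite (integral_normal_law mX law (phi := fun x => x ^+ 2)).
  - exact: normal_second_moment_ge.
  - exact: measurable_funX.
  - by move=> x; exact: sqr_ge0.
rewrite lee_fin => h; rewrite ler_pdivlMr//.
by rewrite (_ : s ^+ 2 / 2 * (2 * gauss_mass) = gauss_mass * s ^+ 2)//; field.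
Qed.

Lemma real_moment_le_mgf (X : T -> R) (B : R) (q : nat) : measurable_fun setT X ->
  (\int[P]_x (expR (X x))%:E <= B%:E)%E ->
  (\int[P]_x (expR (- X x))%:E <= B%:E)%E ->
  (\int[P]_x (X x ^+ (2 * q))%:E <= ((2 * q)`!%:R * (B + B))%:E)%E.
Proof.
move=> mX h1 h2.
have pw (x : R) : 0 <= x -> x ^+ (2 * q) <= (2 * q)`!%:R * expR x.
  move=> x0; have f0 : 0 < (2 * q)`!%:R :> R by rewrite ltr0n fact_gt0.
  rewrite -ler_pdivrMl// mulrC; case: q f0 => [|q] _.
    by rewrite muln0 expr0 fact0 divr1 -expR0 ler_expR.
  rewrite -[(2 * q.+1)%N]prednK ?muln_gt0//.
  by apply: (le_trans _ (@expR_ge1Dxn _ x (2 * q.+1).-1 x0)); rewrite lerDr.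
apply: (@le_trans _ _ ((2 * q)`!%:R%:E * \int[P]_x (expR (X x))%:E +
    (2 * q)`!%:R%:E * \int[P]_x (expR (- X x))%:E)%E).
  apply: ge0_integral_le_lin => //.
  - exact: measurableT_comp.
  - by apply: measurableT_comp => //; exact: measurableT_comp.
  - exact: measurable_funX.
  - by move=> x; rewrite exprM exprn_ge0 ?sqr_ge0.
  move=> x _; rewrite -mulrDr exprM -real_normK ?num_real// -exprM.
  rewrite (le_trans (pw _ (normr_ge0 _)))// ler_wpM2l//.
  by case: (ger0P (X x)) => _; [rewrite lerDl|rewrite lerDr]; rewrite expR_ge0.
rewrite mulrDr EFinD; apply: leeD; rewrite EFinM; apply: lee_wpmul2l => //; by rewrite lee_fin.
Qed.

(** An even moment of a complex variable is controlled by the exponential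
    moments of its real projections in all directions, at the scale [v]. *)
Lemma moment_le_mgf (B : R) (q : nat) : exists2 C : R, 0 <= C &
  forall (Z : T -> R[i]) (v : R), cmeasurable Z -> 0 <= v ->
  (forall u : R[i], cmod u ^+ 2 * v <= 1 ->
    (\int[P]_x (expR (complex.Re (u * Z x)%R))%:E <= B%:E)%E) ->
  (\int[P]_x (cmod (Z x) ^+ (2 * q))%:E <= (C * v ^+ q)%:E)%E.
Proof.
(* [2 ^+ q] comes from [(a + b) ^+ q <= 2 ^+ q * (a ^+ q + b ^+ q)], applied to
   the squares of the two coordinates. *)
pose C := 2 ^+ q * ((2 * q)`!%:R * (`|B| + `|B|)) + 2 ^+ q * ((2 * q)`!%:R * (`|B| + `|B|)).
have C0 : 0 <= C by rewrite addr_ge0// !mulr_ge0// ?exprn_ge0// addr_ge0.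
exists C => // Z v mZ v0 hB.
have pos w : 0 < w -> v <= w -> (\int[P]_x (cmod (Z x) ^+ (2 * q))%:E <= (C * w ^+ q)%:E)%E.
  move=> w0 vw; pose k := (Num.sqrt w)^-1.
  have k2 : k ^+ 2 = w^-1 by rewrite exprVn sqr_sqrtr// ltW.
  have k0 : 0 <= k by rewrite invr_ge0 sqrtr_ge0.
  have kw u : cmod u = k -> (\int[P]_x (expR (complex.Re (u * Z x)%R))%:E <= `|B|%:E)%E.
    move=> uk; apply: (@le_trans _ _ B%:E); last by rewrite lee_fin ler_norm.
    by apply: hB; rewrite uk k2 mulrC ler_pdivrMr// mul1r.
  have [mRe mIm] := mZ.
  have mkRe : measurable_fun setT (fun x => k * complex.Re (Z x)) by exact: measurable_funM.
  have mkIm : measurable_fun setT (fun x => k * complex.Im (Z x)) by exact: measurable_funM.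
  have hRe : (\int[P]_x ((k * complex.Re (Z x)) ^+ (2 * q))%:E <=
      ((2 * q)`!%:R * (`|B| + `|B|))%:E)%E.
    apply: real_moment_le_mgf => //.
      apply: le_trans (kw k%:C _); last by rewrite cmodC ger0_norm.
      by rewrite le_eqVlt; apply/orP; left; apply/eqP; apply: eq_integral => x _;
        rewrite creM /= mul0r subr0.
    apply: le_trans (kw (- k)%:C _); last by rewrite cmodC normrN ger0_norm.
    by rewrite le_eqVlt; apply/orP; left; apply/eqP; apply: eq_integral => x _;
      rewrite creM /= mul0r subr0 mulNr.
  have hIm : (\int[P]_x ((k * complex.Im (Z x)) ^+ (2 * q))%:E <=
      ((2 * q)`!%:R * (`|B| + `|B|))%:E)%E.
    apply: real_moment_le_mgf => //.
      apply: le_trans (kw (0 -i* k) _); last first.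
        by rewrite /cmod /= expr0n add0r sqrrN sqrtr_sqr ger0_norm.
      by rewrite le_eqVlt; apply/orP; left; apply/eqP; apply: eq_integral => x _;
       rewrite creM /= mul0r sub0r mulNr opprK.
    apply: le_trans (kw (0 +i* k) _); last first.
      by rewrite /cmod /= expr0n add0r sqrtr_sqr ger0_norm.
    by rewrite le_eqVlt; apply/orP; left; apply/eqP; apply: eq_integral => x _;
      rewrite creM /= mul0r sub0r.
  have wq : 0 <= w ^+ q * 2 ^+ q by rewrite mulr_ge0 ?exprn_ge0// ltW.
  apply: (@le_trans _ _ ((w ^+ q * 2 ^+ q)%:E * \int[P]_x ((k * complex.Re (Z x)) ^+ (2 * q))%:E +
    (w ^+ q * 2 ^+ q)%:E * \int[P]_x ((k * complex.Im (Z x)) ^+ (2 * q))%:E)%E).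
    apply: ge0_integral_le_lin => //.
    - exact: measurable_funX.
    - exact: measurable_funX.
    - by apply: measurable_funX; exact: measurable_cmod.
    - by move=> x; rewrite exprM exprn_ge0 ?sqr_ge0.
    - by move=> x; rewrite exprM exprn_ge0 ?sqr_ge0.
    - by move=> x; rewrite exprn_ge0 ?cmod_ge0.
    move=> x _; have wn : w ^+ q != 0 by rewrite expf_neq0// gt_eqF.
    have kx (y : R) : w ^+ q * 2 ^+ q * (k * y) ^+ (2 * q) = 2 ^+ q * (y ^+ 2) ^+ q.
      by rewrite (exprM (k * y)) (exprMn 2 k) k2 (exprMn q w^-1) exprVn; field.
    rewrite !kx (exprM (cmod _)) cmod_sqr -mulrDr.
    set a := _ ^+ 2; set b := complex.Im _ ^+ 2.
    have a0 : 0 <= a by exact: sqr_ge0.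
    have b0 : 0 <= b by exact: sqr_ge0.
    wlog ab : a b a0 b0 / a <= b.
      move=> h; have [|/ltW] := leP a b; first exact: h.
      by rewrite addrC [_ ^+ q + _]addrC; exact: h.
    apply: (@le_trans _ _ ((2 * b) ^+ q)).
      by rewrite lerXn2r ?nnegrE ?addr_ge0 ?mulr_ge0//; lra.
    by rewrite exprMn ler_wpM2l ?exprn_ge0// lerDr exprn_ge0.
  apply: (@le_trans _ _ ((w ^+ q * 2 ^+ q)%:E * ((2 * q)`!%:R * (`|B| + `|B|))%:E +
      (w ^+ q * 2 ^+ q)%:E * ((2 * q)`!%:R * (`|B| + `|B|))%:E)%E).
    by apply: leeD; apply: lee_wpmul2l => //; rewrite lee_fin.
  rewrite -!EFinM -EFinD lee_fin le_eqVlt; apply/orP; left; apply/eqP.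
  by rewrite /C; ring.
(* If [v = 0] the bound [pos w] holds for every [w > 0]; let [w] tend to 0. *)
move: v0; rewrite le_eqVlt => /predU1P[v0|v0]; last exact: pos.
rewrite -v0; case: q C C0 pos {hB} => [|q] C C0 pos.
  by rewrite expr0; have := pos 1 ltr01; rewrite -v0 expr0; exact.
apply/lee_addgt0Pr => e e0; rewrite expr0n /= mulr0 add0e.
pose w := Num.min 1 (e / (C + 1)).
have C1 : 0 < C + 1 by rewrite ltr_wpDl.
have w0 : 0 < w by rewrite lt_min ltr01 divr_gt0.
apply: le_trans (pos w w0 _) _; first by rewrite -v0 ltW.
rewrite lee_fin; apply: (@le_trans _ _ (C * w)).
  rewrite ler_wpM2l// exprS ler_piMr ?(ltW w0)// exprn_ile1 ?(ltW w0)//.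
  by rewrite ge_min lexx.
apply: (@le_trans _ _ ((C + 1) * w)); first by rewrite ler_wpM2r ?(ltW w0)// lerDl.
by rewrite mulrC -ler_pdivlMr// ge_min lexx orbT.
Qed.

End real_gaussian.

(** * Integrals of complex functions *)

Section complex_integral.
Context d (T : measurableType d) (R : realType).
Context (mu : {measure set T -> \bar R}) (D : set T) (mD : measurable D).
Implicit Types f g h : T -> R[i].

Definition cintegrable g : Prop :=
  mu.-integrable D (EFin \o (fun x => complex.Re (g x))) /\
  mu.-integrable D (EFin \o (fun x => complex.Im (g x))).

Lemma cintegrable_bound g (b : T -> R) : cmeasurable g ->
  measurable_fun setT b -> (forall x, D x -> cmod (g x) <= b x) ->
  (\int[mu]_(x in D) (b x)%:E < +oo)%E -> cintegrable g.
Proof.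
move=> [mr mi] mb gb boo.
have ib : mu.-integrable D (EFin \o b).
  apply/integrableP; split; first by apply/measurable_EFinP; exact: measurable_funTS.
  rewrite (_ : (\int[mu]_(x in D) `|(EFin \o b) x|)%E = (\int[mu]_(x in D) (b x)%:E)%E)//.
  apply: eq_integral => x /set_mem Dx; rewrite /= ger0_norm//.
  exact: le_trans (cmod_ge0 _) (gb _ Dx).
split; apply: le_integrable ib => //.
- by apply/measurable_EFinP; exact: measurable_funTS.
- move=> x Dx; rewrite /= lee_fin (le_trans (normRe_le _))//.
  by rewrite (le_trans (gb _ Dx))// ler_norm.
- by apply/measurable_EFinP; exact: measurable_funTS.
- move=> x Dx; rewrite /= lee_fin (le_trans (normIm_le _))//.
  by rewrite (le_trans (gb _ Dx))// ler_norm.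
Qed.

Lemma cintegrableD f g : cintegrable f -> cintegrable g ->
  cintegrable (fun x => f x + g x).
Proof.
move=> [fr fi] [gr gi]; split.
  rewrite (_ : _ \o _ = (fun x => (EFin \o (fun x => complex.Re (f x))) x +
      (EFin \o (fun x => complex.Re (g x))) x)%E).
    exact: integrableD.
  by apply/funext => x /=; rewrite creD.
rewrite (_ : _ \o _ = (fun x => (EFin \o (fun x => complex.Im (f x))) x +
      (EFin \o (fun x => complex.Im (g x))) x)%E).
  exact: integrableD.
by apply/funext => x /=; rewrite cimD.
Qed.

Lemma integrable_cst_mul (r : R) (p : T -> R) : mu.-integrable D (EFin \o p) ->
  mu.-integrable D (EFin \o (fun x => r * p x)).
Proof. by move=> hp; apply: (integrableZl mD r hp). Qed.

Lemma cintegrableZ (c : R[i]) g : cintegrable g -> cintegrable (fun x => c * g x).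
Proof.
move=> [gr gi]; split.
  rewrite (_ : _ \o _ = (fun x => (EFin \o (fun x => complex.Re c * complex.Re (g x))%R) x +
      (EFin \o (fun x => - complex.Im c * complex.Im (g x))%R) x)%E).
    by apply: integrableD => //; exact: integrable_cst_mul.
  by apply/funext => x /=; rewrite creM -EFinD mulNr.
rewrite (_ : _ \o _ = (fun x => (EFin \o (fun x => complex.Re c * complex.Im (g x))%R) x +
      (EFin \o (fun x => complex.Im c * complex.Re (g x))%R) x)%E).
  by apply: integrableD => //; exact: integrable_cst_mul.
by apply/funext => x /=; rewrite cimM -EFinD.
Qed.

Lemma cintegrable0 : cintegrable (fun=> 0).
Proof. by split; exact: integrable0. Qed.

Lemma cintegrable_sum (I : Type) (s : seq I) (F : I -> T -> R[i]) :
  (forall i, cintegrable (F i)) -> cintegrable (fun x => \sum_(i <- s) F i x).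
Proof.
move=> hF; elim: s => [|i s ih].
  by under eq_fun do rewrite big_nil; exact: cintegrable0.
by under eq_fun do rewrite big_cons; exact: cintegrableD.
Qed.

Lemma cintD f g : cintegrable f -> cintegrable g ->
  cint mu D (fun x => f x + g x) = cint mu D f + cint mu D g.
Proof.
move=> [fr fi] [gr gi]; apply: complexP; rewrite (creD, cimD) /=.
  by rewrite -RintegralD//; apply: eq_Rintegral => x _; rewrite creD.
by rewrite -RintegralD//; apply: eq_Rintegral => x _; rewrite cimD.
Qed.

Lemma cintZ (c : R[i]) g : cintegrable g ->
  cint mu D (fun x => c * g x) = c * cint mu D g.
Proof.
move=> [gr gi]; apply: complexP; rewrite (creM, cimM) /=.
  rewrite -!RintegralZl// -mulN1r -RintegralZl//; last exact: integrable_cst_mul.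
  rewrite -RintegralD//; do ?exact: integrable_cst_mul.
  - by apply: eq_Rintegral => x _; rewrite creM mulN1r.
  - by apply: integrable_cst_mul; exact: integrable_cst_mul.
rewrite -!RintegralZl// -RintegralD//; do ?exact: integrable_cst_mul.
by apply: eq_Rintegral => x _; rewrite cimM.
Qed.

Lemma cint0 : cint mu D (fun=> 0) = 0.
Proof. by apply: complexP; rewrite /= /Rintegral integral0. Qed.

Lemma cint_sum (I : Type) (s : seq I) (F : I -> T -> R[i]) :
  (forall i, cintegrable (F i)) ->
  cint mu D (fun x => \sum_(i <- s) F i x) = \sum_(i <- s) cint mu D (F i).
Proof.
move=> hF; elim: s => [|i s ih].
  by under eq_fun do rewrite big_nil; rewrite cint0 big_nil.
rewrite big_cons -ih -cintD//; last exact: cintegrable_sum.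
by congr cint; apply/funext => x; rewrite big_cons.
Qed.

Lemma cint_conj g : cintegrable g ->
  cint mu D (fun x => conjc (g x)) = conjc (cint mu D g).
Proof.
move=> [gr gi]; apply: complexP; rewrite (cre_conj, cim_conj) /=.
  by apply: eq_Rintegral => x _; rewrite cre_conj.
rewrite -mulN1r -RintegralZl//; apply: eq_Rintegral => x _.
by rewrite cim_conj mulN1r.
Qed.

Lemma cL2D f g : cL2 mu D f -> cL2 mu D g -> cL2 mu D (fun x => f x + g x).
Proof.
move=> [mf foo] [mg goo]; split; first exact: cmeasurableD.
apply: (le_lt_trans (sqnormD mu mD mf mg)).
by apply: lte_add_pinfty; apply: lte_mul_pinfty => //; rewrite ?lee_fin//.
Qed.

Lemma cL2Z (c : R[i]) f : cL2 mu D f -> cL2 mu D (fun x => c * f x).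
Proof.
move=> [mf foo]; split; first by apply: cmeasurableM => //; exact: cmeasurable_cst.
by rewrite sqnormZ//; apply: lte_mul_pinfty => //; rewrite ?lee_fin ?sqr_ge0.
Qed.

Lemma cL2_sum (I : eqType) (s : seq I) (F : I -> T -> R[i]) :
  (forall i, i \in s -> cL2 mu D (F i)) -> cL2 mu D (fun x => \sum_(i <- s) F i x).
Proof.
elim: s => [|i s ih] hF.
  under eq_fun do rewrite big_nil; split; first exact: cmeasurable_cst.
  rewrite /sqnorm; under eq_integral do rewrite cmod0 expr2 mul0r.
  by rewrite integral0 ltry.
under eq_fun do rewrite big_cons; apply: cL2D.
  by apply: hF; rewrite mem_head.
by apply: ih => j js; apply: hF; rewrite inE js orbT.
Qed.

Lemma cintegrable_mul_conj f g : cL2 mu D f -> cL2 mu D g ->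
  cintegrable (fun x => f x * conjc (g x)).
Proof.
move=> [mf foo] [mg goo].
apply: (@cintegrable_bound _ (fun x => 1 * cmod (f x) ^+ 2 + 1 * cmod (g x) ^+ 2)).
- by apply: cmeasurableM => //; exact: cmeasurable_conj.
- by apply: measurable_funD; apply: measurable_funM => //; exact: measurable_cmod_sqr.
- move=> x _; rewrite cmodM cmod_conj !mul1r.
  have := sqr_ge0 (cmod (f x) - cmod (g x)); rewrite sqrrB mulr2n.
  by have := mulr_ge0 (cmod_ge0 (f x)) (cmod_ge0 (g x)); lra.
apply: (@le_lt_trans _ _ (1%:E * sqnorm mu D f + 1%:E * sqnorm mu D g)%E).
  apply: ge0_integral_le_lin => //; do ?[exact: measurable_cmod_sqr | by move=> x; exact: sqr_ge0].
  - by apply: measurable_funD; apply: measurable_funM => //; exact: measurable_cmod_sqr.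
  - by move=> x; rewrite !mul1r addr_ge0 ?sqr_ge0.
by rewrite !mul1e lte_add_pinfty.
Qed.

Lemma cint_mul_conj f : cL2 mu D f ->
  cint mu D (fun x => f x * conjc (f x)) = (fine (sqnorm mu D f))%:C.
Proof.
move=> [mf foo]; apply: complexP => /=.
  by congr fine; apply: eq_integral => x _; rewrite mul_conj.
by rewrite /Rintegral integral0_eq// => x _; rewrite mul_conj.
Qed.

Lemma sqnorm_fineK f : cL2 mu D f -> sqnorm mu D f = (fine (sqnorm mu D f))%:E.
Proof. by move=> [_ foo]; rewrite fineK// ge0_fin_numE// sqnorm_ge0. Qed.

(** Bounding the two coordinates separately costs the factor 2 and spares the
    choice of the phase of the integral. *)
Lemma cmod_cint_le g (b : T -> R) (B : R) : cmeasurable g ->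
  measurable_fun setT b -> (forall x, D x -> cmod (g x) <= b x) ->
  (\int[mu]_(x in D) (b x)%:E <= B%:E)%E -> cmod (cint mu D g) <= 2 * B.
Proof.
move=> mg mb gb bB.
have [gr gi] : cintegrable g.
  by apply: (cintegrable_bound mg mb gb); rewrite (le_lt_trans bB)// ltry.
have part (p : T -> R) : mu.-integrable D (EFin \o p) -> measurable_fun setT p ->
    (forall x, D x -> `|p x| <= b x) -> `|Rintegral mu D p| <= B.
  move=> ip mp pb; rewrite -lee_fin -abse_EFin fineK; last exact: integrable_fin_num.
  apply: (le_trans (le_abse_integral _ mD _)).
    by apply/measurable_EFinP; exact: measurable_funTS.
  apply: le_trans bB; apply: ge0_le_integral => //.
  - by apply: measurableT_comp => //; apply/measurable_EFinP; exact: measurable_funTS.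
  - by apply/measurable_EFinP; exact: measurable_funTS.
rewrite (le_trans (cmod_le _))// mulr_natl mulr2n; have [mr mi] := mg.
apply: lerD; apply: part => // x Dx.
- by rewrite (le_trans (normRe_le _))// gb.
- by rewrite (le_trans (normIm_le _))// gb.
Qed.

Lemma cint_sum_mul_conj (s : seq int) (c e : int -> R[i]) (U V : int -> T -> R[i]) :
  (forall n, n \in s -> cL2 mu D (U n)) -> (forall n, n \in s -> cL2 mu D (V n)) ->
  cint mu D (fun x => (\sum_(n <- s) c n * U n x) * conjc (\sum_(m <- s) e m * V m x)) =
  \sum_(n <- s) \sum_(m <- s) c n * conjc (e m) * cint mu D (fun x => U n x * conjc (V m x)).
Proof.
move=> hU hV.
pose U' n := if n \in s then U n else (fun=> 0).
pose V' n := if n \in s then V n else (fun=> 0).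
have L20 : cL2 mu D (fun=> 0).
  by have := @cL2_sum int [::] (fun _ _ => 0) (fun i => ltac:(by [])); under eq_fun do rewrite big_nil.
have hU' n : cL2 mu D (U' n) by rewrite /U'; case: ifPn => // /hU.
have hV' n : cL2 mu D (V' n) by rewrite /V'; case: ifPn => // /hV.
have iUV n m : cintegrable (fun x => c n * conjc (e m) * (U' n x * conjc (V' m x))).
  by apply: cintegrableZ; exact: cintegrable_mul_conj.
transitivity (cint mu D (fun x => \sum_(n <- s) \sum_(m <- s)
    c n * conjc (e m) * (U' n x * conjc (V' m x)))).
  congr cint; apply/funext => x; rewrite mulr_suml big_seq [RHS]big_seq.
  apply: eq_bigr => n ns; rewrite rmorph_sum mulr_sumr big_seq [RHS]big_seq.
  by apply: eq_bigr => m ms; rewrite /U' /V' ns ms rmorphM mulrACA.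
rewrite cint_sum; last by move=> n; exact: cintegrable_sum.
rewrite big_seq [RHS]big_seq; apply: eq_bigr => n ns; rewrite cint_sum//.
rewrite big_seq [RHS]big_seq; apply: eq_bigr => m ms; rewrite cintZ.
  by rewrite /U' /V' ns ms.
exact: cintegrable_mul_conj.
Qed.

Lemma sqnorm_lincomb_le (s : seq int) (c : int -> R[i]) (U : int -> T -> R[i]) :
  (forall n, n \in s -> cL2 mu D (U n)) ->
  (sqnorm mu D (fun x => \sum_(n <- s) c n * U n x)%R <=
   (\sum_(n <- s) \sum_(m <- s) cmod (c n) * cmod (c m) *
     cmod (cint mu D (fun x => U n x * conjc (U m x))))%R%:E)%E.
Proof.
move=> hU; have hS : cL2 mu D (fun x => \sum_(n <- s) c n * U n x).
  by apply: cL2_sum => n ns; apply: cL2Z; exact: hU.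
rewrite (sqnorm_fineK hS) lee_fin.
have fS : 0 <= fine (sqnorm mu D (fun x => \sum_(n <- s) c n * U n x)).
  by rewrite fine_ge0// sqnorm_ge0.
rewrite -(ger0_norm fS) -cmodC -cint_mul_conj// cint_sum_mul_conj//.
rewrite (le_trans (cmod_sum _ _ _))//; apply: ler_sum => n _.
rewrite (le_trans (cmod_sum _ _ _))//; apply: ler_sum => m _.
by rewrite !cmodM cmod_conj.
Qed.

(** Bessel's inequality: expand the squared norm of the remainder. *)
Lemma bessel (s : seq int) (e : int -> T -> R[i]) g : uniq s ->
  (forall n, n \in s -> cL2 mu D (e n)) ->
  (forall n m, n \in s -> m \in s ->
    cint mu D (fun x => e n x * conjc (e m x)) = (n == m)%:R) ->
  cL2 mu D g ->
  \sum_(n <- s) cmod (cint mu D (fun x => g x * conjc (e n x))) ^+ 2 <=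
  fine (sqnorm mu D g).
Proof.
move=> us he ortho hg.
pose b n := cint mu D (fun x => g x * conjc (e n x)).
pose h x := \sum_(n <- s) b n * e n x.
have hh : cL2 mu D h by apply: cL2_sum => n ns; apply: cL2Z; exact: he.
have diag (F : int -> int -> R[i]) : \sum_(n <- s) \sum_(m <- s) F n m * (n == m)%:R =
    \sum_(n <- s) F n n.
  rewrite big_seq [RHS]big_seq; apply: eq_bigr => n ns.
  rewrite (bigD1_seq n)//= eqxx mulr1 big1 ?addr0// => m mn.
  by rewrite eq_sym (negbTE mn) mulr0.
pose B := \sum_(n <- s) cmod (b n) ^+ 2.
have BE : \sum_(n <- s) b n * conjc (b n) = B%:C.
  by rewrite /B raddf_sum; apply: eq_bigr => n _; rewrite mul_conj.
have hhE : cint mu D (fun x => h x * conjc (h x)) = B%:C.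
  rewrite /h cint_sum_mul_conj// -BE -(diag (fun n m => b n * conjc (b m))).
  rewrite big_seq [RHS]big_seq; apply: eq_bigr => n ns.
  by rewrite big_seq [RHS]big_seq; apply: eq_bigr => m ms; rewrite ortho.
have ghE : cint mu D (fun x => g x * conjc (h x)) = B%:C.
  pose e' n := if n \in s then e n else (fun=> 0).
  have he' n : cL2 mu D (e' n).
    rewrite /e'; case: ifPn => [/he//|_].
    by have := @cL2_sum int [::] (fun _ _ => 0) (fun i => ltac:(by [])); under eq_fun do rewrite big_nil.
  transitivity (cint mu D (fun x => \sum_(n <- s) conjc (b n) * (g x * conjc (e' n x)))).
    congr cint; apply/funext => x; rewrite /h rmorph_sum mulr_sumr.
    rewrite big_seq [RHS]big_seq; apply: eq_bigr => n ns.
    by rewrite /e' ns rmorphM mulrCA.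
  rewrite cint_sum; last by move=> n; apply: cintegrableZ; exact: cintegrable_mul_conj.
  rewrite -BE big_seq [RHS]big_seq; apply: eq_bigr => n ns.
  rewrite cintZ; last exact: cintegrable_mul_conj.
  by rewrite /e' ns mulrC.
have hgE : cint mu D (fun x => h x * conjc (g x)) = B%:C.
  rewrite -(conjc_real B) -ghE -cint_conj; last exact: cintegrable_mul_conj.
  by congr cint; apply/funext => x; rewrite rmorphM /= conjcK mulrC.
have hgh : cL2 mu D (fun x => g x + -1 * h x) by apply: cL2D => //; exact: cL2Z.
have : 0 <= fine (sqnorm mu D (fun x => g x + -1 * h x)) by rewrite fine_ge0// sqnorm_ge0.
suff -> : fine (sqnorm mu D (fun x => g x + -1 * h x)) = fine (sqnorm mu D g) - B.
  by rewrite subr_ge0.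
suff : (fine (sqnorm mu D (fun x => g x + -1 * h x)))%:C = (fine (sqnorm mu D g) - B)%:C.
  by move=> [].
have I1 := cintegrable_mul_conj hg hg; have I2 := cintegrable_mul_conj hg hh.
have I3 := cintegrable_mul_conj hh hg; have I4 := cintegrable_mul_conj hh hh.
rewrite -cint_mul_conj//.
transitivity (cint mu D (fun x => (g x * conjc (g x) + -1 * (g x * conjc (h x))) +
    (-1 * (h x * conjc (g x)) + h x * conjc (h x)))).
  congr cint; apply/funext => x; rewrite rmorphD rmorphM rmorphN1; ring.
rewrite cintD; [|by apply: cintegrableD => //; exact: cintegrableZ..].
rewrite !cintD//; do ?exact: cintegrableZ.
rewrite !cintZ// ghE hgE hhE cint_mul_conj// rmorphB /=; ring.
Qed.

End complex_integral.

(** * The moments of complex fractional Gaussian noise *)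

Section fgn_is_subgaussian.
Context d (T : measurableType d) (R : realType) (P : probability T R).
Context (H : R) (H2 : 2^-1 <= H) (Delta : int -> T -> R[i]).
Context (fgn : complex_fgn P H Delta).

Lemma complex_fgn_measurable n : cmeasurable (Delta n).
Proof.
have [G _ _ _] := fgn; split.
  have [+ _] := G 1%N (fun=> n) (fun=> 1) (fun=> 0).
  by under eq_fun do rewrite big_ord1 mul1r mul0r addr0.
have [+ _] := G 1%N (fun=> n) (fun=> 0) (fun=> 1).
by under eq_fun do rewrite big_ord1 mul1r mul0r add0r.
Qed.

(** The complex integral takes the value 0 when the second moment is infinite,
    so that a unit variance forces it to be finite. *)
Lemma cL2_of_unit_variance (Z : T -> R[i]) : cmeasurable Z ->
  cexpect P (fun w => Z w * conjc (Z w)) = 1 -> cL2 P setT Z.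
Proof.
move=> mZ [h _]; split=> //; rewrite ltey; apply/eqP => Zoo; move: h.
rewrite /Rintegral; under eq_integral do rewrite mul_conj /=.
by rewrite -/(sqnorm P setT Z) Zoo => /eqP; rewrite eq_sym oner_eq0.
Qed.

Lemma cL2_cst (c : R[i]) : cL2 P setT (fun=> c).
Proof.
split; first exact: cmeasurable_cst.
by rewrite /sqnorm (integral_prob_cst P (cmod c ^+ 2)) ltry.
Qed.

Lemma cintegrable_cL2 (Z : T -> R[i]) : cL2 P setT Z -> cintegrable P setT Z.
Proof.
move=> LZ; have := cintegrable_mul_conj measurableT LZ (cL2_cst 1).
by under eq_fun do rewrite conjc1 mulr1.
Qed.

Lemma complex_fgn_cL2 n : cL2 P setT (Delta n).
Proof.
have [_ _ _ cov] := fgn; apply: cL2_of_unit_variance; first exact: complex_fgn_measurable.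
by rewrite cov subrr fgn_cov0// gt_eqF// (lt_le_trans _ H2)// invr_gt0.
Qed.

(** In every direction [u] the projection of a linear combination is a centred
    real Gaussian variable, of variance at most [cmod u ^+ 2] times the form. *)
Lemma complex_fgn_moments : fgn_moments P H Delta.
Proof.
have [G mean _ cov] := fgn.
move=> q; have [C C0 hC] := moment_le_mgf P (expR (1 / (2 * gauss_mass))) q.
exists C => // s c us; pose Z x := \sum_(n <- s) c n * Delta n x.
have LZ : cL2 P setT Z.
  by apply: cL2_sum => // n _; apply: cL2Z => //; exact: complex_fgn_cL2.
have mZ := LZ.1.
apply: hC => //; first exact: fgn_form_ge0.
move=> u uv.
have LuZ : cL2 P setT (fun x => u * Z x) by exact: cL2Z.
have EuZ : cint P setT (fun x => u * Z x) = 0.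
  rewrite cintZ//; last exact: cintegrable_cL2.
  rewrite /Z cint_sum//; last first.
    by move=> n; apply: cintegrableZ => //; apply: cintegrable_cL2; exact: complex_fgn_cL2.
  rewrite big1 ?mulr0// => n _; rewrite cintZ//; last first.
    by apply: cintegrable_cL2; exact: complex_fgn_cL2.
  by have := mean n; rewrite /cexpect => ->; rewrite mulr0.
have [iRe _] := cintegrable_cL2 LuZ.
apply: gaussian_rv_mgf.
- have := G (size s) (fun k => nth 0 s k)
    (fun k => complex.Re (u * c (nth 0 s k))) (fun k => - complex.Im (u * c (nth 0 s k))).
  set X1 := (X in gaussian_rv P X -> _); set X2 := (X in _ -> gaussian_rv P X).
  suff -> : X1 = X2 by [].
  apply/funext => x; rewrite /X1 /X2 mulr_sumr cre_sum (big_nth 0) big_mkord.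
  by apply: eq_bigr => k _; rewrite mulrA (creM (u * _)) mulNr.
- have := congr1 (@complex.Re R) EuZ; rewrite /= /Rintegral => h.
  rewrite -[LHS]fineK; first by congr (_%:E).
  exact: (integrable_fin_num measurableT iRe).
- apply: (@le_trans _ _ (sqnorm P setT (fun x => u * Z x)%R)).
    apply: ge0_le_integral => //.
    + by move=> x _; rewrite lee_fin sqr_ge0.
    + by apply/measurable_EFinP; apply: measurable_funX; have [] := LuZ.1.
    + exact: measurable_cmodX LuZ.1.
    + by move=> x _; rewrite lee_fin cmod_sqr lerDl sqr_ge0.
  rewrite sqnormZ//; apply: (@le_trans _ _ ((cmod u ^+ 2)%:E * (fgn_form H s c)%:E)%E).
    apply: lee_wpmul2l; first by rewrite lee_fin sqr_ge0.
    have hb := @sqnorm_lincomb_le _ _ _ P setT measurableT s c _ (fun n _ => complex_fgn_cL2 n).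
    apply: (le_trans hb).
    rewrite lee_fin; apply: ler_sum => n _; apply: ler_sum => m _.
    rewrite ler_wpM2l ?mulr_ge0 ?cmod_ge0//.
    by have := cov n m; rewrite /cexpect => ->; rewrite cmodC ger0_norm// fgn_cov_ge0.
  by rewrite -EFinM lee_fin.
Qed.

End fgn_is_subgaussian.

(** * Sums of independent Gaussian variables *)

Section independent_gaussian_sums.
Context d (T : measurableType d) (R : realType) (P : probability T R).
Context (A : set int) (Z : int -> T -> R[i]).
Context (mZ : forall n, cmeasurable (Z n)) (indZ : independent_family P A Z).

Let pairZ n w : R * R := (complex.Re (Z n w), complex.Im (Z n w)).

Let mpairZ n : measurable_fun setT (pairZ n).
Proof. by have [? ?] := mZ n; apply: measurable_fun_pair. Qed.

Let mevent n (B : set (R * R)) : measurable B -> measurable (pairZ n @^-1` B).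
Proof. by move=> mB; rewrite -[X in measurable X]setTI; exact: mpairZ. Qed.

Let prob_event n (B : set (R * R)) : R := fine (P (pairZ n @^-1` B)).

Let prob_eventK n (B : set (R * R)) : measurable B ->
  P (pairZ n @^-1` B) = (prob_event n B)%:E.
Proof. by move=> mB; rewrite fineK// fin_num_measure//; exact: mevent. Qed.

Let integral_event n (B : set (R * R)) : measurable B ->
  (\int[P]_w (\1_B (pairZ n w))%:E = (prob_event n B)%:E)%E.
Proof.
move=> mB; rewrite -prob_eventK//.
rewrite (_ : (fun w => (\1_B (pairZ n w))%:E) = (fun w => (\1_(pairZ n @^-1` B) w)%:E))//.
by rewrite integral_indic ?setIT//; exact: mevent.
Qed.

(** The product formula for events is upgraded to functions one factor at a
    time: with the other factors fixed, both sides are measures in the set [B]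
    that constrains the current variable. *)
Lemma integral_prod_indep (phi : int -> R * R -> R) (c : int -> R) :
  (forall n, measurable_fun setT (phi n)) -> (forall n y, 0 <= phi n y) ->
  (forall n, A n -> (\int[P]_w (phi n (pairZ n w))%:E = (c n)%:E)%E) ->
  forall (s1 s2 : seq int) (B : int -> set (R * R)), uniq (s1 ++ s2) ->
  (forall n, n \in s1 ++ s2 -> A n) -> (forall n, measurable (B n)) ->
  (\int[P]_w (\prod_(n <- s1) phi n (pairZ n w) *
              \prod_(n <- s2) \1_(B n) (pairZ n w))%:E =
   (\prod_(n <- s1) c n * \prod_(n <- s2) prob_event n (B n))%:E)%E.
Proof.
move=> mphi phi0 hc; elim=> [|j s1 ih] s2 B us sA mB.
  rewrite big_nil mul1r; under eq_integral do rewrite big_nil mul1r.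
  have -> : (fun w => (\prod_(n <- s2) \1_(B n) (pairZ n w) : R)%:E) =
      (fun w => (\1_[set w | forall n, n \in s2 -> B n (pairZ n w)] w)%:E).
    apply/funext => w; congr (_%:E); rewrite indicE.
    have [|] := boolP (w \in _) => [/set_mem/= h|/negP h].
      by rewrite big_seq big1// => n /h hn; rewrite indicE mem_set.
    have [n [ns hn]] : exists n, n \in s2 /\ ~ B n (pairZ n w).
      apply: contrapT => h'; apply: h; apply/mem_set => n ns.
      by apply: contrapT => hn; apply: h'; exists n.
    by rewrite (big_rem n)//= indicE memNset// mul0r.
  have me : measurable [set w | forall n, n \in s2 -> B n (pairZ n w)].
    have -> : [set w | forall n, n \in s2 -> B n (pairZ n w)] =
        \bigcap_(n in [set n | n \in s2]) (pairZ n @^-1` B n).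
      by apply/seteqP; split.
    apply: fin_bigcap_measurable; last by move=> n _; exact: mevent.
    exact: finite_seq.
  rewrite integral_indic// setIT.
  have [_ /(_ s2 B us sA (fun n _ => mB n)) h] := indZ.
  apply: (etrans h); rewrite -prodEFin; apply: eq_bigr => n _; exact: prob_eventK.
have [ns1 us'] : j \notin s1 ++ s2 /\ uniq (s1 ++ s2) by move: us => /= /andP[].
pose G w := \prod_(n <- s1) phi n (pairZ n w) * \prod_(n <- s2) (\1_(B n) (pairZ n w) : R).
pose k := \prod_(n <- s1) c n * \prod_(n <- s2) prob_event n (B n).
have mG : measurable_fun setT G.
  apply: measurable_funM; apply: measurable_prod => n _; apply: measurableT_comp => //.
have G0 w : 0 <= G w.
  by apply: mulr_ge0; apply: prodr_ge0 => n _ //; rewrite indicE.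
have Aj : A j by apply: sA; rewrite /= mem_head.
have c0 n : A n -> 0 <= c n.
  by move=> An; rewrite -lee_fin -hc// integral_ge0// => w _; rewrite lee_fin.
have k0 : 0 <= k.
  apply: mulr_ge0; last by apply: prodr_ge0 => n _; exact: fine_ge0.
  rewrite big_seq; apply: prodr_ge0 => n ns; apply: c0; apply: sA.
  by rewrite /= inE mem_cat ns orbT.
have key (C : set (R * R)) : measurable C ->
    (\int[P]_w (G w * \1_C (pairZ j w))%:E = \int[P]_w (k * \1_C (pairZ j w))%:E)%E.
  move=> mC; pose B' n := if n == j then C else B n.
  have B'B n : n \in s1 ++ s2 -> B' n = B n.
    by rewrite /B'; case: eqP => // -> js; rewrite js in ns1.
  have := ih (j :: s2) B'.
  rewrite -cat1s uniq_catCA /= => /(_ us) h.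
  have {}h := h _ _; rewrite !big_cons in h.
  transitivity (k * prob_event j C)%:E; last first.
    under eq_integral do rewrite EFinM.
    rewrite ge0_integralZl//.
    - by rewrite integral_event// EFinM.
    - by apply/measurable_EFinP; apply: measurableT_comp => //; exact: measurable_indic.
  have -> : (k * prob_event j C)%:E = (\prod_(n <- s1) c n *
      \prod_(n <- j :: s2) prob_event n (B' n))%:E.
    rewrite /k big_cons {1}/B' eqxx -mulrA [_ * prob_event _ _]mulrC.
    congr ((_ * (_ * _))%:E); rewrite big_seq [RHS]big_seq; apply: eq_bigr => n ns.
    by rewrite B'B// mem_cat ns orbT.
  rewrite -ih; first last.
  - by move=> n; rewrite /B'; case: ifP.
  - by move=> n; rewrite mem_cat inE orbCA -mem_cat -in_cons; exact: sA.
  - by rewrite -cat1s uniq_catCA.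
  apply: eq_integral => w _; congr (_%:E); rewrite /G big_cons {1}/B' eqxx -mulrA.
  rewrite [\prod_(n <- s2) _ * _]mulrC; congr (_ * (_ * _)).
  rewrite big_seq [RHS]big_seq; apply: eq_bigr => n ns.
  by rewrite B'B// mem_cat ns orbT.
have := @integral_weighted_transfer _ _ _ _ _ _ _ P P (pairZ j) (pairZ j) G (fun=> k)
  (@mpairZ j) (@mpairZ j) mG (measurable_cst _) G0 (fun=> k0) key _ (mphi j) (phi0 j).
under [X in _ = X -> _]eq_integral do rewrite EFinM.
rewrite ge0_integralZl//; last 2 first.
- by apply/measurable_EFinP; exact: measurableT_comp.
- by move=> w _; rewrite lee_fin.
rewrite hc// -EFinM => h.
transitivity (k * c j)%:E; last by rewrite /k big_cons mulrAC; congr (_ * _)%:E; rewrite mulrC.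
rewrite -h; apply: eq_integral => w _; congr (_%:E).
by rewrite big_cons -mulrA mulrC.
Qed.

Context (stdZ : forall n, A n -> standard_complex_gaussian P (Z n)).

Lemma std_gaussian_mgf n (b : R[i]) : A n ->
  (\int[P]_w (expR (complex.Re (b * Z n w)%R))%:E <=
   (expR (cmod b ^+ 2 / (2 * gauss_mass)))%:E)%E.
Proof.
move=> An; have [G mean var _] := stdZ An.
have LZ : cL2 P setT (Z n) by apply: cL2_of_unit_variance.
have LbZ : cL2 P setT (fun w => b * Z n w) by exact: cL2Z.
apply: gaussian_rv_mgf.
- have := G 1%N (fun=> tt) (fun=> complex.Re b) (fun=> - complex.Im b).
  set X1 := (X in gaussian_rv P X -> _); set X2 := (X in _ -> gaussian_rv P X).
  suff -> : X1 = X2 by [].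
  by apply/funext => w; rewrite /X1 /X2 big_ord1 creM mulNr.
- have EbZ : cint P setT (fun w => b * Z n w) = 0.
    rewrite cintZ//; last exact: cintegrable_cL2.
    by move: mean; rewrite /cexpect => ->; rewrite mulr0.
  have := congr1 (@complex.Re R) EbZ; rewrite /= /Rintegral => h.
  rewrite -[LHS]fineK; first by congr (_%:E).
  exact: (integrable_fin_num measurableT (cintegrable_cL2 LbZ).1).
apply: (@le_trans _ _ (sqnorm P setT (fun w => b * Z n w)%R)).
  apply: ge0_le_integral => //.
  + by move=> x _; rewrite lee_fin sqr_ge0.
  + by apply/measurable_EFinP; apply: measurable_funX; have [] := LbZ.1.
  + exact: measurable_cmodX LbZ.1.
  + by move=> x _; rewrite lee_fin cmod_sqr lerDl sqr_ge0.
rewrite sqnormZ// (sqnorm_fineK LZ) -EFinM lee_fin.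
have : (fine (sqnorm P setT (Z n)))%:C = 1 by rewrite -cint_mul_conj.
by move=> [->]; rewrite mulr1.
Qed.

(** By independence the exponential moment of the sum is the product of those
    of its terms, as if the sum were known to be Gaussian. *)
Lemma gaussian_sum_mgf (s : seq int) (b : int -> R[i]) : uniq s ->
  (forall n, n \in s -> A n) ->
  (\int[P]_w (expR (complex.Re (\sum_(n <- s) b n * Z n w)%R))%:E <=
   (expR ((\sum_(n <- s) cmod (b n) ^+ 2) / (2 * gauss_mass)))%:E)%E.
Proof.
move=> us sA.
pose phi n (y : R * R) := expR (complex.Re (b n) * y.1 - complex.Im (b n) * y.2).
have phiE n w : phi n (pairZ n w) = expR (complex.Re (b n * Z n w)) by rewrite creM.
pose c n := fine (\int[P]_w (phi n (pairZ n w))%:E)%E.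
have mphi n : measurable_fun setT (phi n).
  apply: measurableT_comp => //; apply: measurable_funB; apply: measurable_funM => //.
have phi0 n y : 0 <= phi n y by exact: expR_ge0.
have int_le n : A n -> (\int[P]_w (phi n (pairZ n w))%:E <=
    (expR (cmod (b n) ^+ 2 / (2 * gauss_mass)))%:E)%E.
  by move=> An; under eq_integral do rewrite phiE; exact: std_gaussian_mgf.
have cE n : A n -> (\int[P]_w (phi n (pairZ n w))%:E = (c n)%:E)%E.
  move=> An; rewrite fineK// ge0_fin_numE.
    by rewrite (le_lt_trans (int_le _ An))// ltry.
  by apply: integral_ge0 => w _; rewrite lee_fin.
have := @integral_prod_indep phi c mphi phi0 cE s [::] (fun=> setT).
rewrite cats0 => /(_ us sA (fun=> measurableT)).
rewrite big_nil mulr1; under eq_integral do rewrite big_nil mulr1.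
have -> : (fun w => (\prod_(n <- s) phi n (pairZ n w))%:E) =
    (fun w => (expR (complex.Re (\sum_(n <- s) b n * Z n w)))%:E).
  apply/funext => w; rewrite cre_sum expR_sum; congr (_%:E).
  by apply: eq_bigr => n _; rewrite phiE.
move=> ->; rewrite lee_fin mulr_suml expR_sum big_seq [leRHS]big_seq.
apply: ler_prod => n ns; rewrite -!lee_fin -cE; last exact: sA.
rewrite int_le; last exact: sA.
by rewrite andbT; apply: integral_ge0 => w _; rewrite lee_fin.
Qed.

Lemma gaussian_sum_moments (q : nat) : exists2 C : R, 0 <= C &
  forall (s : seq int) (b : int -> R[i]) (v : R), uniq s ->
  (forall n, n \in s -> A n) -> \sum_(n <- s) cmod (b n) ^+ 2 <= v ->
  (\int[P]_w (cmod (\sum_(n <- s) b n * Z n w)%R ^+ (2 * q))%:E <= (C * v ^+ q)%:E)%E.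
Proof.
have [C C0 hC] := moment_le_mgf P (expR (1 / (2 * gauss_mass))) q.
exists C => // s b v us sA hv; apply: hC.
- by apply: cmeasurable_sum => n; apply: cmeasurableM => //; exact: cmeasurable_cst.
- by apply: le_trans hv; apply: sumr_ge0 => n _; exact: sqr_ge0.
move=> u uv.
under eq_integral do rewrite mulr_sumr; under eq_integral do under eq_bigr do rewrite mulrA.
apply: (le_trans (gaussian_sum_mgf _ us sA)); rewrite lee_fin ler_expR.
have gm : 0 < (2 * gauss_mass)^-1 :> R.
  by rewrite invr_gt0 (mulr_gt0 _ gauss_mass_gt0).
rewrite (ler_pM2r gm).
apply: le_trans uv; under eq_bigr do rewrite cmodM exprMn.
by rewrite -mulr_sumr ler_wpM2l// sqr_ge0.
Qed.

End independent_gaussian_sums.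

(** * Continuous functions on the circle *)

Section circle_continuity.
Context {R : realType}.

Lemma cmod_cexp1_sub1 (v : R) : cmod (cexp1 v - 1) ^+ 2 = 2 - 2 * cos (2 * pi * v).
Proof.
rewrite cmod_sqr creD cimD creN cimN /= subr0.
have := cos2Dsin2 (2 * pi * v); set c := cos _; set s := sin _ => cs.
have -> : s ^+ 2 = 1 - c ^+ 2 by rewrite -[X in X - _]cs; ring.
by ring.
Qed.

(** The chord between 1 and [cexp1 v] is short only when [v] is near an
    integer; [h] below is the chord of an arc [dl]. *)
Lemma near_int_of_cexp1 (e : R) : 0 < e -> exists2 h : R, 0 < h &
  forall v : R, cmod (cexp1 v - 1) < h -> exists k : int, `|v - k%:~R| < e.
Proof.
move=> e0; pose dl := Num.min e 2^-1.
have d0 : 0 < dl by rewrite lt_min e0 invr_gt0 ltr0n.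
have d2 : dl <= 2^-1 by rewrite ge_min lexx orbT.
have pi0 := pi_gt0 R.
have inpi (x : R) : 0 <= x <= 2^-1 -> (2 * pi * x) \in `[0, pi].
  move=> /andP[x0 x2]; rewrite in_itv /= !mulr_ge0 ?(ltW pi0)//=.
  rewrite (_ : 2 * pi * x = pi * (2 * x)); last by ring.
  by rewrite ler_piMr ?(ltW pi0)//; lra.
pose h := Num.sqrt (2 - 2 * cos (2 * pi * dl)).
have h0 : 0 < 2 - 2 * cos (2 * pi * dl).
  suff : cos (2 * pi * dl) < 1 by lra.
  have z0 : (0 : R) \in `[0, pi] by rewrite in_itv /= lexx ltW.
  rewrite -[ltRHS](@cos0 R) ltr_cos//; first by rewrite mulr_gt0 ?mulr_gt0 ?ltr0n.
  by apply: inpi; rewrite (ltW d0).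
exists h; first by rewrite sqrtr_gt0.
move=> v vh; pose k := Num.floor (v + 2^-1); exists k.
set r := v - k%:~R.
have r2 : `|r| <= 2^-1.
  have /andP[k1 k2] := floor_itv (v + 2^-1); rewrite -/k intrD in k1 k2.
  by rewrite ler_norml /r; apply/andP; split; lra.
apply: lt_le_trans (_ : dl <= e); last by rewrite ge_min lexx.
rewrite ltNge; apply/negP => dr.
have : cmod (cexp1 v - 1) ^+ 2 < h ^+ 2.
  by rewrite ltr_pXn2r ?nnegrE ?cmod_ge0 ?sqrtr_ge0.
have -> : cexp1 v = cexp1 r.
  by rewrite -(subrK k%:~R v) cexp1D cexp1_int mulr1.
rewrite cmod_cexp1_sub1 sqr_sqrtr ?ltW// ltrD2l ltrN2 ltr_pM2l// ltNge.
have -> : cos (2 * pi * r) = cos (2 * pi * `|r|).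
  by case: (ger0P r) => // _; rewrite mulrN cosN.
rewrite leNgt ltr_cos.
- by rewrite ltr_pM2l ?mulr_gt0// -leNgt dr.
- by apply: inpi; rewrite normr_ge0.
- by apply: inpi; rewrite (ltW d0).
Qed.

Lemma periodic1_int (U : Type) (f : R -> U) : periodic1 f ->
  forall x (k : int), f (x + k%:~R) = f x.
Proof.
move=> pf.
have nat_case x (n : nat) : f (x + n%:R) = f x.
  by elim: n x => [|n ih] x; [rewrite addr0|rewrite -natr1 addrA pf].
move=> x [n|n]; first exact: nat_case.
by rewrite NegzE mulrNz -(nat_case (x - n.+1%:R) n.+1) subrK.
Qed.

Context (f : R -> R[i]) (hf : C_circle f).

Lemma C_circle_cvg x (e : R) : 0 < e ->
  exists2 dl : R, 0 < dl & forall y, `|y - x| < dl -> cmod (f y - f x) < e.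
Proof.
have [_ cf] := hf; move=> e0.
have /cvgrPdist_lt/(_ e%:C) := cf x.
rewrite ltcR => /(_ e0) [dl /= dl0 hdl]; exists dl => // y yx.
have := hdl y; rewrite /ball /= distrC => /(_ yx).
rewrite normc_def ltcR -cmod_sqr sqrtr_sqr ger0_norm ?cmod_ge0//.
by rewrite cmodBC.
Qed.

Lemma C_circle_measurable : cmeasurable f.
Proof.
split; apply: continuous_measurable_fun => x; apply/cvgrPdist_lt => e e0;
  have [dl dl0 hdl] := C_circle_cvg x e0; exists dl => //= y yx.
  rewrite -creN -creD (le_lt_trans (normRe_le _))// cmodBC hdl//.
  by rewrite distrC.
rewrite -cimN -cimD (le_lt_trans (normIm_le _))// cmodBC hdl//.
by rewrite distrC.
Qed.

Let covering : near_covering (`[0, 1]%classic : set R).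
Proof. by rewrite -compact_near_coveringP; exact: segment_compact. Qed.

Lemma C_circle_bounded : exists2 B : R, 0 <= B & forall x, cmod (f x) <= B.
Proof.
have [pf _] := hf.
have near01 : forall x : R, `[0, 1]%classic x ->
    \forall x' \near x & M \near +oo, cmod (f x') <= M.
  move=> x _; have [dl dl0 hdl] := C_circle_cvg x ltr01.
  exists (ball x dl, [set M | cmod (f x) + 1 < M]) => /=.
    split; first exact: nbhsx_ballx.
    by exists (cmod (f x) + 1); split; [exact: num_real|].
  move=> [y M] [/= yx hM]; apply: le_trans (ltW hM).
  rewrite -(subrK (f x) (f y)) (le_trans (cmodD _ _))// addrC lerD2l ltW// hdl//.
  by move: yx; rewrite /ball /= distrC.
have [M0 [_ hM]] := @covering _ _ (fun M x => cmod (f x) <= M) _ near01.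
pose M := `|M0| + 1.
have M0M : M0 < M by rewrite (le_lt_trans (ler_norm _))// ltrDl.
exists M; first by rewrite addr_ge0.
move=> x; rewrite -(periodic1_int pf x (- Num.floor x)) mulrNz.
apply: (hM _ M0M); rewrite /= in_itv /=.
have /andP[h1 h2] := floor_itv x; rewrite intrD in h2.
by rewrite subr_ge0 h1 lerBlDl ltW.
Qed.

(** Uniform continuity on the circle, in the quadratic form used with a
    positive kernel: the distance on the circle is measured by
    [cmod (cexp1 (x - s) - 1)], which the Fejer kernel integrates well. *)
Lemma C_circle_unif (e : R) : 0 < e -> exists2 C : R, 0 <= C & forall x s,
  cmod (f x - f s) <= e + C * cmod (cexp1 (x - s) - 1) ^+ 2.
Proof.
have [pf _] := hf; move=> e0; have [B B0 hB] := C_circle_bounded.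
have e2 : 0 < e / 2 by rewrite divr_gt0.
suff [h h0 hh] : exists2 h : R, 0 < h & forall x s,
    cmod (cexp1 (x - s) - 1) < h -> cmod (f x - f s) <= e.
  exists (2 * B / h ^+ 2); first by rewrite divr_ge0 ?sqr_ge0 ?mulr_ge0.
  move=> x s; have [|hx] := ltP (cmod (cexp1 (x - s) - 1)) h.
    move=> /hh /le_trans; apply; rewrite lerDl.
    by rewrite mulr_ge0 ?sqr_ge0// divr_ge0 ?sqr_ge0// mulr_ge0.
  rewrite (@le_trans _ _ (2 * B))//.
    by rewrite (le_trans (cmodD _ _))// cmodN mulr_natl mulr2n lerD.
  rewrite (@le_trans _ _ (2 * B / h ^+ 2 * cmod (cexp1 (x - s) - 1) ^+ 2))//; last first.
    by rewrite lerDr ltW.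
  rewrite -mulrA ler_peMr ?mulr_ge0// mulrC ler_pdivlMr ?exprn_gt0// mul1r.
  by rewrite lerXn2r ?nnegrE ?cmod_ge0 ?(ltW h0).
have near01 : forall x : R, `[0, 1]%classic x ->
    \forall x' \near x & h \near (0 : R)^'+,
      forall s, cmod (cexp1 (x' - s) - 1) < h -> cmod (f x' - f s) <= e.
  move=> x _; have [dl dl0 hdl] := C_circle_cvg x e2.
  have dl2 : 0 < dl / 2 by rewrite divr_gt0.
  have [h0 h00 hh0] := near_int_of_cexp1 dl2.
  exists (ball x (dl / 2), [set h | h < h0]) => /=.
    split; first exact: nbhsx_ballx.
    by exists h0 => //= y /=; rewrite sub0r normrN => yh _; rewrite (le_lt_trans (ler_norm _)).
  move=> [y h] [/= yx hh1] s ys.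
  have [k hk] := hh0 (y - s) (lt_trans ys hh1).
  move: yx; rewrite /ball /= distrC => yx.
  have -> : f s = f (s + k%:~R) by rewrite periodic1_int.
  have f1 : cmod (f y - f x) < e / 2.
    by apply: hdl; rewrite (lt_trans yx)// gtr_pMr// invf_lt1 ?ltr1n.
  have f2 : cmod (f (s + k%:~R) - f x) < e / 2.
    apply: hdl; rewrite (_ : _ - x = (y - x) - (y - s - k%:~R)); last by ring.
    by rewrite (le_lt_trans (ler_normB _ _))// [ltRHS]splitr ltrD.
  rewrite (_ : _ - _ = (f y - f x) - (f (s + k%:~R) - f x)); last by ring.
  rewrite (le_trans (cmodD _ _))// cmodN [leRHS]splitr.
  by rewrite lerD// ltW.
have [h0 h00 hh0] := @covering _ _ (fun h x => forall s,
  cmod (cexp1 (x - s) - 1) < h -> cmod (f x - f s) <= e) _ near01.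
exists (h0 / 2); first by rewrite divr_gt0.
move=> x s xs.
pose k := - Num.floor x.
rewrite -(periodic1_int pf x k).
have h0h : h0 / 2 < h0 by rewrite gtr_pMr// invf_lt1 ?ltr1n.
have q0 : 0 < h0 / 2 by rewrite divr_gt0.
have hn : `|0 - h0 / 2| < h0 by rewrite sub0r normrN gtr0_norm.
have xk : `[0, 1]%classic (x + k%:~R).
  rewrite /= in_itv /= /k mulrNz.
  have /andP[h1 h2] := floor_itv x; rewrite intrD in h2.
  by rewrite subr_ge0 h1 lerBlDl ltW.
have ek : cexp1 (x + k%:~R - s) = cexp1 (x - s).
  by rewrite [X in cexp1 X = _]addrAC [LHS]cexp1D cexp1_int mulr1.
by have := hh0 _ hn q0 _ xk s; rewrite ek; exact.
Qed.

End circle_continuity.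

(** * Fejer's theorem *)

Section fejer.
Context {R : realType}.
Local Notation leb := (@lebesgue_measure R).
Local Notation D := (@circle_dom R).

Lemma measurable_circle_dom : measurable D.
Proof. exact: measurable_itv. Qed.

Lemma lebesgue_circle_dom : leb D = 1%E.
Proof. by rewrite /circle_dom lebesgue_measure_itv /= lte_fin ltr01 oppr0 adde0. Qed.

Lemma integral_circle_cst (c : R) : (\int[leb]_(x in D) c%:E = c%:E)%E.
Proof.
have := integral_cst leb measurable_circle_dom c%:E.
by rewrite [X in (_ * X)%E]lebesgue_circle_dom mule1.
Qed.

Lemma cintegrable_bounded (g : R -> R[i]) (B : R) : cmeasurable g ->
  (forall x, cmod (g x) <= B) -> cintegrable leb D g.
Proof.
move=> mg gB.
have := @cintegrable_bound _ _ _ leb D measurable_circle_dom g (fun=> B) mg.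
by apply => //; rewrite integral_circle_cst ltry.
Qed.

Lemma cmeasurable_cexp1 (c x : R) : cmeasurable (fun t => cexp1 (c * t + x)).
Proof.
have cc : continuous (fun t : R => c * t + x).
  by move=> t; apply: cvgD; [exact: mulrl_continuous|exact: cvg_cst].
split; apply: continuous_measurable_fun => t.
  apply: (@continuous_comp _ _ _ (fun t => c * t + x) (fun y => complex.Re (cexp1 y))).
    exact: cc.
  exact: continuous_cexp1_Re.
apply: (@continuous_comp _ _ _ (fun t => c * t + x) (fun y => complex.Im (cexp1 y))).
  exact: cc.
exact: continuous_cexp1_Im.
Qed.

Lemma cmeasurable_character (n : int) : cmeasurable (fun t : R => cexp1 (n%:~R * t)).
Proof. by have := cmeasurable_cexp1 n%:~R 0; under eq_fun do rewrite addr0. Qed.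

Lemma cint_character (n : int) :
  cint leb D (fun t => cexp1 (n%:~R * t)) = (n == 0)%:R.
Proof.
have [->|n0] := eqVneq n 0.
  apply: complexP => /=; rewrite /Rintegral.
    under eq_integral do rewrite mulr0z mul0r mulr0 cos0.
    by rewrite integral_circle_cst.
  under eq_integral do rewrite mulr0z mul0r mulr0 sin0.
  by rewrite integral_circle_cst.
have c0 : 2 * pi * n%:~R != 0 :> R by rewrite !mulf_neq0 ?intr_eq0 ?pnatr_eq0// gt_eqF// pi_gt0.
set c := 2 * pi * n%:~R in c0.
have cE t : 2 * pi * (n%:~R * t) = c * t by rewrite mulrA.
(* Over a full period a primitive takes the same value at both ends. *)
have der (F G : R -> R) : (forall x, is_derive x (1 : R) F (G x)) -> continuous G ->
    F c = F 0 -> \int[leb]_(t in D) G (c * t) = 0.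
  move=> dF cG Fc.
  pose E t := c^-1 * F (c * t).
  have dE x : is_derive x (1 : R) E (G (c * x)).
    have d1 : is_derive x (1 : R) (fun t : R => c * t) (c *: (1 : R^o)).
      exact: (@is_deriveZ R R R id c x 1 1 (is_derive_id x 1)).
    have d2 := @is_derive1_comp R F (fun t => c * t) x _ _ (dF (c * x)) d1.
    have d3 := @is_deriveZ R R R _ c^-1 x 1 _ d2.
    apply: (is_derive_eq d3).
    by rewrite /GRing.scale /= mulr1 mulrCA mulVf// mulr1.
  have contc : continuous (fun t => G (c * t)).
    move=> t; apply: (@continuous_comp _ _ _ (fun t => c * t) G); last exact: cG.
    exact: mulrl_continuous.
  have contE : continuous E.
    by move=> x; apply/differentiable_continuous/derivable1_diffP; case: (dE x).
  rewrite /Rintegral /circle_dom integral_itv_bndo_bndc; last first.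
    apply: measurable_funTS; apply/measurable_EFinP.
    exact: continuous_measurable_fun.
  rewrite (@continuous_FTC2 _ _ E)//.
  - by rewrite /E mulr1 mulr0 Fc -EFinD subrr.
  - exact: continuous_subspaceT.
  - split.
    + by move=> x _; case: (dE x).
    + exact: cvg_at_right_filter (contE 0).
    + exact: cvg_at_left_filter (contE 1).
  - by move=> x _; rewrite derive1E; case: (dE x).
have cos_per : cos c = 1 /\ sin c = 0.
  by have : cexp1 (n%:~R : R) = 1 := cexp1_int n; rewrite /cexp1 -/c => -[].
apply: complexP => /=.
  under eq_Rintegral do rewrite cE.
  apply: (der sin cos).
  - exact: continuous_cos.
  - by rewrite cos_per.2 sin0.
under eq_Rintegral do rewrite cE.
apply: (der (fun t => - cos t) sin).
- by move=> x; have := @is_deriveN _ _ _ cos x 1 _ (is_derive_cos x); rewrite opprK.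
- exact: continuous_sin.
- by rewrite cos_per.1 cos0.
Qed.

Lemma sum_sym_range (V : nmodType) (F : int -> V) (m : nat) :
  \sum_(n <- sym_range m) F n =
  (\sum_(i < m) F (i%:Z - m%:Z) + F 0) + \sum_(i < m) F (m%:Z - i%:Z).
Proof.
rewrite -big_sym_range -(big_mkord xpredT (fun k => F (k%:Z - m%:Z))).
rewrite (big_cat_nat (n := m.+1)) //=; last by lia.
rewrite big_nat_recr//= subrr big_mkord; congr (_ + _).
rewrite -{1}[m.+1]add0n big_addn (_ : ((2 * m).+1 - m.+1 = m)%N); last by lia.
rewrite big_mkord (reindex_inj rev_ord_inj) /=; apply: eq_bigr => i _.
by congr F; have := ltn_ord i; lia.
Qed.

(** The Cesaro sums of the symmetric partial sums are sums over differences: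
    this is what makes the Fejer kernel a square, hence nonnegative. *)
Lemma sum_sym_range_toeplitz (V : nmodType) (F : int -> V) (m : nat) :
  \sum_(k < m) \sum_(n <- sym_range k) F n =
  \sum_(i < m) \sum_(j < m) F (i%:Z - j%:Z).
Proof.
elim: m => [|m ih]; first by rewrite !big_ord0.
rewrite big_ord_recr ih /= sum_sym_range [RHS]big_ord_recr /=.
under [X in _ = X + _]eq_bigr do rewrite big_ord_recr /=.
by rewrite big_split /= [in RHS]big_ord_recr /= subrr -!addrA; congr (_ + (_ + _)); rewrite addrC.
Qed.

Definition cesaro_mean (u : int -> R[i]) (n : nat) : R[i] :=
  (n.+1%:R^-1)%:C * \sum_(k < n.+1) \sum_(j <- sym_range k) u j.

Definition fejer_kernel (n : nat) (v : R) : R :=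
  n.+1%:R^-1 * cmod (\sum_(k < n.+1) cexp1 (k%:R * v)) ^+ 2.

Lemma fejer_kernel_ge0 n v : 0 <= fejer_kernel n v.
Proof. by rewrite mulr_ge0 ?invr_ge0 ?sqr_ge0. Qed.

Lemma fejer_kernelE n v :
  (fejer_kernel n v)%:C = cesaro_mean (fun j => cexp1 (j%:~R * v)) n.
Proof.
rewrite /fejer_kernel /cesaro_mean rmorphM /= -mul_conj; congr (_ * _).
rewrite sum_sym_range_toeplitz mulr_suml; apply: eq_bigr => i _.
have -> : conjc (\sum_(k < n.+1) cexp1 (k%:R * v)) = \sum_(k < n.+1) cexp1 (- (k%:R * v)).
  by rewrite (rmorph_sum conjc); apply: eq_bigr => k _; exact: conj_cexp1.
rewrite mulr_sumr; apply: eq_bigr => j _.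
by rewrite -cexp1D intrD mulrDl intrN mulNr -!pmulrn.
Qed.

Lemma cexp1_natM (k : nat) (v : R) : cexp1 (k%:R * v) = cexp1 v ^+ k.
Proof.
elim: k => [|k ih]; first by rewrite mul0r cexp10 expr0.
by rewrite -natr1 mulrDl mul1r cexp1D ih exprSr.
Qed.

(** Multiplied by [cexp1 v - 1], the geometric sum in the kernel telescopes to
    [cexp1 (n.+1%:R * v) - 1], of modulus at most 2. *)
Lemma fejer_kernel_concentrated n v :
  cmod (cexp1 v - 1) ^+ 2 * fejer_kernel n v <= 4 * n.+1%:R^-1.
Proof.
rewrite /fejer_kernel mulrCA mulrC ler_wpM2r ?invr_ge0// -exprMn -cmodM.
under eq_bigr do rewrite cexp1_natM.
rewrite -subrX1 -cexp1_natM.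
have : cmod (cexp1 (n.+1%:R * v) - 1) <= 2.
  by rewrite (le_trans (cmodD _ _))// cmodN cmod1 cmod_cexp1 -mulr2n.
move=> h; apply: (@le_trans _ _ (2 ^+ 2)); last by lra.
by rewrite lerXn2r ?nnegrE ?cmod_ge0.
Qed.

Lemma cmod_cesaro_le n (B : R) : exists C : R, forall u : int -> R[i],
  (forall j, cmod (u j) <= B) -> cmod (cesaro_mean u n) <= C.
Proof.
exists (cmod (n.+1%:R^-1)%:C * \sum_(k < n.+1) \sum_(j <- sym_range k) B) => u uB.
rewrite /cesaro_mean cmodM ler_wpM2l ?cmod_ge0//.
rewrite (le_trans (cmod_sum _ _ _))//; apply: ler_sum => k _.
by rewrite (le_trans (cmod_sum _ _ _))//; apply: ler_sum => j _.
Qed.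

Lemma cint_cesaro (F : int -> R -> R[i]) (n : nat) :
  (forall j, cintegrable leb D (F j)) ->
  cint leb D (fun s => cesaro_mean (fun j => F j s) n) =
  cesaro_mean (fun j => cint leb D (F j)) n.
Proof.
move=> iF; have mD := measurable_circle_dom.
rewrite /cesaro_mean cintZ//; last first.
  by apply: cintegrable_sum => // k; exact: cintegrable_sum.
rewrite cint_sum//; last by move=> k; exact: cintegrable_sum.
by congr (_ * _); apply: eq_bigr => k _; rewrite cint_sum.
Qed.

Lemma cmeasurable_cesaro (F : int -> R -> R[i]) (n : nat) :
  (forall j, cmeasurable (F j)) -> cmeasurable (fun s => cesaro_mean (fun j => F j s) n).
Proof.
move=> mF; apply: cmeasurableM; first exact: cmeasurable_cst.
by apply: cmeasurable_sum => k; exact: cmeasurable_sum.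
Qed.

Lemma cmeasurable_character_sub (j : int) (x : R) :
  cmeasurable (fun s : R => cexp1 (j%:~R * (x - s))).
Proof.
have := cmeasurable_cexp1 (- j%:~R) (j%:~R * x).
by under eq_fun do rewrite mulNr addrC -mulrBr.
Qed.

Lemma measurable_fejer_kernel n x : measurable_fun setT (fun s : R => fejer_kernel n (x - s)).
Proof.
have [+ _] := cmeasurable_cesaro n (fun j => cmeasurable_character_sub j x).
by under eq_fun do rewrite -fejer_kernelE.
Qed.

Lemma cint_fejer_kernel n x : cint leb D (fun s : R => (fejer_kernel n (x - s))%:C) = 1.
Proof.
have mD := measurable_circle_dom.
under eq_fun do rewrite fejer_kernelE.
have ic j : cintegrable leb D (fun s : R => cexp1 (j%:~R * (x - s))).
  apply: (cintegrable_bounded (B := 1)); first exact: cmeasurable_character_sub.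
  by move=> s; rewrite cmod_cexp1.
rewrite cint_cesaro//.
have cj j : cint leb D (fun s : R => cexp1 (j%:~R * (x - s))) = (j == 0)%:R.
  transitivity (cint leb D (fun s : R => cexp1 (j%:~R * x) * cexp1 ((- j)%:~R * s))).
    by congr cint; apply/funext => s; rewrite -cexp1D mulrBr mulrNz mulNr.
  rewrite cintZ//; last first.
    by apply: (cintegrable_bounded (B := 1)); [exact: cmeasurable_character|move=> s; rewrite cmod_cexp1].
  rewrite cint_character oppr_eq0; have [->|] := eqVneq j 0; last by rewrite mulr0.
  by rewrite mulr0z mul0r cexp10 mulr1.
rewrite /cesaro_mean; under eq_bigr do under eq_bigr do rewrite cj.
have one k : \sum_(j <- sym_range k) (j == 0)%:R = 1 :> R[i].
  rewrite (bigD1_seq 0) ?uniq_sym_range ?mem_sym_range//= big1 ?addr0// => j j0.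
  by rewrite (negbTE j0).
under eq_bigr do rewrite one.
rewrite sumr_const card_ord -(rmorph_nat (real_complex R)) -rmorphM.
by rewrite mulVf ?rmorph1// pnatr_eq0.
Qed.

Lemma integral_fejer_kernel n x :
  (\int[leb]_(s in D) (fejer_kernel n (x - s))%:E = 1%:E)%E.
Proof.
have := congr1 (@complex.Re R) (cint_fejer_kernel n x); rewrite /= /Rintegral => h.
have i1 : (\int[leb]_(s in D) (fejer_kernel n (x - s))%:E)%E \is a fin_num.
  have [C hC] := cmod_cesaro_le n 1.
  have := @cintegrable_bounded (fun s : R => (fejer_kernel n (x - s))%:C) C.
  case.
  - split; first exact: measurable_fejer_kernel.
    exact: measurable_cst.
  - by move=> s; rewrite fejer_kernelE; apply: hC => j; rewrite cmod_cexp1.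
  - by move=> iK _; apply: (integrable_fin_num _ iK); exact: measurable_circle_dom.
by rewrite -(fineK i1) h.
Qed.

Context (f : R -> R[i]) (hf : C_circle f).

(** Fejer's theorem, for the Cesaro means of the Fourier series. The kernel is
    nonnegative with integral 1, and [C_circle_unif] bounds [f x - f s] by a
    small constant plus a multiple of a function that it nearly annihilates. *)
Theorem fejer_uniform (e : R) : 0 < e -> exists N : nat, forall n x, (N <= n)%N ->
  cmod (f x - cesaro_mean (fun j => fourier_coef f j * cexp1 (j%:~R * x)) n) <= e.
Proof.
have mD := measurable_circle_dom.
have mf := C_circle_measurable hf; have [B B0 hB] := C_circle_bounded hf.
move=> e0; have e4 : 0 < e / 4 by rewrite divr_gt0.
have [C C0 hC] := C_circle_unif hf e4.
pose N := (Num.truncn (16 * C / e)).+1.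
exists N => n x Nn.
have iterm j : cintegrable leb D (fun t => f t * cexp1 (- (j%:~R * t))).
  apply: (cintegrable_bounded (B := B)).
    apply: cmeasurableM => //; have := cmeasurable_character (- j).
    by under eq_fun do rewrite mulrNz mulNr.
  by move=> t; rewrite cmodM cmod_cexp1 mulr1.
have ifj j : cintegrable leb D (fun s : R => f s * cexp1 (j%:~R * (x - s))).
  apply: (cintegrable_bounded (B := B)).
    by apply: cmeasurableM => //; exact: cmeasurable_character_sub.
  by move=> t; rewrite cmodM cmod_cexp1 mulr1.
have cesM (z : R[i]) u : cesaro_mean (fun j => z * u j) n = z * cesaro_mean u n.
  rewrite /cesaro_mean mulrCA; congr (_ * _); rewrite mulr_sumr.
  by apply: eq_bigr => k _; rewrite mulr_sumr.
have meanE : cesaro_mean (fun j => fourier_coef f j * cexp1 (j%:~R * x)) n =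
    cint leb D (fun s : R => f s * (fejer_kernel n (x - s))%:C).
  under [in RHS]eq_fun do rewrite fejer_kernelE -cesM.
  rewrite cint_cesaro//; congr cesaro_mean; apply/funext => j.
  rewrite /fourier_coef mulrC -cintZ//; congr cint; apply/funext => s.
  by rewrite mulrCA -cexp1D mulrBr.
have mK : cmeasurable (fun s : R => (fejer_kernel n (x - s))%:C).
  by split; [exact: measurable_fejer_kernel|exact: measurable_cst].
have [CK hCK] := cmod_cesaro_le n 1.
have KB s : cmod (fejer_kernel n (x - s))%:C <= CK.
  by rewrite fejer_kernelE; apply: hCK => j; rewrite cmod_cexp1.
have fxE : f x = cint leb D (fun s : R => f x * (fejer_kernel n (x - s))%:C).
  rewrite cintZ//; first by rewrite cint_fejer_kernel mulr1.
  exact: cintegrable_bounded KB.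
have diffE : f x - cesaro_mean (fun j => fourier_coef f j * cexp1 (j%:~R * x)) n =
    cint leb D (fun s => (f x - f s) * (fejer_kernel n (x - s))%:C).
  rewrite meanE {1}fxE -mulN1r -cintZ//; last first.
    apply: (cintegrable_bounded (B := B * CK)); first exact: cmeasurableM.
    by move=> s; rewrite cmodM ler_pM ?cmod_ge0.
  rewrite -cintD//; first by congr cint; apply/funext => s; rewrite mulN1r mulrBl.
    by apply: cintegrableZ => //; exact: cintegrable_bounded KB.
  apply: cintegrableZ => //; apply: (cintegrable_bounded (B := B * CK)); first exact: cmeasurableM.
  by move=> s; rewrite cmodM ler_pM ?cmod_ge0.
rewrite diffE.
have n0 : 0 < n.+1%:R :> R by rewrite ltr0n.
have small : 4 * C * n.+1%:R^-1 <= e / 4.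
  rewrite ler_pdivrMr// -ler_pdivrMl//.
  rewrite (_ : (e / 4)^-1 * (4 * C) = 16 * C / e); last by field; rewrite gt_eqF.
  apply: ltW; apply: lt_le_trans (truncnS_gt _) _.
  by rewrite ler_nat ltnW// ltnS.
apply: (@le_trans _ _ (2 * (e / 4 + 4 * C * n.+1%:R^-1))); last first.
  rewrite [leRHS](_ : e = 2 * (e / 4 + e / 4)); last by field.
  by rewrite ler_pM2l// lerD2l.
have key := @cmod_cint_le _ _ _ leb D mD
  (fun s : R => (f x - f s) * (fejer_kernel n (x - s))%:C)
  (fun s : R => e / 4 * fejer_kernel n (x - s) + 4 * C * n.+1%:R^-1 * 1)
  (e / 4 + 4 * C * n.+1%:R^-1).
apply: key.
- by apply: cmeasurableM => //; apply: cmeasurableB => //; exact: cmeasurable_cst.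
- apply: measurable_funD => //; apply: measurable_funM => //.
  exact: measurable_fejer_kernel.
- move=> s _; rewrite cmodM cmodC ger0_norm ?fejer_kernel_ge0//.
  rewrite (le_trans (ler_wpM2r (fejer_kernel_ge0 _ _) (hC x s)))// mulrDl lerD2l mulr1.
  have h := ler_wpM2l C0 (fejer_kernel_concentrated n (x - s)).
  by rewrite -[leLHS]mulrA (le_trans h)// mulrA [C * 4]mulrC.
apply: (@le_trans _ _ ((e / 4)%:E * \int[leb]_(s in D) (fejer_kernel n (x - s))%:E +
   (4 * C * n.+1%:R^-1)%:E * \int[leb]_(s in D) (cst 1 s)%:E)%E).
  apply: ge0_integral_le_lin => //; rewrite ?(ltW e4) ?mulr_ge0 ?invr_ge0//.
  - exact: measurable_fejer_kernel.
  - apply: measurable_funD => //; apply: measurable_funM => //.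
    exact: measurable_fejer_kernel.
  - by move=> s; exact: fejer_kernel_ge0.
  - move=> s; rewrite mulr1; apply: addr_ge0; apply: mulr_ge0.
    + exact: ltW.
    + exact: fejer_kernel_ge0.
    + by rewrite mulr_ge0.
    + by rewrite invr_ge0.
by rewrite integral_fejer_kernel [X in (_ + _ * X)%E](integral_circle_cst 1) !mule1 -EFinD.
Qed.

End fejer.

(** * The Gaussian isometry *)

Section L2_tools.
Context d (T : measurableType d) (R : realType) (P : probability T R).

(** Moment bounds pass to limits in quadratic mean: Fatou's lemma along an
    almost surely convergent subsequence. *)
Lemma moment_L2_limit (z : nat -> T -> R[i]) (W : T -> R[i]) (p : nat) (B : \bar R) :
  (forall n, cmeasurable (z n)) -> cmeasurable W ->
  (fun n => sqnorm P setT (fun x => z n x - W x)) @ \oo --> 0%E ->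
  (forall n, (\int[P]_x (cmod (z n x) ^+ p)%:E <= B)%E) ->
  (\int[P]_x (cmod (W x) ^+ p)%:E <= B)%E.
Proof.
move=> mz mW zW zB; have [phi [_ hphi]] := sqnorm_cvg_subseq_ae mz mW zW.
apply: (@fatou_le _ _ _ _ (fun k x => cmod (z (phi k) x) ^+ p)) => //.
- by move=> k; apply: measurable_funX; exact: measurable_cmod.
- by move=> k x; rewrite exprn_ge0 ?cmod_ge0.
- by apply: measurable_funX; exact: measurable_cmod.
- by move=> x; rewrite exprn_ge0 ?cmod_ge0.
move: hphi; apply: filterS => x hx.
have cz : (fun k => cmod (z (phi k) x)) @ \oo --> cmod (W x).
  apply/cvgrPdist_le => e e0; have /cvgrPdist_le/(_ _ e0) [N _ hN] := hx.
  exists N => // n /hN; rewrite /= sub0r normrN ger0_norm ?cmod_ge0// => h.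
  have h1 := le_trans (cmod_leDB (z (phi n) x) (W x)) (lerD (lexx _) h).
  rewrite cmodBC in h; have h2 := le_trans (cmod_leDB (W x) (z (phi n) x)) (lerD (lexx _) h).
  by rewrite ler_norml; apply/andP; split; lra.
apply: (@continuous_cvg _ R R _ _ _ (fun y : R => y ^+ p) (cmod (W x)) _ cz).
exact: exprn_continuous.
Qed.

Lemma sqnorm_cvg0_lincomb (s : seq int) (c : int -> R[i])
    (z : int -> nat -> T -> R[i]) (W : int -> T -> R[i]) :
  (forall n N, cmeasurable (z n N)) -> (forall n, cmeasurable (W n)) ->
  (forall n, (fun N => sqnorm P setT (fun x => z n N x - W n x)) @ \oo --> 0%E) ->
  (fun N => sqnorm P setT (fun x => \sum_(n <- s) c n * z n N x -
     \sum_(n <- s) c n * W n x)) @ \oo --> 0%E.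
Proof.
move=> mz mW zW; elim: s => [|n s ih].
  under eq_fun do under [X in sqnorm _ _ X]eq_fun do rewrite !big_nil subrr.
  rewrite /sqnorm; under eq_fun do under eq_integral do rewrite cmod0 expr2 mul0r.
  by under eq_fun do rewrite integral0; exact: cvg_cst.
have mc (c' : R[i]) (f : T -> R[i]) : cmeasurable f -> cmeasurable (fun x => c' * f x).
  by move=> mf; apply: cmeasurableM => //; exact: cmeasurable_cst.
under eq_fun => N.
  rewrite (_ : (fun x => _) = (fun x => c n * (z n N x - W n x) +
    (\sum_(n <- s) c n * z n N x - \sum_(n <- s) c n * W n x))); last first.
    by apply/funext => x; rewrite !big_cons mulrBr opprD addrACA.
  over.
apply: sqnorm_cvg0D => //.
- by move=> N; apply: mc; exact: cmeasurableB.
- by move=> N; apply: cmeasurableB; apply: cmeasurable_sum => m; exact: mc.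
have -> : (fun N => sqnorm P setT (fun x => c n * (z n N x - W n x))) =
    (fun N => (cmod (c n) ^+ 2)%:E * sqnorm P setT (fun x => (z n N x - W n x)%R))%E.
  by apply/funext => N; rewrite sqnormZ//; exact: cmeasurableB.
rewrite -(mule0 (cmod (c n) ^+ 2)%:E); apply: cvgeZl => //; exact: zW.
Qed.

Lemma sqr_sum_le (n : nat) (x : nat -> R) :
  (\sum_(k < n) x k) ^+ 2 <= n%:R * \sum_(k < n) x k ^+ 2.
Proof.
elim: n => [|n ih]; first by rewrite !big_ord0 expr2 !mul0r.
rewrite !big_ord_recr /=; set S := \sum_(k < n) x k in ih *.
set Q := \sum_(k < n) x k ^+ 2 in ih *.
have Q0 : 0 <= Q by apply: sumr_ge0 => k _; exact: sqr_ge0.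
have cross : 2 * (S * x n) <= Q + n%:R * x n ^+ 2.
  have [n0|n0] := eqVneq n 0%N.
    have -> : S = 0 by rewrite /S n0 big_ord0.
    by rewrite mul0r mulr0; apply: addr_ge0 => //; rewrite mulr_ge0 ?sqr_ge0.
  have np : 0 < n%:R :> R by rewrite ltr0n lt0n.
  rewrite -(ler_pM2l np); apply: (@le_trans _ _ (S ^+ 2 + (n%:R * x n) ^+ 2)).
    rewrite -subr_ge0 (_ : _ - _ = (S - n%:R * x n) ^+ 2) ?sqr_ge0//; ring.
  rewrite (_ : n%:R * (Q + n%:R * x n ^+ 2) = n%:R * Q + (n%:R * x n) ^+ 2); last by ring.
  by rewrite lerD2r.
rewrite (_ : (S + x n) ^+ 2 = S ^+ 2 + 2 * (S * x n) + x n ^+ 2); last by ring.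
rewrite -[n.+1%:R]natr1 (_ : (n%:R + 1) * (Q + x n ^+ 2) =
  n%:R * Q + (Q + n%:R * x n ^+ 2) + x n ^+ 2); last by ring.
by rewrite lerD2r lerD.
Qed.

Lemma sqnorm_mean_le (z : nat -> T -> R[i]) (n : nat) : (forall k, cmeasurable (z k)) ->
  (sqnorm P setT (fun x => (n.+1%:R^-1)%:C * \sum_(k < n.+1) z k x)%R <=
   (n.+1%:R^-1)%:E * \sum_(k < n.+1) sqnorm P setT (z k))%E.
Proof.
move=> mz; have n0 : 0 < n.+1%:R :> R by rewrite ltr0n.
rewrite sqnormZ//; last exact: cmeasurable_sum.
rewrite cmodC ger0_norm ?invr_ge0//.
apply: (@le_trans _ _ ((n.+1%:R^-1 ^+ 2)%:E * (n.+1%:R%:E *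
    \sum_(k < n.+1) sqnorm P setT (z k))))%E.
  apply: lee_wpmul2l; first by rewrite lee_fin sqr_ge0.
  rewrite -ge0_integral_sum//; last 2 first.
  - by move=> k; exact: measurable_cmodX.
  - by move=> k x _; rewrite lee_fin sqr_ge0.
  rewrite -ge0_integralZl//; last 2 first.
  - by apply: emeasurable_sum => k; exact: measurable_cmodX.
  - by move=> x _; apply: sume_ge0 => k _; rewrite lee_fin sqr_ge0.
  apply: ge0_le_integral => //.
  - by move=> x _; rewrite lee_fin sqr_ge0.
  - by apply: measurable_cmodX; exact: cmeasurable_sum.
  - by apply: measurable_funeM; apply: emeasurable_sum => k; exact: measurable_cmodX.
  - move=> x _; rewrite sumEFin -EFinM lee_fin.
    apply: le_trans (sqr_sum_le _ (fun k => cmod (z k x))).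
    rewrite lerXn2r ?nnegrE ?cmod_ge0 ?cmod_sum//.
    by apply: sumr_ge0 => k _; exact: cmod_ge0.
by rewrite muleA -EFinM expr2 -mulrA mulVf ?mulr1.
Qed.

(** Convexity of the squared norm reduces this to the Cesaro theorem for the
    real sequence of squared norms. *)
Lemma sqnorm_cesaro_cvg0 (z : nat -> T -> R[i]) : (forall k, cmeasurable (z k)) ->
  (forall k, (sqnorm P setT (z k) < +oo)%E) ->
  (fun k => sqnorm P setT (z k)) @ \oo --> 0%E ->
  (fun n => sqnorm P setT (fun x => (n.+1%:R^-1)%:C * \sum_(k < n.+1) z k x)) @ \oo --> 0%E.
Proof.
move=> mz zoo z0.
have fz k : sqnorm P setT (z k) = (fine (sqnorm P setT (z k)))%:E.
  by rewrite sqnorm_fineK.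
have /fine_cvgP[_ /cesaro z0'] := z0.
apply: (@squeeze_cvge _ _ _ _ (cst 0%E) _
  (fun n => (arithmetic_mean (fun k => fine (sqnorm P setT (z k))) n)%:E)).
- apply: nearW => n; rewrite sqnorm_ge0/= (le_trans (sqnorm_mean_le n mz))//.
  rewrite /arithmetic_mean /series /= EFinM -sumEFin big_mkord.
  by under [in leRHS]eq_bigr do rewrite -fz.
- exact: cvg_cst.
- by apply: cvg_EFin => //; exact: nearW.
Qed.

End L2_tools.

Section gaussian_isometry.
Context d (T : measurableType d) (R : realType) (P : probability T R).
Context (A : set int) (Z : int -> T -> R[i]).
Context (mZ : forall n, cmeasurable (Z n)) (indZ : independent_family P A Z).
Context (stdZ : forall n, A n -> standard_complex_gaussian P (Z n)).
Context (mu : probability R R) (e : int -> R -> R[i]).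
Local Notation D := (@circle_dom R).
Context (he : forall n, A n -> cL2 mu D (e n)).
Context (ortho : forall n m, A n -> A m -> inner mu (e n) (e m) = (n == m)%:R).

Let mD : measurable D. Proof. exact: measurable_itv. Qed.

(** The partial sums of the isometry that maps [e n] to [Z n], for [n] in
    [A]. *)
Definition gauss_psum (g : R -> R[i]) (N : nat) (w : T) : R[i] :=
  \sum_(n <- [seq n <- sym_range N | n \in A]) inner mu g (e n) * Z n w.

Lemma gauss_psumE g N w : gauss_psum g N w =
  \sum_(n <- sym_range N) (if n \in A then inner mu g (e n) * Z n w else 0).
Proof. by rewrite /gauss_psum big_filter big_mkcond. Qed.

Lemma cmeasurable_gauss_psum g N : cmeasurable (gauss_psum g N).
Proof.
by apply: cmeasurable_sum => n; apply: cmeasurableM => //; exact: cmeasurable_cst.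
Qed.

Let inA (s : seq int) (Q : pred int) n :
  n \in [seq n <- s | Q n && (n \in A)] -> A n.
Proof. by rewrite mem_filter => /andP[/andP[_ /set_mem]]. Qed.

Let bessel_sum g N : R := \sum_(n <- [seq n <- sym_range N | n \in A]) cmod (inner mu g (e n)) ^+ 2.

Let bessel_sum_le g N : cL2 mu D g -> bessel_sum g N <= fine (sqnorm mu D g).
Proof.
move=> Lg; apply: bessel => //.
- by rewrite filter_uniq ?uniq_sym_range.
- by move=> n; rewrite mem_filter => /andP[/set_mem An _]; exact: he.
- by move=> n m; rewrite !mem_filter => /andP[/set_mem An _] /andP[/set_mem Am _]; exact: ortho.
Qed.

(** Bessel's inequality makes the bound uniform in [N]. *)
Lemma gauss_psum_moments (q : nat) : exists2 C : R, 0 <= C & forall g N v,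
  cL2 mu D g -> fine (sqnorm mu D g) <= v ->
  (\int[P]_w (cmod (gauss_psum g N w) ^+ (2 * q))%:E <= (C * v ^+ q)%:E)%E.
Proof.
have [C C0 hC] := gaussian_sum_moments mZ indZ stdZ q; exists C => // g N v Lg gv.
apply: hC.
- by rewrite filter_uniq ?uniq_sym_range.
- by move=> n; rewrite mem_filter => /andP[/set_mem].
- exact: le_trans (bessel_sum_le _ Lg) gv.
Qed.

Lemma gauss_psum_cvg g : cL2 mu D g -> exists2 W : T -> R[i], cmeasurable W &
  (fun N => sqnorm P setT (fun w => gauss_psum g N w - W w)) @ \oo --> 0%E.
Proof.
move=> Lg; apply: sqnorm_complete => [N|eps eps0]; first exact: cmeasurable_gauss_psum.
have [C C0 hC] := gaussian_sum_moments mZ indZ stdZ 1.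
pose term n := if n \in A then cmod (inner mu g (e n)) ^+ 2 else 0.
have bE N : bessel_sum g N = \sum_(n <- sym_range N) term n.
  by rewrite /bessel_sum big_filter big_mkcond.
have term0 n : 0 <= term n by rewrite /term; case: ifP => // _; exact: sqr_ge0.
have nd : nondecreasing_seq (bessel_sum g).
  move=> N M NM; rewrite !bE (sym_range_split _ NM) lerDl.
  by apply: sumr_ge0 => n _.
have cv : cvgn (bessel_sum g).
  apply: nondecreasing_is_cvgn => //; exists (fine (sqnorm mu D g)) => _ [N _ <-].
  exact: bessel_sum_le.
have incr N M : (N <= M)%N ->
    (sqnorm P setT (fun w => (gauss_psum g M w - gauss_psum g N w)%R) <=
     (C * (bessel_sum g M - bessel_sum g N))%:E)%E.
  move=> NM; pose s := [seq n <- sym_range M | (N < absz n)%N && (n \in A)].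
  have := hC s (fun n => inner mu g (e n)) (bessel_sum g M - bessel_sum g N).
  rewrite muln1 expr1 => hs; apply: le_trans (hs _ _ _).
  - rewrite le_eqVlt; apply/orP; left; apply/eqP; apply: eq_integral => w _.
    congr ((cmod _ ^+ 2)%:E); rewrite !gauss_psumE (sym_range_split _ NM) addrC addKr.
    by rewrite big_filter big_mkcondr.
  - by rewrite filter_uniq ?uniq_sym_range.
  - by move=> n /inA.
  - rewrite !bE (sym_range_split _ NM) addrC addKr big_filter big_mkcondr.
    exact: lexx.
have C1 : 0 < C + 1 by rewrite ltr_wpDl.
have /cvgrPdist_lt/(_ (eps / (C + 1))) := cv.
rewrite divr_gt0// => /(_ isT)[N _ hN]; exists N.
have main m n : (N <= n)%N -> (n <= m)%N ->
    (sqnorm P setT (fun w => (gauss_psum g m w - gauss_psum g n w)%R) <= eps%:E)%E.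
  move=> Nn nm; apply: (le_trans (incr _ _ nm)); rewrite lee_fin.
  have bl : bessel_sum g m <= limn (bessel_sum g) by exact: nondecreasing_cvgn_le.
  have hn : limn (bessel_sum g) - bessel_sum g n < eps / (C + 1).
    by rewrite (le_lt_trans (ler_norm _))// hN.
  have d0 : 0 <= bessel_sum g m - bessel_sum g n by rewrite subr_ge0 nd.
  apply: (@le_trans _ _ ((C + 1) * (bessel_sum g m - bessel_sum g n))).
    by rewrite ler_wpM2r// lerDl.
  rewrite mulrC -ler_pdivlMr//; apply: le_trans (ltW hn).
  by rewrite lerD2r.
move=> m n Nm Nn; have [nm|/ltnW mn] := leqP n m; first exact: main.
rewrite (_ : sqnorm _ _ _ = sqnorm P setT (fun w => gauss_psum g n w - gauss_psum g m w)).
  exact: main.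
by apply: eq_integral => w _; rewrite cmodBC.
Qed.

Lemma inner_lincomb (s : seq int) (c : int -> R[i]) (g : int -> R -> R[i]) n : A n ->
  (forall m, cL2 mu D (g m)) ->
  inner mu (fun u => \sum_(m <- s) c m * g m u) (e n) = \sum_(m <- s) c m * inner mu (g m) (e n).
Proof.
move=> An Lg; have ig m : cintegrable mu D (fun u => g m u * conjc (e n u)).
  by apply: cintegrable_mul_conj => //; exact: he.
transitivity (cint mu D (fun u => \sum_(m <- s) c m * (g m u * conjc (e n u)))).
  congr cint; apply/funext => u; rewrite mulr_suml.
  by apply: eq_bigr => m _; rewrite mulrA.
rewrite cint_sum//; last by move=> m; exact: cintegrableZ.
by apply: eq_bigr => m _; rewrite cintZ.
Qed.

Lemma gauss_psum_lincomb (s : seq int) (c : int -> R[i]) (g : int -> R -> R[i]) N w :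
  (forall m, cL2 mu D (g m)) ->
  gauss_psum (fun u => \sum_(m <- s) c m * g m u) N w =
  \sum_(m <- s) c m * gauss_psum (g m) N w.
Proof.
move=> Lg; rewrite /gauss_psum; under [RHS]eq_bigr do rewrite mulr_sumr.
rewrite [RHS]exchange_big !big_filter.
apply: eq_bigr => n /set_mem An; rewrite inner_lincomb// mulr_suml.
by apply: eq_bigr => m _; rewrite mulrA.
Qed.

Lemma gauss_psumB g h N w : cL2 mu D g -> cL2 mu D h ->
  gauss_psum (fun u => g u - h u) N w = gauss_psum g N w - gauss_psum h N w.
Proof.
move=> Lg Lh; rewrite /gauss_psum -sumrB !big_filter; apply: eq_bigr => n /set_mem An.
rewrite -mulrBl; congr (_ * _); rewrite -[X in _ - X]mul1r -mulNr -cintZ//; last first.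
  by apply: cintegrable_mul_conj => //; exact: he.
rewrite -cintD//.
- by congr cint; apply/funext => u; rewrite mulN1r mulrBl.
- by apply: cintegrable_mul_conj => //; exact: he.
- by apply: cintegrableZ => //; apply: cintegrable_mul_conj => //; exact: he.
Qed.

End gaussian_isometry.

(** * The spectral representation *)

Section spectral_representation.
Context (R : realType) (H : R) (H2 : 2^-1 <= H).
Context (mu : probability R R) (spec : fgn_spectral_measure H mu).
Local Notation D := (@circle_dom R).

Let mD : measurable D. Proof. exact: measurable_itv. Qed.

Let character (n : int) (u : R) : R[i] := cexp1 (n%:~R * u).

Lemma cL2_spectral_bounded (g : R -> R[i]) (B : R) : cmeasurable g ->
  (forall u, cmod (g u) <= B) -> cL2 mu D g /\ fine (sqnorm mu D g) <= B ^+ 2.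
Proof.
move=> mg gB; have B0 : 0 <= B by exact: le_trans (cmod_ge0 _) (gB 0).
have h : (sqnorm mu D g <= (B ^+ 2)%:E)%E.
  have := integral_cst mu mD (B ^+ 2)%:E; have [circ _] := spec.
  rewrite [X in (_ * X)%E]circ mule1 => <-; apply: ge0_le_integral => //.
  - by move=> u _; rewrite lee_fin sqr_ge0.
  - exact: measurable_cmodX.
  - by move=> u _; rewrite lee_fin lerXn2r ?nnegrE ?cmod_ge0.
have Lg : cL2 mu D g by split => //; rewrite (le_lt_trans h)// ltry.
by split => //; rewrite -lee_fin -sqnorm_fineK.
Qed.

Let cL2_character n : cL2 mu D (character n).
Proof.
have [] // := @cL2_spectral_bounded (character n) 1; first exact: cmeasurable_character.
by move=> u; rewrite cmod_cexp1.
Qed.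

Let character_cov n m :
  cint mu D (fun u => character n u * conjc (character m u)) = (fgn_cov H (n - m))%:C.
Proof.
have [_ ->] := spec; congr cint; apply/funext => u.
by rewrite /character conj_cexp1 -cexp1D rmorphB mulrBl.
Qed.

Context d (T : measurableType d) (P : probability T R).
Context (A : set int) (Z : int -> T -> R[i]) (e : int -> R -> R[i]).
Context (mZ : forall n, cmeasurable (Z n)) (indZ : independent_family P A Z).
Context (stdZ : forall n, A n -> standard_complex_gaussian P (Z n)).
Context (he : forall n, A n -> cL2 mu D (e n)).
Context (ortho : forall n m, A n -> A m -> inner mu (e n) (e m) = (n == m)%:R).

Let gsum := gauss_psum A Z mu e.

Let mgsum g N : cmeasurable (gsum g N).
Proof. exact: cmeasurable_gauss_psum. Qed.

(** The images of the characters under the Gaussian isometry form a noise with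
    the covariance [fgn_cov], by definition of the spectral measure. *)
Lemma noise_of_spectral_measure : exists W : int -> T -> R[i],
  [/\ forall n, cmeasurable (W n), fgn_moments P H W &
      forall n, (fun N => sqnorm P setT (fun w => gsum (character n) N w - W n w)) @ \oo --> 0%E].
Proof.
have hW n : exists W, cmeasurable W /\
    (fun N => sqnorm P setT (fun w => gsum (character n) N w - W w)) @ \oo --> 0%E.
  by have [W mW cW] := gauss_psum_cvg mZ indZ stdZ he ortho (cL2_character n); exists W.
have {hW}[W hW] := choice hW.
have mW n : cmeasurable (W n) := (hW n).1.
have cW n := (hW n).2.
exists W; split => // q.
have [C C0 hC] := gauss_psum_moments mZ indZ stdZ he ortho q.
exists C => // s c us.
have Ls : cL2 mu D (fun u => \sum_(n <- s) c n * character n u).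
  by apply: cL2_sum => // n _; exact: cL2Z.
have form : fine (sqnorm mu D (fun u => \sum_(n <- s) c n * character n u)) <= fgn_form H s c.
  rewrite -lee_fin -(sqnorm_fineK Ls).
  apply: (le_trans (@sqnorm_lincomb_le _ _ _ mu D mD s c character (fun n _ => cL2_character n))).
  rewrite lee_fin; apply: ler_sum => n _; apply: ler_sum => m _.
  by rewrite character_cov cmodC ger0_norm// fgn_cov_ge0.
apply: (@moment_L2_limit _ _ _ _ (fun N w => \sum_(n <- s) c n * gsum (character n) N w)).
- by move=> N; apply: cmeasurable_sum => n; apply: cmeasurableM => //; exact: cmeasurable_cst.
- by apply: cmeasurable_sum => n; apply: cmeasurableM => //; exact: cmeasurable_cst.
- exact: sqnorm_cvg0_lincomb.
- move=> N; apply: le_trans (hC _ N _ Ls form).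
  rewrite le_eqVlt; apply/orP; left; apply/eqP; apply: eq_integral => w _.
  by rewrite gauss_psum_lincomb.
Qed.

(** Each [j] with [`|j| <= n] occurs once for every [k] between [`|j|] and [n]:
    the repetitions carry the Cesaro weights. *)
Definition cesaro_seq (n : nat) : seq int := flatten [seq sym_range k | k <- iota 0 n.+1].

Lemma cesaro_meanE (u : int -> R[i]) n :
  cesaro_mean u n = \sum_(j <- cesaro_seq n) (n.+1%:R^-1)%:C * u j.
Proof.
rewrite -mulr_sumr /cesaro_mean /cesaro_seq big_flatten big_map; congr (_ * _).
by rewrite -[iota 0 n.+1]/(index_iota 0 n.+1) big_mkord.
Qed.

Context (f : R -> R[i]) (hf : C_circle f).

(** Both processes are limits of images of the trigonometric polynomials given
    by Fejer's theorem: for [S t] because convergence in quadratic mean implies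
    Cesaro convergence, and for the expansion of [f (t + u)] in the basis [e]
    because the isometry is continuous. *)
Lemma gauss_psum_fourier (W : int -> T -> R[i]) (t : R) (St : T -> R[i]) :
  (forall n, cL2 P setT (W n)) ->
  (forall n, (fun N => sqnorm P setT (fun w => gsum (character n) N w - W n w)) @ \oo --> 0%E) ->
  L2_sum P (fun n w => fourier_coef f n * W n w * cexp1 (n%:~R * t)) St ->
  (fun N => sqnorm P setT (fun w => gsum (fun u => f (t + u)) N w - St w)) @ \oo --> 0%E.
Proof.
move=> LW cW [LSt cS]; have mSt := LSt.1; have mW n := (LW n).1.
have mf := C_circle_measurable hf; have [B B0 hB] := C_circle_bounded hf.
pose psum k w := \sum_(j <- sym_range k) fourier_coef f j * W j w * cexp1 (j%:~R * t).
have Lpsum k : cL2 P setT (psum k).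
  apply: cL2_sum => // j _.
  have := cL2Z measurableT (fourier_coef f j * cexp1 (j%:~R * t)) (LW j).
  by under eq_fun do rewrite mulrAC.
have LpS k : cL2 P setT (fun w => psum k w - St w).
  have := cL2D measurableT (Lpsum k) (cL2Z measurableT (-1) LSt).
  by under eq_fun do rewrite mulN1r.
have mpS k : cmeasurable (fun w => psum k w - St w) := (LpS k).1.
have {}cS : (fun N => sqnorm P setT (fun w => psum N w - St w)) @ \oo --> 0%E.
  move: cS; under eq_fun => N.
    under eq_fun => w do rewrite (big_sym_range (fun n => fourier_coef f n * W n w * cexp1 (n%:~R * t))).
    over.
  exact.
pose c M j := (M.+1%:R^-1)%:C * (fourier_coef f j * cexp1 (j%:~R * t)).
pose V M w := \sum_(j <- cesaro_seq M) c M j * W j w.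
have mV M : cmeasurable (V M).
  by apply: cmeasurable_sum => j; apply: cmeasurableM => //; exact: cmeasurable_cst.
have VSE M : (fun w => V M w - St w) =
    (fun w => (M.+1%:R^-1)%:C * \sum_(k < M.+1) (psum k w - St w)).
  apply/funext => w; rewrite sumrB mulrBr; congr (_ - _).
    transitivity (cesaro_mean (fun j => fourier_coef f j * W j w * cexp1 (j%:~R * t)) M) => //.
    by rewrite cesaro_meanE; apply: eq_bigr => j _; rewrite /c -[LHS]mulrA [_ * W j w]mulrAC.
  rewrite sumr_const card_ord -[St w *+ _]mulr_natl mulrA.
  by rewrite -(rmorph_nat (real_complex R)) -rmorphM mulVf ?rmorph1 ?mul1r// pnatr_eq0.
have cV : (fun M => sqnorm P setT (fun w => V M w - St w)) @ \oo --> 0%E.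
  under eq_fun do rewrite VSE.
  apply: (@sqnorm_cesaro_cvg0 _ _ _ P (fun k w => psum k w - St w)) => // k.
  exact: (LpS k).2.
pose ft u := f (t + u).
have mft : cmeasurable ft.
  have mt : measurable_fun setT (fun u : R => t + u) by exact: measurable_funD.
  by have [mr mi] := mf; split; [exact: (measurableT_comp mr mt)|exact: (measurableT_comp mi mt)].
have [Lft _] := cL2_spectral_bounded mft (fun u => hB (t + u)).
pose sg M u := \sum_(j <- cesaro_seq M) c M j * character j u.
have sgE M u : sg M u = cesaro_mean (fun j => fourier_coef f j * cexp1 (j%:~R * (t + u))) M.
  rewrite cesaro_meanE; apply: eq_bigr => j _.
  by rewrite /c /character -!mulrA mulrDr cexp1D.
have gsgE k N w : gsum (sg k) N w =
    \sum_(j <- cesaro_seq k) c k j * gsum (character j) N w.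
  exact: gauss_psum_lincomb.
have Lsg M : cL2 mu D (sg M) by apply: cL2_sum => // j _; exact: cL2Z.
have [C C0 hC] := gauss_psum_moments mZ indZ stdZ he ortho 1.
apply/cvge0_le; first by move=> N; exact: sqnorm_ge0.
move=> eps eps0.
(* Three errors of [eps / 16], two of them counted four times and one twice. *)
have eps16 : 0 < eps / 16 by rewrite divr_gt0.
have C1 : 0 < C + 1 by rewrite ltr_wpDl.
pose dl := Num.min 1 (eps / 16 / (C + 1)).
have dl0 : 0 < dl by rewrite lt_min ltr01 !divr_gt0.
have [M1 hM1] := fejer_uniform hf dl0.
have /cvge0_le/(_ _ eps16) := cV; move=> /(_ (fun n => sqnorm_ge0 _ _ _))[M2 hM2].
pose M := maxn M1 M2.
have cgV : (fun N => sqnorm P setT (fun w => gsum (sg M) N w - V M w)) @ \oo --> 0%E.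
  under eq_fun => N.
    under eq_fun => w do rewrite gsgE.
    over.
  exact: sqnorm_cvg0_lincomb.
have /cvge0_le/(_ _ eps16) := cgV; move=> /(_ (fun n => sqnorm_ge0 _ _ _))[N hN].
exists N => n Nn.
have mdiff : cmeasurable (fun u => ft u - sg M u) by apply: cmeasurableB => //; exact: (Lsg M).1.
have [Ldiff diff_le] : cL2 mu D (fun u => ft u - sg M u) /\
    fine (sqnorm mu D (fun u => ft u - sg M u)) <= dl ^+ 2.
  apply: cL2_spectral_bounded => // u; rewrite sgE; apply: hM1; exact: leq_maxl.
have first_le : (sqnorm P setT (fun w => gsum (fun u => ft u - sg M u)%R n w) <= (eps / 16)%:E)%E.
  have := hC _ n _ Ldiff diff_le; rewrite muln1 expr1 => /le_trans; apply.
  rewrite lee_fin; apply: (@le_trans _ _ ((C + 1) * dl)).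
    apply: ler_pM => //; [exact: sqr_ge0|by rewrite lerDl|].
    by rewrite expr2 ler_piMr ?(ltW dl0)// ge_min lexx.
  by rewrite mulrC -ler_pdivlMr// ge_min lexx orbT.
have -> : (fun w => gsum ft n w - St w) =
    (fun w => (gsum (fun u => ft u - sg M u) n w + (gsum (sg M) n w - V M w)) + (V M w - St w)).
  apply/funext => w.
  have -> : gsum (fun u => ft u - sg M u) n w = gsum ft n w - gsum (sg M) n w.
    exact: gauss_psumB.
  by rewrite subrKA subrKA.
have mgV : cmeasurable (fun w => gsum (sg M) n w - V M w) by exact: cmeasurableB.
have mVS : cmeasurable (fun w => V M w - St w) by exact: cmeasurableB.
apply: (le_trans (sqnormD P measurableT _ mVS)); first exact: cmeasurableD.
apply: (@le_trans _ _ (2%:E * (2%:E * (eps / 16)%:E + 2%:E * (eps / 16)%:E) + 2%:E * (eps / 16)%:E)%E).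
  apply: leeD; apply: lee_wpmul2l => //; last by apply: hM2; exact: leq_maxr.
  apply: (le_trans (sqnormD P measurableT (mgsum _ _) mgV)).
  by apply: leeD; apply: lee_wpmul2l => //; exact: hN.
apply: (@le_trans _ _ (2 * (2 * (eps / 16) + 2 * (eps / 16)) + 2 * (eps / 16))%:E) => //.
rewrite lee_fin (_ : 2 * _ + _ = eps * (10 / 16)); last by field.
by rewrite ler_piMr ?(ltW eps0)//; lra.
Qed.

End spectral_representation.
(** * Almost surely bounded Gaussian processes *)

Lemma cL2_of_fgn_moments (R : realType) d (T : measurableType d)
    (P : probability T R) (H : R) (W : int -> T -> R[i]) :
  (forall n, cmeasurable (W n)) -> fgn_moments P H W -> forall n, cL2 P setT (W n).
Proof.
move=> mW /(_ 1%N)[C C0 hC] n; split=> //.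
have := hC [:: n] (fun=> 1) isT; rewrite muln1 expr1.
under eq_integral do rewrite big_seq1 mul1r.
by move=> h; rewrite (le_lt_trans h)// ltry.
Qed.

(** The basis expansion of [f (t + u)] defines the same process as a Fourier
    series driven by a noise with the covariance [fgn_cov], to which
    [random_fourier_series_bounded] applies. *)
Theorem class_PH_of_decay (R : realType) (f : R -> R[i]) (H alpha K : R) :
  2^-1 <= H -> H < alpha -> 0 < K ->
  (forall n : int, n != 0 -> cmod (fourier_coef f n) <= K * (`|n%:~R| `^ (- alpha))) ->
  C_circle f -> class_PH H f.
Proof.
move=> H2 Ha K0 ha hf mu spec; split=> // d T P A e Z [he ortho _] indZ stdZ.
(* Extending by 0 outside [A] makes the whole family measurable and keeps the
   sums over [A]. *)
pose Z' n := if n \in A then Z n else (fun=> 0).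
have Z'E n : A n -> Z' n = Z n by move=> An; rewrite /Z' mem_set.
have mZ' n : cmeasurable (Z' n).
  rewrite /Z'; case: ifPn => [/set_mem An|_]; last exact: cmeasurable_cst.
  by have [mZ _] := indZ; exact: mZ.
have indZ' : independent_family P A Z'.
  split=> [//|s B us sA mB]; have [_ /(_ s B us sA mB) h] := indZ.
  rewrite (_ : [set w | _] = [set w | forall n, n \in s ->
      B n (complex.Re (Z n w), complex.Im (Z n w))]); last first.
    apply/seteqP; split => w /= hw n ns; have := hw n ns; by rewrite Z'E//; exact: sA.
  apply: (etrans h); rewrite big_seq [RHS]big_seq.
  by apply: eq_bigr => n ns; rewrite Z'E//; exact: sA.
have stdZ' n : A n -> standard_complex_gaussian P (Z' n).
  by move=> An; rewrite Z'E//; exact: stdZ.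
have [W [mW momW cW]] := noise_of_spectral_measure H2 spec mZ' indZ' stdZ' he ortho.
have [S [hS bS]] := random_fourier_series_bounded H2 Ha K0 mW momW ha.
exists S; split=> // t; split; first exact: (hS t).1.
have lim := gauss_psum_fourier spec mZ' indZ' stdZ' he ortho hf
  (cL2_of_fgn_moments mW momW) cW (hS t).
apply: cvg_trans lim; apply: near_eq_cvg; apply: nearW => N.
congr sqnorm; apply/funext => w.
congr (_ - _); rewrite gauss_psumE.
rewrite -(big_sym_range (fun n => if n \in A then inner mu (fun u => f (t + u)) (e n) * Z' n w else 0)).
apply: eq_bigr => k _; case: ifPn => // /set_mem Ak.
by rewrite Z'E.
Qed.

Theorem corollary1 (R : realType) (f : R -> R[i]) (hf : L2_circle f)
  (H : R) (hH1 : 2^-1 <= H) (hH2 : H < 1)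
  (d : measure_display) (Omega : measurableType d) (P : probability Omega R)
  (Delta : int -> Omega -> R[i]) (hDelta : complex_fgn P H Delta)
  (hdecay : exists alpha K : R, [/\ H < alpha, 0 < K &
     forall n : int, n != 0 ->
       cmod (fourier_coef f n) <= K * (`|n%:~R| `^ (- alpha))]) :
  (exists S : R -> Omega -> R[i],
     (forall t : R, L2_sum P
        (fun n w => fourier_coef f n * Delta n w * cexp1 (n%:~R * t)) (S t)) /\
     bounded_as P S) /\
  (C_circle f ->
   (\esum_(n in [set: int]) (cmod (fourier_coef f n))%:E = +oo)%E ->
   class_PH H f /\ ~ wiener_algebra f).
Proof.
have [alpha [K [Ha K0 ha]]] := hdecay; split.
  exact: (random_fourier_series_bounded hH1 Ha K0 (complex_fgn_measurable hDelta)
    (complex_fgn_moments hH1 hDelta) ha).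
move=> cf sum_oo; split; first exact: class_PH_of_decay hH1 Ha K0 ha cf.
move=> [_]; rewrite /summable.
under eq_esum do rewrite gee0_abs ?lee_fin ?cmod_ge0//.
by rewrite sum_oo ltxx.
Qed.
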